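(* Suppose the system $\partial_t U=\mathcal A U+F$ satisfies assumptions (I), (P), (H) of the context and is semi-strictly hyperbolic, i.e. there is $d_0>0$ with $|D_{H,ii}-D_{H,jj}|\ge d_0$ on $Z_H$ for $i\ne j$. Let $m_P\in\mathbb N_0$ be sufficiently large (depending on $a_P,B_P$), $m_H\in\mathbb N$ sufficiently large (depending on $\ell_*,B_H$), and $\rho_0$ sufficiently small (with respect to $m_P,m_H$). Let $U_A,F_A$ be the renormalizations of $U,F$ given by $$U_A|_{Z_P\setminus Z_I}:=\mathcal E_PQ_P^{(m_P)}M_PU,\quad U_A|_{Z_I}:=U,\quad U_A|_{Z_H\setminus Z_I}:=\mathcal E_HQ_H^{(m_H)}M_HU,$$ and likewise for $F_A$ with $F$ in place of $U$. Let $U$ be a solution of the system with $\int_0^T|F_A(\tau,\xi)|\,d\tau<\infty$ for all $\xi\in\mathbb R^d$, and let $u_A(\xi)=\lim_{\tau\searrow0}U_A(\tau,\xi)$, $\xi\in\mathbb R^d$. Let $s\in\mathbb R$ and suppose $$\int_{\mathbb R^d}\langle\xi\rangle^{2s}|u_A(\xi)|^2\,d\xi<\infty,\qquad\int_{Z_P}\langle\xi\rangle^{2s}\big|\big(\mathcal E_PQ_P^{(m_P)}M_PF\big)(\tau,\xi)\big|^2\,d\xi\,d\tau<\infty.$$ Then, for any $\delta>0$, $$\lim_{t\searrow0}\int_{\{\xi\in\mathbb R^d:\,(t,\xi)\in Z_P\}}\langle\xi\rangle^{2(s-\delta)}|U_A(t,\xi)-u_A(\xi)|^2\,d\xi=0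.$$
   Context: Conventions. $\mathbb N=\{1,2,\dots\}$, $\mathbb N_0=\mathbb N\cup\{0\}$, $\imath=\sqrt{-1}$, $\langle\eta\rangle=(1+|\eta|^2)^{1/2}$; $\mathbb C^n\otimes\mathbb C^n$ denotes $n\times n$ complex matrices. Functions of $\xi$ that are integrated are measurable. Setting. $d,n\in\mathbb N$, $T>0$, $\ell\in(-1,\infty)^d$, $\ell_*=\min_i\ell_i$, $\alpha>0$. $\lambda:[0,T]\to\mathbb R^d\otimes\mathbb R^d$ has the form $\lambda=\lambda^0+\lambda^*(t)$ with $\lambda^0$ constant, $\lambda^*$ smooth on $(0,T]$, $|(t\partial_t)^k\lambda^*|\le C_kt^\alpha$ for every $k\in\mathbb N$. Put $\mathfrak H(t,\xi)=[\sum_{i,j}t^{\ell_i+\ell_j}\lambda_{ij}(t)\xi_i\xi_j]^{1/2}$ and assume $\mathfrak H^2\ge\lambda_0\sum_it^{2\ell_i}\xi_i^2$ for some $\lambda_0>0$. The system is $\partial_tU=\mathcal AU+F$ on $(0,T]_t\times\mathbb R^d_\xi$, with $F\in C((0,T]\times\mathbb R^d;\mathbb C^n)$ and $\mathcal A:(0,T]\times\mathbb R^d\to\mathbb C^n\otimes\mathbb C^n$; it is an ODE in $t$ for each fixed $\xi$, and solutions are $C^1$ in $t\in(0,T]$ for each $\xi$. Rescaled time and zones. $\langle\langle\xi\rangle\rangle=\max_i\langle\xi_i\rangle^{1/(\ell_i+1)}$, $z=\langle\langle\xi\rangle\rangle t$, $\mathfrak Z=\langle\langle\xi\rangle\rangle^{-1}\mathfrak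 H$, $\partial_z=\langle\langle\xi\rangle\rangle^{-1}\partial_t$ (so $z\partial_z=t\partial_t$). For small $\rho_0\in(0,1)$, the zones are the subsets of $(0,T]\times\mathbb R^d$: $Z_P=\{z\le\rho_0\}$, $Z_I=\{\rho_0\le z\le\rho_0^{-1}\}$, $Z_H=\{z\ge\rho_0^{-1}\}$. All hypotheses on zones are understood to hold for all sufficiently small $\rho_0$, the objects for smaller $\rho_0$ being restrictions of those for larger $\rho_0$. Symbol classes. For $V\subseteq(0,T]\times\mathbb R^d$, a normed space $X$ and $a\in\mathbb R$, $\mathcal S^a(V;X)$ is the set of continuous $f:V\to X$, smooth in $t$ for each $\xi$, with $|(z\partial_z)^kf|\le C_kz^a$ on $V$ for all $k\in\mathbb N_0$; $\mathcal S^a_*(V;X)$ is defined likewise with bounds $C_kz^a(1+|\log z|)^p$ for some $p\in\mathbb N_0$ independent of $k$. Below $X=\mathbb C^n\otimes\mathbb C^n$. (I) $\langle\langle\xi\rangle\rangle^{-1}\mathcal A\in\mathcal S^0(Z_I;X)$. (P) On $Z_P$: $M_P\mathcal AM_P^{-1}+(\partial_tM_P)M_P^{-1}=t^{-1}B_P+\langle\langle\xi\rangle\rangle R_P$, with $M_P$ invertible, $M_P,M_P^{-1}\in\mathcal S^0(Z_P;X)$; $B_P\in\mathcal S^0(Z_P;X)$ independent of $t$ and everywhere in Jordan normal form (eigenvalues on the diagonal, ones on the superdiagonal within blocks); $R_P\in\mathcal S^{a_P}_*(Z_P;X)$ for some $a_P>-1$. (H) On $Z_H$: $M_H\mathcal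 AM_H^{-1}+(\partial_tM_H)M_H^{-1}=\imath\mathfrak HD_H+t^{-1}B_H+\langle\langle\xi\rangle\rangle R_H$, with $M_H$ invertible, $M_H,M_H^{-1}\in\mathcal S^0(Z_H;X)$; $B_H\in\mathcal S^0(Z_H;X)$ of the form $B_H(t,\xi)=B_{H,\infty}(t,\xi/|\xi|)$; $D_H\in\mathcal S^0(Z_H;X)$ everywhere diagonal and real-valued; $R_H\in\mathcal S^{a_H}(Z_H;X)$ for some $a_H<-1$. Renormalization on $Z_P$. Fix sequences, $m\in\mathbb N$: $D_P^{(m)}\in\mathcal S_*^{m(a_P+1)-1}(Z_P;X)$ everywhere diagonal, $N_P^{(m)}\in\mathcal S_*^{m(a_P+1)}(Z_P;X)$, $R_P^{(m)}\in\mathcal S_*^{m(a_P+1)+a_P}(Z_P;X)$, such that, with $Q_P^{(m)}=I_n+\sum_{k=1}^mN_P^{(k)}$, $$R_P^{(m)}=\sum_{k=1}^m\partial_zN_P^{(k)}+Q_P^{(m)}(z^{-1}B_P+R_P)-\Big(z^{-1}B_P+\sum_{k=1}^mD_P^{(k)}\Big)Q_P^{(m)};$$ also $Q_P^{(0)}=I_n$, $R_P^{(0)}=R_P$. Put $\mathcal E_P=\exp(-(\log z)B_P)$. Renormalization on $Z_H$. Fix sequences, $m\in\mathbb N$: $D_H^{(m)}\in\mathcal S^{-(m-1)(\ell_*+1)-1}(Z_H;X)$ diagonal with $D_H^{(1)}=\operatorname{diag}(z^{-1}B_{H,ii}+R_{H,ii})_{i=1}^n$, $N_H^{(m)}\in\mathcal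 S^{-m(\ell_*+1)}(Z_H;X)$, $R_H^{(m)}\in\mathcal S^{-m(\ell_*+1)-1}(Z_H;X)$, such that, with $Q_H^{(m)}=I_n+\sum_{k=1}^mN_H^{(k)}$, $$R_H^{(m)}=\sum_{k=1}^m\partial_zN_H^{(k)}+Q_H^{(m)}(\imath\mathfrak ZD_H+z^{-1}B_H+R_H)-\Big(\imath\mathfrak ZD_H+\sum_{k=1}^mD_H^{(k)}\Big)Q_H^{(m)}.$$ Put $b_{H,i}(t,\xi)=\int_{\langle\langle\xi\rangle\rangle^{-1}\rho_0^{-1}}^t\tau^{-1}B_{H,ii}(\tau,\xi)\,d\tau$ and $\mathcal E_H=\operatorname{diag}(e^{-b_{H,1}},\dots,e^{-b_{H,n}})$ on $Z_H$. *)

(* Defs.v *)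
From HB Require Import structures.
From mathcomp Require Import all_boot all_order all_algebra.
From mathcomp Require Import all_classical all_reals all_analysis.
From mathcomp Require Import complex.

Set Implicit Arguments.
Unset Strict Implicit.
Unset Printing Implicit Defensive.

Import Order.TTheory GRing.Theory Num.Theory.
Import numFieldNormedType.Exports.

Local Open Scope classical_set_scope.
Local Open Scope ring_scope.
Local Open Scope complex_scope.

(* R[i] carries the topology given by its modulus. *)
HB.instance Definition _ (R : rcfType) := NormedModule.copy R[i] R[i]^o.

(* Lebesgue measure on R^n, realised on n.-tuple R (the library puts the
   product sigma-algebra on tuples, not on row vectors): the image of
   lebesgue_measure \x lebesgue_measure_tuple under (x, y) |-> x :: y. *)
Section lebesgue_tuple.
Context {R : realType}.
Local Notation mR := (measurableTypeR R).

Definition cons_pair n (p : mR * n.-tuple mR) : n.+1.-tuple mR :=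
  [tuple of p.1 :: p.2].

Lemma measurable_cons_pair n : measurable_fun [set: mR * n.-tuple mR] (@cons_pair n).
Proof. by apply: measurable_cons; [exact: measurable_fst|exact: measurable_snd]. Qed.

Section cons_measure.
Context (mu1 : {sigma_finite_measure set mR -> \bar R}).
Context n (mu : {sigma_finite_measure set (n.-tuple mR) -> \bar R}).

Definition cons_measure : set (n.+1.-tuple mR) -> \bar R :=
  pushforward (mu1 \x mu)%E (@cons_pair n).

Let cons_measure0 : cons_measure set0 = 0%E.
Proof. by rewrite /cons_measure /pushforward preimage_set0 measure0. Qed.

Let cons_measure_ge0 B : (0 <= cons_measure B)%E.
Proof. by rewrite /cons_measure /pushforward measure_ge0. Qed.

Let cons_measure_additive : semi_sigma_additive cons_measure.
Proof.
move=> F mF tF mUF; rewrite /cons_measure /pushforward preimage_bigcup.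
have mc k : measurable (@cons_pair n @^-1` F k).
  by rewrite -[X in measurable X]setTI; exact: measurable_cons_pair.
apply: measure_semi_sigma_additive => //.
- apply/trivIsetP => /= i j _ _ ij; rewrite -preimage_setI.
  by move/trivIsetP : tF => /(_ _ _ _ _ ij) ->//; rewrite preimage_set0.
- rewrite -preimage_bigcup -[X in measurable X]setTI.
  exact: measurable_cons_pair.
Qed.

HB.instance Definition _ := isMeasure.Build _ _ _ cons_measure
  cons_measure0 cons_measure_ge0 cons_measure_additive.

Let cons_measure_sigma_finite : sigma_finite setT cons_measure.
Proof.
have /sigma_finiteP[F [TF ndF Foo]] := sigma_finiteT mu1.
have /sigma_finiteP[G [TG ndG Goo]] := sigma_finiteT mu.
pose u (x : n.+1.-tuple mR) : mR * n.-tuple mR := (thead x, [tuple of behead x]).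
have mu_ : measurable_fun setT u.
  apply: measurable_fun_pair; first exact: measurable_tnth.
  exact: measurable_behead.
have uK p : u (cons_pair p) = p.
  by case: p => x y; congr pair; apply/val_inj.
exists (fun k => u @^-1` (F k `*` G k)).
  rewrite -preimage_bigcup predeqE => x; split=> // _ /=.
  have [k _ Fk] : (\bigcup_k F k) (u x).1 by rewrite -TF.
  have [l _ Gl] : (\bigcup_k G k) (u x).2 by rewrite -TG.
  exists (maxn k l) => //; split.
  - by move: (u x).1 Fk; exact/subsetPset/ndF/leq_maxl.
  - by move: (u x).2 Gl; exact/subsetPset/ndG/leq_maxr.
move=> k; have [? ?] := Foo k; have [? ?] := Goo k; split.
  by rewrite -[X in measurable X]setTI; apply: mu_ => //; exact: measurableX.
rewrite /cons_measure /pushforward (_ : _ @^-1` _ = F k `*` G k); last first.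
  by apply/seteqP; split=> p; rewrite /preimage /mkset uK.
by rewrite product_measure1E// lte_mul_pinfty// ge0_fin_numE.
Qed.

HB.instance Definition _ := Measure_isSigmaFinite.Build _ _ _ cons_measure
  cons_measure_sigma_finite.

End cons_measure.

Fixpoint lebesgue_measure_tuple n :
    {sigma_finite_measure set (n.-tuple mR) -> \bar R} :=
  match n with
  | 0 => \d_([tuple] : 0.-tuple mR)
  | m.+1 => cons_measure (@lebesgue_measure R) (lebesgue_measure_tuple m)
  end.

Lemma lebesgue_measure_tuple_box n (B : 'I_n -> set mR) :
  (forall i, measurable (B i)) ->
  lebesgue_measure_tuple n [set x | forall i, B i (tnth x i)] =
  (\prod_(i < n) lebesgue_measure (B i))%E.
Proof.
elim: n B => [|n IH] B mB.
  by rewrite big_ord0 /= diracE mem_set// => -[].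
rewrite big_ord_recl -IH => [|i]; last exact: mB.
rewrite /= /cons_measure /pushforward -product_measure1E//; last first.
  rewrite (_ : mkset _ = \bigcap_(i in [set: 'I_n])
      (@tnth n mR ^~ i @^-1` B (lift ord0 i))).
    apply: fin_bigcap_measurable => [|i _]; first exact: finite_finset.
    by rewrite -[X in measurable X]setTI; apply: measurable_tnth.
  by apply/seteqP; split=> [x /= h i _|x /= h i]; exact: h.
congr (product_measure1 _ _ _); apply/seteqP; split=> -[x y] /=.
  move=> h; split; first exact: (h ord0).
  by move=> i; have := h (lift ord0 i); rewrite tnthS.
move=> [h0 h] i; case: (unliftP ord0 i) => [j|] ->; last exact: h0.
by rewrite tnthS; exact: h.
Qed.

End lebesgue_tuple.
Arguments lebesgue_measure_tuple : clear implicits.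

Definition row_of_tuple (R : realType) d (x : d.-tuple R) : 'rV[R]_d :=
  \row_i tnth x i.

Section norms.
Context {R : realType}.

Definition rnorm d (xi : 'rV[R]_d) : R := Num.sqrt (\sum_i xi 0 i ^+ 2).

(* Euclidean norm on C^n (n x 1 matrices), Frobenius norm on matrices. *)
Definition cnorm m n (A : 'M[R[i]]_(m, n)) : R :=
  Num.sqrt (\sum_i \sum_j Normc.normc (A i j) ^+ 2).

Definition japanese (r : R) : R := Num.sqrt (1 + r ^+ 2).

(* <xi>^(2s) |v|^2 *)
Definition weighted_sq d n (s : R) (xi : 'rV[R]_d) (v : 'cV[R[i]]_n) : \bar R :=
  (japanese (rnorm xi) `^ (2 * s) * cnorm v ^+ 2)%:E.

Definition cexp (z : R[i]) : R[i] :=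
  (expR (complex.Re z))%:C * (cos (complex.Im z) +i* sin (complex.Im z)).

Definition expmx n (A : 'M[R[i]]_n) : 'M[R[i]]_n :=
  limn (series (fun k => (k`!%:R)^-1 *: A ^+ k)).

Definition cintegral (D : set R) (f : R -> R[i]) : R[i] :=
  (\int[lebesgue_measure]_(t in D) complex.Re (f t))
  +i* (\int[lebesgue_measure]_(t in D) complex.Im (f t)).

(* Lebesgue (as opposed to Borel) measurability: almost everywhere equality with
   a Borel function. *)
Definition lebesgue_measurable_on d n (D : set 'rV[R]_d)
    (f : 'rV[R]_d -> 'cV[R[i]]_n) : Prop :=
  exists g : d.-tuple (measurableTypeR R) -> 'cV[R[i]]_n,
    (forall i, measurable_fun setT (fun x => complex.Re (g x i 0)) /\
               measurable_fun setT (fun x => complex.Im (g x i 0))) /\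
    {ae lebesgue_measure_tuple R d, forall x,
      D (row_of_tuple x) -> f (row_of_tuple x) = g x}.

(* Derivative in t relative to I, one-sided at an endpoint of I. If t is an
   isolated point of I, every df qualifies. *)
Definition has_deriv_within p q (I : set R) (f : R -> 'M[R[i]]_(p, q)) (t : R)
    (df : 'M[R[i]]_(p, q)) : Prop :=
  ((s - t)^-1)%:C *: (f s - f t) @[s --> within I t^'] --> df.

(* f is smooth on I and g k = (t d/dt)^k f on I. *)
Definition iterated_tdt p q (I : set R) (f : R -> 'M[R[i]]_(p, q))
    (g : nat -> R -> 'M[R[i]]_(p, q)) : Prop :=
  (forall t, I t -> g 0%N t = f t) /\
  (forall k t, I t -> has_deriv_within I (g k) t ((t^-1)%:C *: g k.+1 t)).

End norms.

Section setting.
Context {R : realType} {d n : nat}.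
Implicit Types (T rho a : R) (ell : 'I_d -> R) (t : R) (xi : 'rV[R]_d).
Implicit Types (V : set (R * 'rV[R]_d)).
Implicit Types (lam : R -> 'M[R]_d).
Local Notation matfun := (R -> 'rV[R]_d -> 'M[R[i]]_n).
Local Notation vecfun := (R -> 'rV[R]_d -> 'cV[R[i]]_n).
Implicit Types (A M B D Rm : matfun) (N Ds Ns Rs : nat -> matfun).

Definition lambda_form T alpha lam : Prop :=
  exists (lam0 : 'M[R]_d) (lam' : R -> 'M[R]_d),
    (forall t, 0 <= t <= T -> lam t = lam0 + lam' t) /\
    exists g, iterated_tdt `]0, T] (fun t => map_mx (real_complex R) (lam' t)) g /\
      forall k, (0 < k)%N -> exists C : R, forall t, 0 < t <= T ->
        cnorm (g k t) <= C * t `^ alpha.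

Definition frakH ell lam t xi : R :=
  Num.sqrt (\sum_i \sum_j t `^ (ell i + ell j) * lam t i j * xi 0 i * xi 0 j).

Definition frakH_coercive T ell lam (lambda0 : R) : Prop :=
  forall t xi, 0 < t <= T ->
    lambda0 * (\sum_i t `^ (2 * ell i) * xi 0 i ^+ 2) <= frakH ell lam t xi ^+ 2.

(* <<xi>>; the base value 0 of the maximum is irrelevant, all terms being >= 1. *)
Definition bracket ell xi : R :=
  \big[Num.max/0]_(i < d) japanese (xi 0 i) `^ (ell i + 1)^-1.

Definition zvar ell t xi : R := bracket ell xi * t.

Definition frakZ ell lam t xi : R := (bracket ell xi)^-1 * frakH ell lam t xi.

Definition ZP T ell rho : set (R * 'rV[R]_d) :=
  [set p | 0 < p.1 <= T /\ zvar ell p.1 p.2 <= rho].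
Definition ZI T ell rho : set (R * 'rV[R]_d) :=
  [set p | 0 < p.1 <= T /\ rho <= zvar ell p.1 p.2 <= rho^-1].
Definition ZH T ell rho : set (R * 'rV[R]_d) :=
  [set p | 0 < p.1 <= T /\ rho^-1 <= zvar ell p.1 p.2].

Definition tsection V xi : set R := [set t | V (t, xi)].

Definition continuous_on p q V (f : R -> 'rV[R]_d -> 'M[R[i]]_(p, q)) : Prop :=
  {within V, continuous (fun x : R * 'rV[R]_d => f x.1 x.2)}.

(* The classes S^a and S^a_*; note that z d/dz = t d/dt. *)
Definition symbol ell V a (f : matfun) : Prop :=
  continuous_on V f /\
  exists g : nat -> matfun,
    (forall xi, iterated_tdt (tsection V xi) (f^~ xi) (fun k => g k ^~ xi)) /\
    forall k, exists C : R, forall t xi, V (t, xi) ->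
      cnorm (g k t xi) <= C * zvar ell t xi `^ a.

Definition symbol_star ell V a (f : matfun) : Prop :=
  continuous_on V f /\
  exists g : nat -> matfun,
    (forall xi, iterated_tdt (tsection V xi) (f^~ xi) (fun k => g k ^~ xi)) /\
    exists p : nat, forall k, exists C : R, forall t xi, V (t, xi) ->
      cnorm (g k t xi) <=
        C * zvar ell t xi `^ a * (1 + `|ln (zvar ell t xi)|) ^+ p.

(* Upper Jordan form, entrywise: i and i+1 lie in the same block iff the
   (i, i+1) entry is 1. *)
Definition jordan_normal_form (B : 'M[R[i]]_n) : Prop :=
  (forall i j : 'I_n, j != i -> j != i.+1 :> nat -> B i j = 0) /\
  (forall i j : 'I_n, j = i.+1 :> nat ->
     B i j = 0 \/ (B i j = 1 /\ B i i = B j j)).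

Definition assumption_I T ell rho A : Prop :=
  symbol ell (ZI T ell rho) 0 (fun t xi => ((bracket ell xi)^-1)%:C *: A t xi).

Definition assumption_P T ell rho A aP M (B : 'rV[R]_d -> 'M[R[i]]_n) Rm : Prop :=
  let V := ZP T ell rho in
  [/\ forall t xi, V (t, xi) -> M t xi \in unitmx,
      symbol ell V 0 M /\ symbol ell V 0 (fun t xi => invmx (M t xi)),
      symbol ell V 0 (fun _ xi => B xi) /\
        (forall t xi, V (t, xi) -> jordan_normal_form (B xi)),
      symbol_star ell V aP Rm &
      forall t xi, V (t, xi) -> exists dM,
        has_deriv_within (tsection V xi) (M^~ xi) t dM /\
        M t xi *m A t xi *m invmx (M t xi) + dM *m invmx (M t xi) =
        (t^-1)%:C *: B xi + (bracket ell xi)%:C *: Rm t xi].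

Definition assumption_H T ell lam rho A aH M D B Rm : Prop :=
  let V := ZH T ell rho in
  [/\ forall t xi, V (t, xi) -> M t xi \in unitmx,
      symbol ell V 0 M /\ symbol ell V 0 (fun t xi => invmx (M t xi)),
      symbol ell V 0 B /\
        (exists Binf : matfun, forall t xi, V (t, xi) ->
           B t xi = Binf t ((rnorm xi)^-1 *: xi)),
      symbol ell V 0 D /\
        (forall t xi, V (t, xi) ->
           is_diag_mx (D t xi) /\ D t xi \is a mxOver Num.real) &
      symbol ell V aH Rm /\
      forall t xi, V (t, xi) -> exists dM,
        has_deriv_within (tsection V xi) (M^~ xi) t dM /\
        M t xi *m A t xi *m invmx (M t xi) + dM *m invmx (M t xi) =
        ('i * (frakH ell lam t xi)%:C) *: D t xi + (t^-1)%:C *: B t xi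
        + (bracket ell xi)%:C *: Rm t xi].

Definition semi_strictly_hyperbolic T ell rho D : Prop :=
  exists d0 : R, 0 < d0 /\
    forall t xi, ZH T ell rho (t, xi) -> forall i j : 'I_n, i != j ->
      d0 <= Normc.normc (D t xi i i - D t xi j j).

Definition Qmx N (m : nat) t xi : 'M[R[i]]_n :=
  1%:M + \sum_(1 <= k < m.+1) N k t xi.

(* The relation
     R^(m) = sum_(k <= m) d_z N^(k) + Q^(m) G - (G0 + sum_(k <= m) D^(k)) Q^(m)
   on V; d_z = <<xi>>^-1 d_t. *)
Definition renormalization_identity ell V (m : nat) (G G0 : matfun) Ds Ns Rs : Prop :=
  forall t xi, V (t, xi) -> exists dN : nat -> 'M[R[i]]_n,
    (forall k, (1 <= k <= m)%N ->
       has_deriv_within (tsection V xi) (Ns k ^~ xi) t (dN k)) /\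
    Rs m t xi =
      \sum_(1 <= k < m.+1) ((bracket ell xi)^-1)%:C *: dN k
      + Qmx Ns m t xi *m G t xi
      - (G0 t xi + \sum_(1 <= k < m.+1) Ds k t xi) *m Qmx Ns m t xi.

Definition renormalization_P T ell rho aP (B : 'rV[R]_d -> 'M[R[i]]_n) Rm
    Ds Ns Rs : Prop :=
  let V := ZP T ell rho in
  let G0 : matfun := fun t xi => ((zvar ell t xi)^-1)%:C *: B xi in
  (forall t xi, V (t, xi) -> Rs 0%N t xi = Rm t xi) /\
  forall m, (0 < m)%N ->
  [/\ symbol_star ell V (m%:R * (aP + 1) - 1) (Ds m),
      forall t xi, V (t, xi) -> is_diag_mx (Ds m t xi),
      symbol_star ell V (m%:R * (aP + 1)) (Ns m),
      symbol_star ell V (m%:R * (aP + 1) + aP) (Rs m) &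
      renormalization_identity ell V m
        (fun t xi => G0 t xi + Rm t xi) G0 Ds Ns Rs].

(* ls stands for the minimum of the ell i. *)
Definition renormalization_H T ell lam rho (ls : R) D B Rm Ds Ns Rs : Prop :=
  let V := ZH T ell rho in
  let G0 : matfun := fun t xi => ('i * (frakZ ell lam t xi)%:C) *: D t xi in
  (forall t xi, V (t, xi) ->
     Ds 1%N t xi =
     diag_mx (\row_i (((zvar ell t xi)^-1)%:C * B t xi i i + Rm t xi i i))) /\
  forall m, (0 < m)%N ->
  [/\ symbol ell V (- (m.-1%:R * (ls + 1)) - 1) (Ds m),
      forall t xi, V (t, xi) -> is_diag_mx (Ds m t xi),
      symbol ell V (- (m%:R * (ls + 1))) (Ns m),
      symbol ell V (- (m%:R * (ls + 1)) - 1) (Rs m) &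
      renormalization_identity ell V m
        (fun t xi => G0 t xi + ((zvar ell t xi)^-1)%:C *: B t xi + Rm t xi)
        G0 Ds Ns Rs].

Definition calEP ell (B : 'rV[R]_d -> 'M[R[i]]_n) t xi : 'M[R[i]]_n :=
  expmx ((- ln (zvar ell t xi))%:C *: B xi).

Definition bH ell rho B (i : 'I_n) t xi : R[i] :=
  cintegral `[(bracket ell xi)^-1 * rho^-1, t]
    (fun tau => (tau^-1)%:C * B tau xi i i).

Definition calEH ell rho B t xi : 'M[R[i]]_n :=
  diag_mx (\row_i cexp (- bH ell rho B i t xi)).

Definition renormP ell (B : 'rV[R]_d -> 'M[R[i]]_n) M N (m : nat)
    (W : vecfun) t xi : 'cV[R[i]]_n :=
  calEP ell B t xi *m Qmx N m t xi *m M t xi *m W t xi.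

Definition renormH ell rho B M N (m : nat) (W : vecfun) t xi : 'cV[R[i]]_n :=
  calEH ell rho B t xi *m Qmx N m t xi *m M t xi *m W t xi.

(* W |-> W_A. On (0, T] x R^d the last case is exactly ZH `\` ZI; the value
   outside this strip plays no role. *)
Definition renormalize T ell rho
    (BP : 'rV[R]_d -> 'M[R[i]]_n) (MP : matfun) (NP : nat -> matfun) (mP : nat)
    (BH MH : matfun) (NH : nat -> matfun) (mH : nat)
    (W : vecfun) t xi : 'cV[R[i]]_n :=
  if (t, xi) \in ZP T ell rho `\` ZI T ell rho then renormP ell BP MP NP mP W t xi
  else if (t, xi) \in ZI T ell rho then W t xi
  else renormH ell rho BH MH NH mH W t xi.

(* U(., xi) is C^1 on (0, T] and solves d_t U = A U + F there. *)
Definition is_solution T A (F U : vecfun) : Prop :=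
  forall xi,
    (forall t, 0 < t <= T ->
       has_deriv_within `]0, T] (U^~ xi) t (A t xi *m U t xi + F t xi)) /\
    {within `]0, T], continuous (fun t => A t xi *m U t xi + F t xi)}.

End setting.

Definition ell_star (R : realType) d (ell : 'I_d.+1 -> R) : R :=
  \big[Num.min/ell ord0]_(i < d.+1) ell i.

(* Main.v *)
Require Import Defs.
From mathcomp Require Import all_boot all_order all_algebra.
From mathcomp Require Import all_classical all_reals all_analysis.
From mathcomp Require Import complex measurable_realfun.
From mathcomp Require Import ring lra.

(** Why the theorem is true.

    Fix [xi], let L be its bracket and z = L t. In the zone of small z put V = M U,
    W = Q V and u = E W, where E = exp(- (log z) B). The renormalization identity and
    the system give ([mderiv_renorm], [mderiv_renormP])

      u' = L E (R + D Q) V + f,     f = E Q M F,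

    R being the remainder of order m and D the sum of the diagonal terms. Now Q is
    close to 1 for small z, so |V| <= 2 |W|, and the remainder contributes at most
    |E| |E^-1| |R| |u|, which is O(z^(aP - eps) |u|) once m is so large that
    z^(m (aP + 1)) beats |E| |E^-1|. The diagonal terms satisfy E D W = (E D E^-1) u,
    and E D E^-1 is a polynomial in log z with coefficients the iterated commutators
    of B with D (Hadamard's formula, [mexp_conj]): B being in Jordan form and D
    diagonal, these commutators live on higher and higher superdiagonals inside the
    blocks of B, and vanish after finitely many steps ([ad_jordan_nilpotent]). Altogether, with
    eps = (aP + 1) / 2 ([zone_constants]),

      |u'| <= K L z^(eps - 1) |u| + |f|.

    The coefficient L z^(eps - 1) has the primitive z^eps / eps, which is as small as
    we please when the zone is small. Hence u has a limit l at t = 0 and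
    ([singular_ode_limit], [zone_estimate], [renormalize_estimate])

      |u(t) - l| <= C (z^eps |l| + int_0^t |f|)

    with C independent of [xi].

    It remains to square, multiply by <xi>^(2 (s - delta)) and integrate in [xi]. As L
    grows at most polynomially in <xi>, lowering eps bounds z^(2 eps) <xi>^(- 2 delta)
    by a positive power of t ([weight_tradeoff]), so that the first term is
    O(t^(2 eta)) times the integral of <xi>^(2 s) |uA|^2. By Cauchy-Schwarz in time the
    second one is at most t times the time integral of <xi>^(2 s) |f|^2
    ([weighted_sq_estimate]), whose integral in [xi] is finite by Tonelli's theorem.
    Tonelli requires f to be measurable on the zone, which follows from the continuity
    of its factors; the other functions involved are only compared with measurable
    ones, using that the integral is monotone without measurability
    ([le_lower_integral]). *)

Set Implicit Arguments.
Unset Strict Implicit.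
Unset Printing Implicit Defensive.

Import Order.TTheory GRing.Theory Num.Theory.
Import numFieldNormedType.Exports.

Local Open Scope classical_set_scope.
Local Open Scope ring_scope.
Local Open Scope complex_scope.

Local Notation nc := Normc.normc.

(** * Entrywise norm of complex matrices *)

Section entrywise_norm.
Context {R : realType}.
Local Notation K := R[i].

Lemma normc_ge0 (x : K) : 0 <= nc x.
Proof. by case: x => a b; rewrite sqrtr_ge0. Qed.

Lemma ler_normcD (x y : K) : nc (x + y) <= nc x + nc y.
Proof. exact: le_normcD. Qed.

Lemma ler_normc_sum (I : Type) (r : seq I) (P : pred I) (F : I -> K) :
  nc (\sum_(i <- r | P i) F i) <= \sum_(i <- r | P i) nc (F i).
Proof.
elim/big_ind2: _ => [|x a y b xa yb|//]; first by rewrite Normc.normc0.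
exact: le_trans (ler_normcD _ _) (lerD xa yb).
Qed.

Lemma normc_real (r : R) : nc r%:C = `|r|.
Proof. by rewrite /= expr0n addr0 sqrtr_sqr. Qed.

Lemma ler_Re_normc (x : K) : `|complex.Re x| <= nc x.
Proof.
by case: x => a b /=; rewrite -sqrtr_sqr ler_wsqrtr// lerDl sqr_ge0.
Qed.

Lemma ler_Im_normc (x : K) : `|complex.Im x| <= nc x.
Proof.
by case: x => a b /=; rewrite -sqrtr_sqr ler_wsqrtr// lerDr sqr_ge0.
Qed.

Lemma ler_normc_ReIm (x : K) : nc x <= `|complex.Re x| + `|complex.Im x|.
Proof.
case: x => a b /=; rewrite -[leRHS]ger0_norm ?addr_ge0// -sqrtr_sqr.
rewrite ler_wsqrtr// sqrrD !real_normK ?num_real//.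
by rewrite lerD2r lerDl mulrn_wge0// mulr_ge0.
Qed.

(** Sum of the moduli of the entries: unlike the Frobenius norm it is
    submultiplicative for trivial reasons. *)
Definition mnorm m n (A : 'M[K]_(m, n)) : R := \sum_i \sum_j nc (A i j).

Lemma mnorm_ge0 m n (A : 'M[K]_(m, n)) : 0 <= mnorm A.
Proof. by do 2 (apply: sumr_ge0 => ? _); exact: normc_ge0. Qed.

Lemma ler_entry_mnorm m n (A : 'M[K]_(m, n)) i j : nc (A i j) <= mnorm A.
Proof.
rewrite /mnorm (bigD1 i)//= (bigD1 j)//= -addrA lerDl addr_ge0//.
  by apply: sumr_ge0 => ? _; exact: normc_ge0.
by do 2 (apply: sumr_ge0 => ? _); exact: normc_ge0.
Qed.

Lemma mnorm0 m n : mnorm (0 : 'M[K]_(m, n)) = 0.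
Proof. by do 2 (apply: big1 => ? _); rewrite mxE Normc.normc0. Qed.

Lemma mnormN m n (A : 'M[K]_(m, n)) : mnorm (- A) = mnorm A.
Proof. by do 2 (apply: eq_bigr => ? _); rewrite mxE normcN. Qed.

Lemma mnormB_sym m n (A B : 'M[K]_(m, n)) : mnorm (A - B) = mnorm (B - A).
Proof. by rewrite -mnormN opprB. Qed.

Lemma ler_mnormD m n (A B : 'M[K]_(m, n)) : mnorm (A + B) <= mnorm A + mnorm B.
Proof.
rewrite /mnorm -big_split; apply: ler_sum => i _.
rewrite -big_split; apply: ler_sum => j _.
by rewrite mxE ler_normcD.
Qed.

Lemma ler_mnormB m n (A B : 'M[K]_(m, n)) : mnorm (A - B) <= mnorm A + mnorm B.
Proof. by rewrite -(mnormN B) ler_mnormD. Qed.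

Lemma ler_mnorm_sum m n (I : Type) (r : seq I) (P : pred I) (F : I -> 'M[K]_(m, n)) :
  mnorm (\sum_(i <- r | P i) F i) <= \sum_(i <- r | P i) mnorm (F i).
Proof.
elim/big_ind2: _ => [|x a y b xa yb|//]; first by rewrite mnorm0.
exact: le_trans (ler_mnormD _ _) (lerD xa yb).
Qed.

Lemma mnormZ m n (a : K) (A : 'M[K]_(m, n)) : mnorm (a *: A) = nc a * mnorm A.
Proof.
rewrite /mnorm mulr_sumr; apply: eq_bigr => i _; rewrite mulr_sumr.
by apply: eq_bigr => j _; rewrite mxE Normc.normcM.
Qed.

Lemma mnormZr m n (a : R) (A : 'M[K]_(m, n)) : mnorm (a%:C *: A) = `|a| * mnorm A.
Proof. by rewrite mnormZ normc_real. Qed.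

Lemma ler_mnormM m n p (A : 'M[K]_(m, n)) (B : 'M[K]_(n, p)) :
  mnorm (A *m B) <= mnorm A * mnorm B.
Proof.
rewrite /mnorm mulr_suml; apply: ler_sum => i _.
have row_le k : \sum_j nc (B k j) <= \sum_k \sum_j nc (B k j).
  rewrite [leRHS](bigD1 k)//= lerDl.
  by do 2 (apply: sumr_ge0 => ? _); exact: normc_ge0.
apply: (@le_trans _ _ (\sum_j \sum_k nc (A i k) * nc (B k j))).
  apply: ler_sum => j _; rewrite mxE; apply: le_trans (ler_normc_sum _ _ _) _.
  by apply: ler_sum => k _; rewrite Normc.normcM.
rewrite exchange_big/= mulr_suml; apply: ler_sum => k _.
by rewrite -mulr_sumr ler_wpM2l// normc_ge0.
Qed.

Lemma mnorm1 n : mnorm (1%:M : 'M[K]_n) = n%:R.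
Proof.
rewrite /mnorm (eq_bigr (fun=> 1)) ?sumr_const ?card_ord// => i _.
rewrite (bigD1 i)//= mxE eqxx Normc.normc1 big1 ?addr0// => j.
by rewrite eq_sym mxE => /negbTE ->; rewrite Normc.normc0.
Qed.

Lemma cnorm_ge0 m n (A : 'M[K]_(m, n)) : 0 <= cnorm A.
Proof. exact: sqrtr_ge0. Qed.

Lemma ler_cnorm_mnorm m n (A : 'M[K]_(m, n)) : cnorm A <= mnorm A.
Proof.
rewrite /cnorm -[leRHS]ger0_norm ?mnorm_ge0// -sqrtr_sqr ler_wsqrtr//.
rewrite expr2 {2}/mnorm mulr_sumr; apply: ler_sum => i _.
rewrite mulr_sumr; apply: ler_sum => j _.
by rewrite expr2 ler_wpM2r ?normc_ge0 ?ler_entry_mnorm.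
Qed.

Lemma ler_entry_cnorm m n (A : 'M[K]_(m, n)) i j : nc (A i j) <= cnorm A.
Proof.
rewrite /cnorm -[leLHS]ger0_norm ?normc_ge0// -sqrtr_sqr ler_wsqrtr//.
rewrite (bigD1 i)//= (bigD1 j)//= -addrA lerDl addr_ge0//.
  by apply: sumr_ge0 => ? _; exact: sqr_ge0.
by do 2 (apply: sumr_ge0 => ? _); exact: sqr_ge0.
Qed.

Lemma ler_mnorm_cnorm m n (A : 'M[K]_(m, n)) : mnorm A <= (m * n)%:R * cnorm A.
Proof.
apply: (@le_trans _ _ (\sum_(i < m) \sum_(j < n) cnorm A)).
  by do 2 (apply: ler_sum => ? _); exact: ler_entry_cnorm.
rewrite (eq_bigr (fun=> cnorm A *+ n)) => [|i _]; last by rewrite sumr_const card_ord.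
by rewrite sumr_const card_ord -mulrnA mulnC mulr_natl.
Qed.

Lemma normr_mx_le m n (A : 'M[K]_(m, n)) : `|A| <= (mnorm A)%:C.
Proof.
rewrite /Num.Def.normr/=; have [->|/mx_norm_neq0[[i j] ->]] := eqVneq (mx_norm A) 0.
  by rewrite lecR mnorm_ge0.
by rewrite lecR ler_entry_mnorm.
Qed.

Lemma mnorm_le_normr m n (A : 'M[K]_(m, n)) :
  mnorm A <= (m * n)%:R * complex.Re `|A|.
Proof.
have entry i j : nc (A i j) <= complex.Re `|A|.
  suff : `|A i j| <= `|A| by rewrite lecE => /andP[_].
  rewrite [leRHS]/Num.Def.normr/= mx_normE.
  by apply: (le_bigmax _ (fun i : 'I_m * 'I_n => `|A i.1 i.2|%:nng) (i, j)).
apply: (@le_trans _ _ (\sum_(i < m) \sum_(j < n) complex.Re `|A|)).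
  by do 2 (apply: ler_sum => ? _); exact: entry.
rewrite (eq_bigr (fun=> complex.Re `|A| *+ n)) => [|i _]; last by rewrite sumr_const card_ord.
by rewrite sumr_const card_ord -mulrnA mulnC mulr_natl.
Qed.

(** The topology of matrices over R[i] is that of the real-valued norm. *)
Lemma cvg_mnormP (T : Type) (F : set_system T) (FF : Filter F) m n
    (f : T -> 'M[K]_(m, n)) (A : 'M[K]_(m, n)) :
  f x @[x --> F] --> A <-> mnorm (f x - A) @[x --> F] --> (0 : R).
Proof.
split=> fA.
- apply/cvgr0Pnorm_lt => e e0.
  have e1 : 0 < e / ((m * n).+1%:R) by rewrite divr_gt0.
  have := cvgr_distC_lt _ _ fA (e / ((m * n).+1%:R))%:C; rewrite ltcR => /(_ _ e1).
  apply: filterS => x fx.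
  rewrite ger0_norm ?mnorm_ge0//; apply: le_lt_trans (mnorm_le_normr _) _.
  have fx1 : complex.Re `|f x - A| < e / ((m * n).+1%:R).
    by move: fx; rewrite ltcE => /andP[_].
  apply: le_lt_trans (ler_wpM2l _ (ltW fx1)) _ => //.
  by rewrite mulrCA gtr_pMr// ltr_pdivrMr ?mul1r ?ltr_nat.
- apply/cvgrPdistC_lt => -[e b]; rewrite ltcE/= => /andP[/eqP -> e0].
  move: fA => /cvgr0Pnorm_lt /(_ e e0); apply: filterS => x.
  rewrite ger0_norm ?mnorm_ge0// => fx; apply: le_lt_trans (normr_mx_le _) _.
  by rewrite ltcR.
Qed.

End entrywise_norm.

(** * Limits and derivatives of complex matrix functions *)

Section matrix_calculus.
Context {R : realType}.
Local Notation K := R[i].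

Lemma cvg_mnorm0P (T : Type) (F : set_system T) (FF : Filter F) m n
    (f : T -> 'M[K]_(m, n)) (A : 'M[K]_(m, n)) :
  f x @[x --> F] --> A <->
  forall e : R, 0 < e -> \forall x \near F, mnorm (f x - A) < e.
Proof.
rewrite cvg_mnormP cvgr0Pnorm_lt; split=> H e e0; move: (H e e0);
  by apply: filterS => x; rewrite ger0_norm// mnorm_ge0.
Qed.

(** Squeeze principle behind the continuity of the matrix operations. *)
Lemma cvg_mx_bound (T : Type) (F : set_system T) (FF : Filter F) m n
    (f : T -> 'M[K]_(m, n)) (A : 'M[K]_(m, n)) (g : T -> R) :
  (\forall x \near F, mnorm (f x - A) <= g x) -> g x @[x --> F] --> 0 ->
  f x @[x --> F] --> A.
Proof.
move=> fg g0; apply/cvg_mnormP.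
apply: (@squeeze_cvgr _ _ _ _ (fun=> 0) g) => //; last exact: cvg_cst.
by move: fg; apply: filterS => x; rewrite mnorm_ge0.
Qed.

Lemma cvg_mulmx (T : Type) (F : set_system T) (FF : Filter F) m n p
    (f : T -> 'M[K]_(m, n)) (g : T -> 'M[K]_(n, p)) (A : 'M[K]_(m, n)) (B : 'M[K]_(n, p)) :
  f x @[x --> F] --> A -> g x @[x --> F] --> B ->
  f x *m g x @[x --> F] --> A *m B.
Proof.
move=> /cvg_mnormP fA /cvg_mnormP gB.
pose h x := mnorm (f x - A) * (mnorm (g x - B) + mnorm B) + mnorm A * mnorm (g x - B).
apply: (@cvg_mx_bound _ _ _ _ _ _ _ h).
  apply: nearW => x; rewrite /h.
  have -> : f x *m g x - A *m B = (f x - A) *m (g x - B + B) + A *m (g x - B).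
    by rewrite subrK mulmxBl mulmxBr addrA subrK.
  apply: le_trans (ler_mnormD _ _) (lerD _ (ler_mnormM _ _)).
  apply: le_trans (ler_mnormM _ _) _.
  by rewrite ler_wpM2l ?mnorm_ge0// ler_mnormD.
rewrite (_ : 0 = 0 * (0 + mnorm B) + mnorm A * 0 :> R); last by rewrite mul0r mulr0 addr0.
by apply: cvgD; apply: cvgM => //; [apply: cvgD => //|]; exact: cvg_cst.
Qed.

Lemma cvg_mxD (T : Type) (F : set_system T) (FF : Filter F) m n
    (f g : T -> 'M[K]_(m, n)) (A B : 'M[K]_(m, n)) :
  f x @[x --> F] --> A -> g x @[x --> F] --> B ->
  f x + g x @[x --> F] --> A + B.
Proof.
move=> /cvg_mnormP fA /cvg_mnormP gB.
apply: (@cvg_mx_bound _ _ _ _ _ _ _ (fun x => mnorm (f x - A) + mnorm (g x - B))).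
  by apply: nearW => x; rewrite opprD addrACA ler_mnormD.
by rewrite -[0]addr0; exact: cvgD.
Qed.

Lemma cvg_mx_Re (T : Type) (F : set_system T) (FF : Filter F) m n
    (f : T -> 'M[K]_(m, n)) (A : 'M[K]_(m, n)) i j :
  f x @[x --> F] --> A -> complex.Re (f x i j) @[x --> F] --> complex.Re (A i j).
Proof.
move=> /cvg_mnorm0P fA; apply/cvgrPdistC_lt => e /fA; apply: filterS => x.
apply: le_lt_trans; apply: le_trans (ler_entry_mnorm _ i j).
have -> : complex.Re (f x i j) - complex.Re (A i j) = complex.Re ((f x - A) i j).
  by rewrite !mxE raddfB.
exact: ler_Re_normc.
Qed.

Lemma cvg_mx_Im (T : Type) (F : set_system T) (FF : Filter F) m n
    (f : T -> 'M[K]_(m, n)) (A : 'M[K]_(m, n)) i j :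
  f x @[x --> F] --> A -> complex.Im (f x i j) @[x --> F] --> complex.Im (A i j).
Proof.
move=> /cvg_mnorm0P fA; apply/cvgrPdistC_lt => e /fA; apply: filterS => x.
apply: le_lt_trans; apply: le_trans (ler_entry_mnorm _ i j).
have -> : complex.Im (f x i j) - complex.Im (A i j) = complex.Im ((f x - A) i j).
  by rewrite !mxE raddfB.
exact: ler_Im_normc.
Qed.

Lemma cvg_sum_real (T I : Type) (F : set_system T) (FF : Filter F) (r : seq I)
    (f : I -> T -> R) (l : I -> R) :
  (forall i, f i x @[x --> F] --> l i) ->
  \sum_(i <- r) f i x @[x --> F] --> \sum_(i <- r) l i.
Proof.
move=> fl; elim: r => [|i r IH].
  by rewrite big_nil (_ : (fun _ => _) = fun=> 0); [exact: cvg_cst|apply/funext => x; rewrite big_nil].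
rewrite big_cons (_ : (fun _ => _) = fun x => f i x + \sum_(j <- r) f j x).
  exact: cvgD.
by apply/funext => x; rewrite big_cons.
Qed.

Lemma cvg_mx_ReIm (T : Type) (F : set_system T) (FF : Filter F) m n
    (f : T -> 'M[K]_(m, n)) (A : 'M[K]_(m, n)) :
  (forall i j, complex.Re (f x i j) @[x --> F] --> complex.Re (A i j)) ->
  (forall i j, complex.Im (f x i j) @[x --> F] --> complex.Im (A i j)) ->
  f x @[x --> F] --> A.
Proof.
move=> fRe fIm.
pose h i j x := `|complex.Re (f x i j) - complex.Re (A i j)| +
                `|complex.Im (f x i j) - complex.Im (A i j)|.
apply: (@cvg_mx_bound _ _ _ _ _ _ _ (fun x => \sum_i \sum_j h i j x)).
  apply: nearW => x; apply: ler_sum => i _; apply: ler_sum => j _.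
  by apply: le_trans (ler_normc_ReIm _) _; rewrite /h !mxE !raddfB.
suff : \sum_i \sum_j h i j x @[x --> F] --> \sum_(i < m) \sum_(j < n) (0 : R).
  by rewrite [X in _ --> X]big1// => i _; rewrite big1.
apply: (@cvg_sum_real _ _ _ FF _ (fun i x => \sum_j h i j x) (fun=> \sum_(j < n) 0)) => i.
apply: (@cvg_sum_real _ _ _ FF _ (h i) (fun=> 0)) => j.
rewrite -[0]addr0; apply: cvgD.
  by rewrite -(normr0 R) -(subrr (complex.Re (A i j))); apply: cvg_norm;
    apply: cvgB => //; exact: cvg_cst.
by rewrite -(normr0 R) -(subrr (complex.Im (A i j))); apply: cvg_norm;
  apply: cvgB => //; exact: cvg_cst.
Qed.

(** Two-sided derivative. [has_deriv_within] reduces to it at interior points of the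
    interval, where all the differentiation takes place. *)
Definition mderiv m n (f : R -> 'M[K]_(m, n)) (t : R) (df : 'M[K]_(m, n)) : Prop :=
  ((s - t)^-1)%:C *: (f s - f t) @[s --> t^'] --> df.

Lemma mderiv_within m n (I : set R) (f : R -> 'M[K]_(m, n)) (t : R) (df : 'M[K]_(m, n)) :
  nbhs t I -> has_deriv_within I f t df -> mderiv f t df.
Proof.
move=> tI; apply: cvg_trans; apply: cvg_app => A IA.
have tI' : t^' I by exact: nbhs_dnbhs.
by apply: filterS2 tI' IA => s Is; exact.
Qed.

Lemma cvg_id_dnbhs (t : R) : s @[s --> t^'] --> t.
Proof. by move=> A; exact: nbhs_dnbhs. Qed.

Lemma mderiv_continuous m n (f : R -> 'M[K]_(m, n)) (t : R) (df : 'M[K]_(m, n)) :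
  mderiv f t df -> f s @[s --> t^'] --> f t.
Proof.
move=> /cvg_mnormP fd.
apply: (@cvg_mx_bound _ _ _ _ _ _ _ (fun s => `|s - t| *
   (mnorm (((s - t)^-1)%:C *: (f s - f t) - df) + mnorm df))).
  near=> s; have st : s != t by near: s; exact: nbhs_dnbhs_neq.
  rewrite -{1}[f s - f t](scale1r) -[1]/((1 : R)%:C) -(@divff _ (s - t)) ?subr_eq0//.
  rewrite rmorphM -scalerA mnormZr ler_wpM2l//.
  apply: le_trans (ler_mnormD _ _); by rewrite subrK.
rewrite (_ : 0 = `|t - t| * (0 + mnorm df)); last by rewrite subrr normr0 mul0r.
apply: cvgM; last by apply: cvgD => //; exact: cvg_cst.
by apply: cvg_norm; apply: cvgB; [exact: cvg_id_dnbhs|exact: cvg_cst].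
Unshelve. all: by end_near. Qed.

Lemma mderivM m n p (f : R -> 'M[K]_(m, n)) (g : R -> 'M[K]_(n, p)) t df dg :
  mderiv f t df -> mderiv g t dg ->
  mderiv (fun s => f s *m g s) t (df *m g t + f t *m dg).
Proof.
move=> fd gd; rewrite /mderiv.
have -> : (fun s => ((s - t)^-1)%:C *: (f s *m g s - f t *m g t)) =
  (fun s => (((s - t)^-1)%:C *: (f s - f t)) *m g s +
            f t *m (((s - t)^-1)%:C *: (g s - g t))).
  apply/funext => s; rewrite -scalemxAl -scalemxAr -scalerDr; congr (_ *: _).
  by rewrite mulmxBl mulmxBr addrA subrK.
apply: cvg_mxD.
  by apply: cvg_mulmx; [exact: fd|exact: mderiv_continuous gd].
by apply: cvg_mulmx; [exact: cvg_cst|exact: gd].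
Qed.

Lemma mderivD m n (f g : R -> 'M[K]_(m, n)) t df dg :
  mderiv f t df -> mderiv g t dg -> mderiv (fun s => f s + g s) t (df + dg).
Proof.
move=> fd gd; rewrite /mderiv.
have -> : (fun s => ((s - t)^-1)%:C *: (f s + g s - (f t + g t))) =
  (fun s => (((s - t)^-1)%:C *: (f s - f t)) + (((s - t)^-1)%:C *: (g s - g t))).
  by apply/funext => s; rewrite -scalerDr opprD addrACA.
by apply: cvg_mxD; [exact: fd|exact: gd].
Qed.

Lemma mderiv_cst m n (A : 'M[K]_(m, n)) t : mderiv (fun=> A) t 0.
Proof.
rewrite /mderiv (_ : (fun _ => _) = fun=> 0); first exact: cvg_cst.
by apply/funext => s; rewrite subrr scaler0.
Qed.

Lemma mderiv_sum m n (I : eqType) (r : seq I) (f : I -> R -> 'M[K]_(m, n)) t df :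
  (forall i, i \in r -> mderiv (f i) t (df i)) ->
  mderiv (fun s => \sum_(i <- r) f i s) t (\sum_(i <- r) df i).
Proof.
elim: r => [|i r IH] fd.
  rewrite big_nil (_ : (fun _ => _) = fun=> 0); first exact: mderiv_cst.
  by apply/funext => s; rewrite big_nil.
rewrite big_cons (_ : (fun _ => _) = fun s => f i s + \sum_(j <- r) f j s).
  apply: mderivD; first by apply: fd; rewrite inE eqxx.
  by apply: IH => j jr; apply: fd; rewrite inE jr orbT.
by apply/funext => s; rewrite big_cons.
Qed.

Lemma cvg_dnbhs_shift (t : R) : h + t @[h --> (0 : R)^'] --> t^'.
Proof.
move=> A; rewrite /= !near_simpl /dnbhs /within/= => -[e/= e0 eA].
exists e => // h /= he h0; apply: eA => /=.
  by rewrite opprD addrCA subrr addr0 normrN; rewrite sub0r normrN in he.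
by apply: contra_neq h0 => /(canRL (addrK _)); rewrite subrr.
Qed.

Lemma cvg_dnbhs_unshift (t : R) : s - t @[s --> t^'] --> (0 : R)^'.
Proof.
move=> A; rewrite /= !near_simpl /dnbhs /within/= => -[e/= e0 eA].
exists e => // s /= he h0; apply: eA => /=; last by rewrite subr_eq0.
by rewrite sub0r opprB.
Qed.

(** Bridge to the real derivatives, whose difference quotients are written with an
    increment instead of a second point. *)
Lemma cvg_quotient_is_derive (f : R -> R) (t df : R) :
  (s - t)^-1 * (f s - f t) @[s --> t^'] --> df <-> is_derive t 1 f df.
Proof.
split=> [fd|fd].
- have fd' : h^-1 *: ((f \o shift t) (h *: 1) - f t) @[h --> (0 : R)^'] --> df.
    have := cvg_comp _ _ (@cvg_dnbhs_shift t) fd.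
    apply: cvg_trans; apply: near_eq_cvg; apply: nearW => h /=.
    by rewrite addrK /shift/= [h *: 1]mulr1.
  apply: DeriveDef; first by apply/cvg_ex; exists df.
  exact: cvg_lim fd'.
- have fd' : h^-1 *: ((f \o shift t) (h *: 1) - f t) @[h --> (0 : R)^'] --> df.
    by rewrite -(@derive_val _ _ _ _ _ _ _ fd); exact: (@ex_derive _ _ _ _ _ _ _ fd).
  have := cvg_comp _ _ (@cvg_dnbhs_unshift t) fd'.
  apply: cvg_trans; apply: near_eq_cvg; apply: nearW => s /=.
  by rewrite /shift/= [_ *: 1]mulr1 subrK.
Qed.

Lemma mderiv_Re m n (f : R -> 'M[K]_(m, n)) (t : R) (df : 'M[K]_(m, n)) i j : mderiv f t df ->
  is_derive t 1 (fun s => complex.Re (f s i j)) (complex.Re (df i j)).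
Proof.
move=> /cvg_mx_Re-/(_ i j) fd; apply/cvg_quotient_is_derive.
move: fd; apply: cvg_trans; apply: near_eq_cvg; apply: nearW => s /=.
by rewrite !mxE; case: (f s i j) => a b; case: (f t i j) => c d /=; rewrite mul0r subr0.
Qed.

Lemma mderiv_Im m n (f : R -> 'M[K]_(m, n)) (t : R) (df : 'M[K]_(m, n)) i j : mderiv f t df ->
  is_derive t 1 (fun s => complex.Im (f s i j)) (complex.Im (df i j)).
Proof.
move=> /cvg_mx_Im-/(_ i j) fd; apply/cvg_quotient_is_derive.
move: fd; apply: cvg_trans; apply: near_eq_cvg; apply: nearW => s /=.
by rewrite !mxE; case: (f s i j) => a b; case: (f t i j) => c d /=; rewrite mul0r addr0.
Qed.

Lemma mderiv_ReIm m n (f : R -> 'M[K]_(m, n)) (t : R) (df : 'M[K]_(m, n)) :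
  (forall i j, is_derive t 1 (fun s => complex.Re (f s i j)) (complex.Re (df i j))) ->
  (forall i j, is_derive t 1 (fun s => complex.Im (f s i j)) (complex.Im (df i j))) ->
  mderiv f t df.
Proof.
move=> fRe fIm; apply: cvg_mx_ReIm => i j.
- move/cvg_quotient_is_derive: (fRe i j).
  apply: cvg_trans; apply: near_eq_cvg; apply: nearW => s /=.
  by rewrite !mxE; case: (f s i j) => a b; case: (f t i j) => c d /=; rewrite mul0r subr0.
- move/cvg_quotient_is_derive: (fIm i j).
  apply: cvg_trans; apply: near_eq_cvg; apply: nearW => s /=.
  by rewrite !mxE; case: (f s i j) => a b; case: (f t i j) => c d /=; rewrite mul0r addr0.
Qed.

Lemma mderiv_comp m n (f : R -> 'M[K]_(m, n)) (g : R -> R) (t : R) (df : 'M[K]_(m, n)) (dg : R) :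
  is_derive t 1 g dg -> mderiv f (g t) df ->
  mderiv (fun s => f (g s)) t (dg%:C *: df).
Proof.
move=> gd fd; apply: mderiv_ReIm => i j.
- have -> : complex.Re ((dg%:C *: df) i j) = complex.Re (df i j) * dg.
    by rewrite mxE; case: (df i j) => a b /=; rewrite mul0r subr0 mulrC.
  exact: (@is_derive1_comp _ _ _ _ _ _ (mderiv_Re i j fd)).
- have -> : complex.Im ((dg%:C *: df) i j) = complex.Im (df i j) * dg.
    by rewrite mxE; case: (df i j) => a b /=; rewrite mul0r addr0 mulrC.
  exact: (@is_derive1_comp _ _ _ _ _ _ (mderiv_Im i j fd)).
Qed.

Lemma mderivZ m n (g : R -> R) (X : 'M[K]_(m, n)) (t dg : R) :
  is_derive t 1 g dg -> mderiv (fun s => (g s)%:C *: X) t (dg%:C *: X).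
Proof.
move=> /cvg_quotient_is_derive gd; apply/cvg_mnormP.
have -> : (fun s => mnorm (((s - t)^-1)%:C *: ((g s)%:C *: X - (g t)%:C *: X) - dg%:C *: X)) =
    (fun s => `|(s - t)^-1 * (g s - g t) - dg| * mnorm X).
  apply/funext => s; rewrite -mnormZr; congr mnorm.
  by rewrite -scalerBl scalerA -scalerBl -!raddfB/= -rmorphM -raddfB.
have -> : (0 : R) = `|dg - dg| * mnorm X by rewrite subrr normr0 mul0r.
apply: cvgM; last exact: cvg_cst.
by apply: cvg_norm; apply: cvgB => //; exact: cvg_cst.
Qed.

Lemma mderiv0_cst m n (f : R -> 'M[K]_(m, n)) :
  (forall x, mderiv f x 0) -> forall x y, f x = f y.
Proof.
move=> fd x y; apply/matrixP => i j.
have dRe (z : R) : is_derive z 1 (fun s => complex.Re (f s i j)) 0.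
  by have := mderiv_Re i j (fd z); rewrite mxE.
have dIm (z : R) : is_derive z 1 (fun s => complex.Im (f s i j)) 0.
  by have := mderiv_Im i j (fd z); rewrite mxE.
have := is_derive_0_is_cst x y dRe; have := is_derive_0_is_cst x y dIm.
by case: (f x i j) => a b; case: (f y i j) => c d /= -> ->.
Qed.

End matrix_calculus.

(** * The matrix exponential and Hadamard's formula *)

Section matrix_exponential.
Context {R : realType} {n : nat}.
Local Notation K := R[i].
Implicit Types A B D X : 'M[K]_n.+1.

Lemma ler_mnormX B k : mnorm (B ^+ k) <= n.+1%:R * mnorm B ^+ k.
Proof.
elim: k => [|k IH]; first by rewrite !expr0 mulr1 -mnorm1.
rewrite [B ^+ _]exprS exprS mulrCA; apply: le_trans (ler_mnormM _ _) _.
by rewrite ler_wpM2l ?mnorm_ge0.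
Qed.

(** Taylor coefficient of x |-> A exp(x B). The factor [A] makes this family stable
    under termwise differentiation: see [expmx_coeff_diffs]. *)
Definition expmx_coeff A B (k : nat) : 'M[K]_n.+1 := (k`!%:R^-1 : R)%:C *: (A *m B ^+ k).

Lemma ler_mnorm_expmx_coeff A B k :
  mnorm (expmx_coeff A B k) <= mnorm A * n.+1%:R * (mnorm B ^+ k / k`!%:R).
Proof.
rewrite /expmx_coeff mnormZr ger0_norm ?invr_ge0// mulrC mulrA ler_wpM2r ?invr_ge0//.
apply: le_trans (ler_mnormM _ _) _.
by rewrite -mulrA ler_wpM2l ?mnorm_ge0// ler_mnormX.
Qed.

Lemma cvg_pseries_expmx (c : R^nat) (C b : R) : 0 <= C -> 0 <= b ->
  (forall k, `|c k| <= C * (b ^+ k / k`!%:R)) -> forall x, cvgn (pseries c x).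
Proof.
move=> C0 b0 cb x; apply: normed_cvg.
apply: (@series_le_cvg _ _ (fun k => C * exp_coeff (b * `|x|) k)) => //.
- by move=> k; exact: normr_ge0.
- by move=> k; apply: mulr_ge0 => //; apply: divr_ge0 => //; apply: exprn_ge0; exact: mulr_ge0.
- move=> k /=; rewrite normrM normrX /exp_coeff/= exprMn mulrAC mulrA.
  by rewrite ler_wpM2r ?exprn_ge0.
- exact: is_cvg_seriesZ (is_cvg_series_exp_coeff _).
Qed.

Lemma expmx_seriesE B x (N : nat) :
  series (fun k => (k`!%:R)^-1 *: (x%:C *: B) ^+ k) N =
  \sum_(k < N) (x ^+ k)%:C *: expmx_coeff 1%:M B k.
Proof.
rewrite /series/= big_mkord; apply: eq_bigr => k _.
rewrite /expmx_coeff mul1mx exprZn !scalerA; congr (_ *: _).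
by rewrite mulrC rmorphV ?rmorph_nat ?unitfE// rmorphXn.
Qed.

(** The real and imaginary parts of each entry are real power series in [x] dominated
    by an exponential series, so that the theory of real power series applies. *)
Lemma cvg_expmx_Re_Im A B (x : R) :
  \sum_(k < N) (x ^+ k)%:C *: expmx_coeff A B k @[N --> \oo] -->
  (\matrix_(i, j) (limn (pseries (fun k => complex.Re (expmx_coeff A B k i j)) x)
    +i* limn (pseries (fun k => complex.Im (expmx_coeff A B k i j)) x)) : 'M[K]_n.+1).
Proof.
apply: cvg_mx_ReIm => i j; rewrite mxE/=.
- rewrite (_ : (fun _ => _) = pseries (fun k => complex.Re (expmx_coeff A B k i j)) x).
    apply: (@cvg_pseries_expmx _ (mnorm A * n.+1%:R) (mnorm B)) => [||k].
    + by rewrite mulr_ge0 ?mnorm_ge0.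
    + exact: mnorm_ge0.
    + apply: le_trans (ler_mnorm_expmx_coeff A B k).
      exact: le_trans (ler_Re_normc _) (ler_entry_mnorm _ _ _).
  apply/funext => N; rewrite /pseries/= /series/= big_mkord summxE raddf_sum.
  apply: eq_bigr => k _; rewrite mxE mulrC.
  by case: (expmx_coeff A B k i j) => a b /=; rewrite mulr0 subr0.
- rewrite (_ : (fun _ => _) = pseries (fun k => complex.Im (expmx_coeff A B k i j)) x).
    apply: (@cvg_pseries_expmx _ (mnorm A * n.+1%:R) (mnorm B)) => [||k].
    + by rewrite mulr_ge0 ?mnorm_ge0.
    + exact: mnorm_ge0.
    + apply: le_trans (ler_mnorm_expmx_coeff A B k).
      exact: le_trans (ler_Im_normc _) (ler_entry_mnorm _ _ _).
  apply/funext => N; rewrite /pseries/= /series/= big_mkord summxE raddf_sum.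
  apply: eq_bigr => k _; rewrite mxE mulrC.
  by case: (expmx_coeff A B k i j) => a b /=; rewrite mulr0 add0r.
Qed.

Definition mexp B (x : R) : 'M[K]_n.+1 := expmx (x%:C *: B).

Lemma cvg_mexp B x :
  \sum_(k < N) (x ^+ k)%:C *: expmx_coeff 1%:M B k @[N --> \oo] --> mexp B x.
Proof.
have h := @cvg_expmx_Re_Im 1%:M B x.
suff -> : mexp B x = lim ((\sum_(k < N) (x ^+ k)%:C *: expmx_coeff 1%:M B k) @[N --> \oo]).
  exact: (cvgP _ h).
rewrite /mexp /expmx (_ : series _ = fun N : nat =>
  \sum_(k < N) (x ^+ k)%:C *: expmx_coeff 1%:M B k)//.
by apply/funext => N; exact: expmx_seriesE.
Qed.

Lemma cvg_mul_mexp A B x :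
  \sum_(k < N) (x ^+ k)%:C *: expmx_coeff A B k @[N --> \oo] --> A *m mexp B x.
Proof.
rewrite (_ : (fun _ => _) = (fun N : nat => A *m \sum_(k < N) (x ^+ k)%:C *: expmx_coeff 1%:M B k)).
  by apply: cvg_mulmx; [exact: cvg_cst|exact: cvg_mexp].
apply/funext => N; rewrite mulmx_sumr; apply: eq_bigr => k _.
by rewrite -scalemxAr /expmx_coeff -scalemxAr mul1mx.
Qed.

Lemma mul_mexpE A B x :
  A *m mexp B x =
  \matrix_(i, j) (limn (pseries (fun k => complex.Re (expmx_coeff A B k i j)) x)
    +i* limn (pseries (fun k => complex.Im (expmx_coeff A B k i j)) x)).
Proof. exact: norm_cvg_unique (@cvg_mul_mexp A B x) (@cvg_expmx_Re_Im A B x). Qed.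

Lemma expmx_coeff_diffs A B k :
  (k.+1%:R : R)%:C *: expmx_coeff A B k.+1 = expmx_coeff (A *m B) B k.
Proof.
rewrite /expmx_coeff scalerA -rmorphM; congr ((_)%:C *: _).
  by rewrite factS natrM invfM mulrA divff ?mul1r.
by rewrite exprS -mulmxA.
Qed.

(** Entrywise differentiation of power series: the coefficients of A exp(x B) turn into
    those of A B exp(x B). *)
Lemma mderiv_mul_mexp A B x :
  mderiv (fun x => A *m mexp B x) x (A *m B *m mexp B x).
Proof.
have cRe A' i j y : cvgn (pseries (fun k => complex.Re (expmx_coeff A' B k i j)) y).
  apply: (@cvg_pseries_expmx _ (mnorm A' * n.+1%:R) (mnorm B)) => [||k].
  - by rewrite mulr_ge0 ?mnorm_ge0.
  - exact: mnorm_ge0.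
  - apply: le_trans (ler_mnorm_expmx_coeff A' B k).
    exact: le_trans (ler_Re_normc _) (ler_entry_mnorm _ _ _).
have cIm A' i j y : cvgn (pseries (fun k => complex.Im (expmx_coeff A' B k i j)) y).
  apply: (@cvg_pseries_expmx _ (mnorm A' * n.+1%:R) (mnorm B)) => [||k].
  - by rewrite mulr_ge0 ?mnorm_ge0.
  - exact: mnorm_ge0.
  - apply: le_trans (ler_mnorm_expmx_coeff A' B k).
    exact: le_trans (ler_Im_normc _) (ler_entry_mnorm _ _ _).
have dRe A' i j : pseries_diffs (fun k => complex.Re (expmx_coeff A' B k i j)) =
    (fun k => complex.Re (expmx_coeff (A' *m B) B k i j)).
  apply/funext => k; rewrite -expmx_coeff_diffs [in RHS]mxE /pseries_diffs.
  by case: (expmx_coeff A' B k.+1 i j) => a b; rewrite /= mul0r subr0.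
have dIm A' i j : pseries_diffs (fun k => complex.Im (expmx_coeff A' B k i j)) =
    (fun k => complex.Im (expmx_coeff (A' *m B) B k i j)).
  apply/funext => k; rewrite -expmx_coeff_diffs [in RHS]mxE /pseries_diffs.
  by case: (expmx_coeff A' B k.+1 i j) => a b; rewrite /= mul0r addr0.
have xK : `|x| < `|(`|x| + 1)| by rewrite [ltRHS]ger0_norm ?ltrDl// addr_ge0.
apply: mderiv_ReIm => i j.
- rewrite mul_mexpE mxE/=.
  rewrite (_ : (fun s => _) = (fun x => limn (pseries (fun k => complex.Re (expmx_coeff A B k i j)) x))); last first.
    by apply/funext => y; rewrite mul_mexpE mxE.
  by rewrite -dRe; apply: (@pseries_snd_diffs _ _ (`|x| + 1)); rewrite ?dRe.
- rewrite mul_mexpE mxE/=.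
  rewrite (_ : (fun s => _) = (fun x => limn (pseries (fun k => complex.Im (expmx_coeff A B k i j)) x))); last first.
    by apply/funext => y; rewrite mul_mexpE mxE.
  by rewrite -dIm; apply: (@pseries_snd_diffs _ _ (`|x| + 1)); rewrite ?dIm.
Qed.

Lemma mderiv_mexp B x : mderiv (mexp B) x (B *m mexp B x).
Proof.
have := @mderiv_mul_mexp 1%:M B x; rewrite mul1mx.
by rewrite (_ : (fun _ => _) = mexp B)//; apply/funext => y; rewrite mul1mx.
Qed.

Lemma mexp_comm B x : B *m mexp B x = mexp B x *m B.
Proof.
apply: norm_cvg_unique (@cvg_mul_mexp B B x) _.
rewrite (_ : (fun _ => _) = (fun N : nat => (\sum_(k < N) (x ^+ k)%:C *: expmx_coeff 1%:M B k) *m B)).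
  by apply: cvg_mulmx; [exact: cvg_mexp|exact: cvg_cst].
apply/funext => N; rewrite mulmx_suml; apply: eq_bigr => k _.
rewrite -scalemxAl /expmx_coeff -scalemxAl mul1mx; congr (_ *: (_ *: _)).
by rewrite -[LHS]exprS -[RHS]exprSr.
Qed.

Lemma mexp0 B : mexp B 0 = 1%:M.
Proof.
apply: norm_cvg_unique (@cvg_mexp B 0) _.
apply: cvg_near_cst; exists 1%N => // -[//|N] _ /=.
rewrite big_ord_recl/= expr0 big1 => [|k _]; last by rewrite expr0n/= scale0r.
by rewrite /expmx_coeff addr0 fact0 invr1 !scale1r expr0 mulmx1.
Qed.

Lemma ler_mnorm_mexp B x : mnorm (mexp B x) <= n.+1%:R ^+ 2 * expR (mnorm B * `|x|).
Proof.
have part (N : nat) : mnorm (\sum_(k < N) (x ^+ k)%:C *: expmx_coeff 1%:M B k) <=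
    n.+1%:R ^+ 2 * expR (mnorm B * `|x|).
  apply: le_trans (ler_mnorm_sum _ _ _) _.
  apply: (@le_trans _ _ (\sum_(k < N) n.+1%:R ^+ 2 * exp_coeff (mnorm B * `|x|) k)).
    apply: ler_sum => k _; rewrite mnormZr normrX mulrC.
    apply: le_trans (ler_wpM2r (exprn_ge0 _ (normr_ge0 _)) (ler_mnorm_expmx_coeff _ _ _)) _.
    rewrite mnorm1 /exp_coeff/= exprMn expr2 -!mulrA.
    by rewrite [_^-1 * _]mulrC.
  rewrite -mulr_sumr ler_wpM2l ?exprn_ge0//.
  have := nondecreasing_cvgn_le _ (is_cvg_series_exp_coeff (mnorm B * `|x|)) N.
  rewrite /series/= big_mkord; apply.
  apply/nondecreasing_seqP => m; rewrite big_nat_recr//= lerDl /exp_coeff/=.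
  by rewrite divr_ge0// exprn_ge0// mulr_ge0// mnorm_ge0.
apply/ler_addgt0Pr => e e0.
have /cvg_mnorm0P/(_ e e0) := @cvg_mexp B x.
move=> /filter_ex[N hN].
rewrite -[mexp B x](subrK (\sum_(k < N) (x ^+ k)%:C *: expmx_coeff 1%:M B k)).
apply: le_trans (ler_mnormD _ _) _.
by rewrite addrC lerD// mnormB_sym ltW.
Qed.

Definition ad B X : 'M[K]_n.+1 := B *m X - X *m B.

(** Truncation of exp(x ad B) D; it is the whole series when [ad B] kills [D] after
    [N] steps. *)
Definition ad_exp B D (N : nat) (x : R) : 'M[K]_n.+1 :=
  \sum_(k < N) (x ^+ k / k`!%:R)%:C *: iter k (ad B) D.

Lemma adZ B a X : ad B (a *: X) = a *: ad B X.
Proof. by rewrite /ad -scalemxAr -scalemxAl scalerBr. Qed.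

(** Shifting the index gives the ODE of exp(x ad B) D; the boundary term of the
    truncated sum is the vanishing iterate. *)
Lemma mderiv_ad_exp B D N x : iter N (ad B) D = 0 ->
  mderiv (ad_exp B D N) x (ad B (ad_exp B D N x)).
Proof.
move=> adN.
have dk (k : nat) : mderiv (fun x => (x ^+ k / k`!%:R)%:C *: iter k (ad B) D) x
    (if k is j.+1 then (x ^+ j / j`!%:R)%:C *: iter k (ad B) D else 0).
  have dX : is_derive x 1 (fun x : R => x ^+ k / k`!%:R) (k%:R * x ^+ k.-1 / k`!%:R).
    have dk := is_deriveZ (k`!%:R^-1 : R) (@is_deriveX _ _ id k x 1 1 (is_derive_id x 1)).
    rewrite (_ : (fun y : R => y ^+ k / k`!%:R) = (k`!%:R^-1 : R) \*: (id ^+ k)); last first.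
      by apply/funext => y; rewrite /= mulrC; congr (_ * _); elim: (k) => // j IH; rewrite !exprS IH.
    apply: is_derive_eq dk _; rewrite [RHS]mulrC; congr (_ * _).
    by rewrite [_ *: 1]mulr1.
  rewrite (_ : (if k is _.+1 then _ else _) = (k%:R * x ^+ k.-1 / k`!%:R)%:C *: iter k (ad B) D).
    exact: mderivZ.
  case: k {dX} => [|k]; first by rewrite !mul0r scale0r.
  congr (_%:C *: _); rewrite /= factS natrM invfM mulrA; congr (_ * _).
  by rewrite mulrAC divff ?mul1r.
have -> : ad B (ad_exp B D N x) = \sum_(k <- index_enum 'I_N)
    (if (k : nat) is j.+1 then (x ^+ j / j`!%:R)%:C *: iter k (ad B) D else 0).
  case: N adN => [|N] adN.
    by rewrite /ad_exp big_ord0 /ad mulmx0 mul0mx subr0 big1// => -[].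
  rewrite big_ord_recl add0r /ad_exp.
  have -> : ad B (\sum_(k < N.+1) (x ^+ k / k`!%:R)%:C *: iter k (ad B) D) =
     \sum_(k < N.+1) (x ^+ k / k`!%:R)%:C *: iter k.+1 (ad B) D.
    rewrite /ad mulmx_sumr mulmx_suml -sumrB; apply: eq_bigr => k _ /=.
    by rewrite -[RHS]adZ.
  by rewrite big_ord_recr/= -[ad B (iter N _ _)]/(iter N.+1 (ad B) D) adN scaler0 addr0.
exact: (@mderiv_sum _ _ _ _ _ (fun (k : 'I_N) y => (y ^+ k / k`!%:R)%:C *: iter k (ad B) D)).
Qed.

Lemma mderiv_mexpN B x : mderiv (fun y => mexp B (- y)) x (- (B *m mexp B (- x))).
Proof.
have d : is_derive x 1 (fun y : R => - y) (-1 : R) by apply: is_derive_eq.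
have := mderiv_comp d (@mderiv_mexp B (- x)).
by rewrite rmorphN rmorph1 scaleN1r.
Qed.

(** Both sides of Hadamard's formula solve X' = B X - X B with the same value at 0: the
    conjugate below has zero derivative. The case [D := 1], [N := 1] yields the
    inverse of the exponential. *)
Lemma mexp_ad_exp B D N x : (0 < N)%N -> iter N (ad B) D = 0 ->
  mexp B (- x) *m ad_exp B D N x *m mexp B x = D.
Proof.
move=> N0 adN.
have cancel (F P E : 'M[K]_n.+1) : B *m F = F *m B ->
    (- (B *m F) *m P + F *m ad B P) *m E + F *m P *m (B *m E) = 0.
  move=> ->; rewrite /ad mulmxBr mulNmx !mulmxA mulmxDl mulNmx mulmxBl.
  by rewrite addrA addNr add0r addNr.
have d0 y : mderiv (fun y => mexp B (- y) *m ad_exp B D N y *m mexp B y) y 0.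
  rewrite -(cancel _ (ad_exp B D N y) (mexp B y) (mexp_comm B (- y))).
  apply: mderivM; last exact: mderiv_mexp.
  by apply: mderivM; [exact: mderiv_mexpN|exact: mderiv_ad_exp].
rewrite (mderiv0_cst d0 x 0) oppr0 mexp0 mul1mx mulmx1 /ad_exp.
case: N N0 {adN d0} => // N _; rewrite big_ord_recl big1 => [|k _].
  by rewrite addr0 expr0 fact0 divr1 scale1r.
by rewrite expr0n/= mul0r scale0r.
Qed.

Lemma mexpNK B x : mexp B (- x) *m mexp B x = 1%:M.
Proof.
have := @mexp_ad_exp B 1%:M 1 x isT; rewrite /= /ad mulmx1 mul1mx subrr => /(_ erefl).
by rewrite /ad_exp big_ord_recl big_ord0 addr0 expr0 fact0 divr1 scale1r mulmx1.
Qed.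

Lemma mexpKN B x : mexp B x *m mexp B (- x) = 1%:M.
Proof. by rewrite -{1}(opprK x) mexpNK. Qed.

(** Hadamard's formula, for [D] killed by a power of [ad B]: conjugating by the
    exponential then costs only a power of the time variable. *)
Lemma mexp_conj B D N x : (0 < N)%N -> iter N (ad B) D = 0 ->
  mexp B x *m D = ad_exp B D N x *m mexp B x.
Proof.
move=> N0 adN; rewrite -{1}(mexp_ad_exp x N0 adN).
by rewrite 2!mulmxA mexpKN mul1mx.
Qed.

Lemma ler_mnorm_ad B X : mnorm (ad B X) <= 2 * mnorm B * mnorm X.
Proof.
apply: le_trans (ler_mnormB _ _) _.
rewrite -mulrA mulr2n mulrDl mul1r lerD ?ler_mnormM//.
by rewrite [leRHS]mulrC ler_mnormM.
Qed.

Lemma ler_mnorm_ad_exp B D N x :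
  mnorm (ad_exp B D N x) <=
    (1 + 2 * mnorm B) ^+ N * N%:R * (1 + `|x|) ^+ N * mnorm D.
Proof.
apply: le_trans (ler_mnorm_sum _ _ _) _.
apply: (@le_trans _ _ (\sum_(k < N)
   (1 + 2 * mnorm B) ^+ N * (1 + `|x|) ^+ N * mnorm D)); last first.
  rewrite sumr_const card_ord -[leLHS]mulr_natl.
  by rewrite le_eqVlt; apply/orP; left; apply/eqP; ring.
apply: ler_sum => k _; rewrite mnormZr.
have b0 : 0 <= 2 * mnorm B by rewrite mulr_ge0 ?mnorm_ge0.
have iterk j : mnorm (iter j (ad B) D) <= (2 * mnorm B) ^+ j * mnorm D.
  elim: j => [|j IH]; first by rewrite mul1r.
  by apply: le_trans (ler_mnorm_ad _ _) _; rewrite exprS -[leRHS]mulrA ler_wpM2l.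
rewrite [(1 + 2 * _) ^+ N * _]mulrC -mulrA; apply: ler_pM => //.
- exact: mnorm_ge0.
- rewrite normrM normrX (ger0_norm (_ : 0 <= _^-1)) ?invr_ge0//.
  apply: (@le_trans _ _ (`|x| ^+ k)).
    by rewrite ler_piMr ?exprn_ge0// invf_le1 ?ltr0n ?fact_gt0// ler1n fact_gt0.
  apply: (@le_trans _ _ ((1 + `|x|) ^+ k)); first by rewrite lerXn2r ?nnegrE ?addr_ge0// lerDr.
  by rewrite ler_weXn2l ?lerDl// ltnW.
- apply: le_trans (iterk k) _; rewrite ler_wpM2r ?mnorm_ge0//.
  apply: (@le_trans _ _ ((1 + 2 * mnorm B) ^+ k)); first by rewrite lerXn2r ?nnegrE ?addr_ge0// lerDr.
  by rewrite ler_weXn2l ?lerDl// ltnW.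
Qed.

End matrix_exponential.

(** * Commutators of diagonal and Jordan matrices *)

Section jordan.
Context {R : realType} {n : nat}.
Local Notation K := R[i].
Implicit Types B D : 'M[K]_n.+1.

(** The k-th iterated commutator of a diagonal matrix with a Jordan matrix [B]
    lives on the k-th superdiagonal, and only inside blocks of equal eigenvalue,
    so that the diagonal part of [B] never contributes. *)
Lemma ad_jordan_support B D k (i j : 'I_n.+1) :
  jordan_normal_form B -> is_diag_mx D -> iter k (ad B) D i j != 0 ->
  j = (i + k)%N :> nat /\ B i i = B j j.
Proof.
move=> [B0 B1] /is_diag_mxP Dd.
have Bsupp (a b : 'I_n.+1) : b != a -> B a b != 0 -> b = a.+1 :> nat /\ B a a = B b b.
  move=> ba Bab; have ba1 : b = a.+1 :> nat.
    by apply/eqP; apply: contra_neqT Bab => ba1; exact: B0.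
  by split => //; have [Bab0|[_]//] := B1 _ _ ba1; rewrite Bab0 eqxx in Bab.
elim: k i j => [|k IH] i j /=.
  move=> Dij; have -> : j = i by apply/eqP; apply: contra_neqT Dij => ij; apply: Dd; rewrite eq_sym.
  by rewrite addn0.
set X := iter k (ad B) D in IH *.
apply: contra_neqP => H.
have -> : ad B X i j = (B *m X) i j - (X *m B) i j by rewrite !mxE.
have -> : (B *m X) i j = B i i * X i j.
  rewrite mxE (bigD1 i)//= big1 ?addr0// => l li.
  apply/eqP; rewrite mulf_eq0; apply: contra_notT H; rewrite negb_or => /andP[Bil Xlj].
  have [l1 lE] := Bsupp _ _ li Bil; have [jl jE] := IH _ _ Xlj.
  by rewrite jl l1 addSnnS lE.
have -> : (X *m B) i j = X i j * B j j.
  rewrite mxE (bigD1 j)//= big1 ?addr0// => l lj.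
  apply/eqP; rewrite mulf_eq0; apply: contra_notT H; rewrite negb_or => /andP[Xil Blj].
  rewrite eq_sym in lj.
  have [l1 lE] := Bsupp _ _ lj Blj; have [jl jE] := IH _ _ Xil.
  by rewrite l1 jl addnS jE lE.
have [->|/IH[_ ->]] := eqVneq (X i j) 0; first by rewrite mul0r mulr0 subrr.
by rewrite mulrC subrr.
Qed.

Lemma ad_jordan_nilpotent B D :
  jordan_normal_form B -> is_diag_mx D -> iter n.+1 (ad B) D = 0.
Proof.
move=> BJ Dd; apply/matrixP => i j; rewrite [RHS]mxE; apply/eqP.
apply: contraT => /(ad_jordan_support BJ Dd)[jE _].
by have := ltn_ord j; rewrite jE addnS ltnS ltnNge leq_addl.
Qed.

End jordan.

(** * Logarithms against powers *)

Section scalar_bounds.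
Context {R : realType}.

(** A power of 1 + y is at most a constant times exp(eps y): raise the tangent bound
    1 + (eps / (q + 1)) y <= exp((eps / (q + 1)) y) to the power [q]. *)
Lemma log_power_bound (eps : R) (q : nat) : 0 < eps ->
  exists2 C : R, 0 <= C &
    forall z, 0 < z -> (1 + `|ln z|) ^+ q <= C * expR (eps * `|ln z|).
Proof.
move=> eps0; pose m := Num.min 1 (eps / q.+1%:R).
have m0 : 0 < m by rewrite lt_min ltr01 divr_gt0.
exists (m^-1 ^+ q); first by rewrite exprn_ge0// invr_ge0 ltW.
move=> z z0; set y := `|ln z|.
have y0 : 0 <= y by exact: normr_ge0.
have h : m * (1 + y) <= expR (eps / q.+1%:R * y).
  apply: le_trans (expR_ge1Dx _); rewrite mulrDr mulr1 lerD//.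
    by rewrite ge_min lexx.
  by rewrite ler_wpM2r// ge_min lexx orbT.
have h2 : (m * (1 + y)) ^+ q <= expR (eps * y).
  apply: le_trans (lerXn2r _ _ _ h) _; rewrite ?nnegrE ?expR_ge0//.
    by rewrite mulr_ge0 ?addr_ge0// ltW.
  rewrite -expRM_natl ler_expR mulrA ler_wpM2r//.
  rewrite mulrCA ger_pMr// ler_pdivrMr ?mul1r ?ler_nat//.
rewrite exprVn -ler_pdivrMl ?invr_gt0 ?exprn_gt0//.
by rewrite invrK -exprMn.
Qed.

Lemma powR_expR_ln (z a : R) : 0 < z -> z `^ a = expR (a * ln z).
Proof. by move=> z0; rewrite /powR gt_eqF. Qed.

Lemma expR_norm_ln (z a : R) : 0 < z <= 1 -> expR (a * `|ln z|) = z `^ (- a).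
Proof.
move=> /andP[z0 z1]; rewrite powR_expR_ln//.
by rewrite ler0_norm ?ln_le0// mulrN mulNr.
Qed.

End scalar_bounds.

(** * Linear systems with an integrable singularity *)

Section singular_ode.
Context {R : realType}.
Local Notation K := R[i].

Lemma mderiv_mnorm_continuous m p (u : R -> 'M[K]_(m, p)) (t : R) (du : 'M[K]_(m, p)) :
  mderiv u t du -> {for t, continuous (fun s => mnorm (u s))}.
Proof.
move=> /mderiv_continuous /cvg_mnorm0P uc.
apply/cvgrPdistC_lt => e /[dup] e0 /uc; rewrite /dnbhs/= near_withinE.
apply: filterS => s us.
have [->|/us {us}] := eqVneq s t; first by rewrite subrr normr0.
apply: le_lt_trans.
have h1 : mnorm (u s) <= mnorm (u s - u t) + mnorm (u t) by rewrite -{1}[u s](subrK (u t)) ler_mnormD.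
have h2 : mnorm (u t) <= mnorm (u s - u t) + mnorm (u s).
  by rewrite mnormB_sym -{1}[u t](subrK (u s)) ler_mnormD.
by rewrite ler_norml; apply/andP; split; lra.
Qed.

(** Mean value inequality: [G + g] and [G - g] have nonnegative derivatives. *)
Lemma ler_incr_derive (g G g' G' : R -> R) (s t : R) : s <= t ->
  (forall x, s <= x <= t -> is_derive x 1 g (g' x)) ->
  (forall x, s <= x <= t -> is_derive x 1 G (G' x)) ->
  (forall x, s <= x <= t -> `|g' x| <= G' x) ->
  `|g t - g s| <= G t - G s.
Proof.
move=> st dg dG gG.
have key (h h' : R -> R) : (forall x, s <= x <= t -> is_derive x 1 h (h' x)) ->
    (forall x, s <= x <= t -> 0 <= h' x) -> h s <= h t.
  move=> dh h0; apply: (@ger0_derive1_ndecr _ h s t) => //.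
  - move=> x /subset_itv_oo_cc; rewrite in_itv/= => xst.
    exact: (@ex_derive _ _ _ _ _ _ _ (dh x xst)).
  - move=> x /subset_itv_oo_cc; rewrite in_itv/= => xst.
    by rewrite derive1E (@derive_val _ _ _ _ _ _ _ (dh x xst)) h0.
  - apply: derivable_within_continuous => x; rewrite in_itv/= => xst.
    exact: (@ex_derive _ _ _ _ _ _ _ (dh x xst)).
rewrite ler_norml; apply/andP; split.
- have := key (fun x => G x + g x) (fun x => G' x + g' x).
  suff h : G s + g s <= G t + g t by move=> _; lra.
  apply: (key (fun x => G x + g x) (fun x => G' x + g' x)) => x xst.
    by have ? := dg x xst; have ? := dG x xst; exact: is_deriveD.
  by have := gG x xst; rewrite ler_norml => /andP[]; lra.
- suff h : G s - g s <= G t - g t by lra.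
  apply: (key (fun x => G x - g x) (fun x => G' x - g' x)) => x xst.
    by have ? := dg x xst; have ? := dG x xst; exact: is_deriveB.
  by have := gG x xst; rewrite ler_norml => /andP[]; lra.
Qed.

Lemma ler_mnorm_incr m p (u du : R -> 'M[K]_(m, p)) (G G' : R -> R) (s t : R) : s <= t ->
  (forall x, s <= x <= t -> mderiv u x (du x)) ->
  (forall x, s <= x <= t -> is_derive x 1 G (G' x)) ->
  (forall x, s <= x <= t -> mnorm (du x) <= G' x) ->
  mnorm (u t - u s) <= (2 * (m * p))%:R * (G t - G s).
Proof.
move=> st du_ dG duG.
have bRe i j : `|complex.Re (u t i j) - complex.Re (u s i j)| <= G t - G s.
  apply: (@ler_incr_derive (fun x => complex.Re (u x i j)) _ (fun x => complex.Re (du x i j)) G') => //.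
    by move=> x /du_ /(mderiv_Re i j).
  move=> x /duG; apply: le_trans; apply: le_trans (ler_entry_mnorm _ i j).
  exact: ler_Re_normc.
have bIm i j : `|complex.Im (u t i j) - complex.Im (u s i j)| <= G t - G s.
  apply: (@ler_incr_derive (fun x => complex.Im (u x i j)) _ (fun x => complex.Im (du x i j)) G') => //.
    by move=> x /du_ /(mderiv_Im i j).
  move=> x /duG; apply: le_trans; apply: le_trans (ler_entry_mnorm _ i j).
  exact: ler_Im_normc.
apply: (@le_trans _ _ (\sum_(i < m) \sum_(j < p) 2 * (G t - G s))).
  apply: ler_sum => i _; apply: ler_sum => j _; apply: le_trans (ler_normc_ReIm _) _.
  by rewrite !mxE !raddfB/= mulr2n mulrDl mul1r lerD.
rewrite (eq_bigr (fun=> (2 * (G t - G s)) *+ p)) => [|i _]; last by rewrite sumr_const card_ord.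
by rewrite sumr_const card_ord -mulrnA -mulr_natl !natrM le_eqVlt; apply/orP; left; apply/eqP; ring.
Qed.

(** The functions [g + G] and [G] are nondecreasing and bounded below, so both have a limit at
    0+, and so does their difference. *)
Lemma cvg_right_of_derive_bound (g G g' G' : R -> R) (b c : R) : 0 < b ->
  (forall x, 0 < x <= b -> is_derive x 1 g (g' x)) ->
  (forall x, 0 < x <= b -> is_derive x 1 G (G' x)) ->
  (forall x, 0 < x <= b -> `|g' x| <= G' x) ->
  (forall x, 0 < x <= b -> `|g x| <= c) ->
  (forall x, 0 < x <= b -> 0 <= G x) ->
  cvg (g x @[x --> 0^'+]).
Proof.
move=> b0 dg dG gG gc G0.
have inc x y : 0 < x -> x <= y -> y <= b -> `|g y - g x| <= G y - G x.
  move=> x0 xy yb; have sub z : x <= z <= y -> 0 < z <= b.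
    by move=> /andP[xz zy]; rewrite (lt_le_trans x0 xz) (le_trans zy yb).
  by apply: (@ler_incr_derive _ _ g' G') => // z /sub; [exact: dg|exact: dG|exact: gG].
have GP : cvg (G x @[x --> 0^'+]).
  apply/cvg_ex; eexists.
  apply: (@nondecreasing_at_right_cvgr _ _ _ (BRight b)); first by rewrite bnd_simp.
    move=> x y; rewrite !in_itv/= => /andP[x0 _] /andP[_ yb] xy.
    by have := inc x y x0 xy yb; have := normr_ge0 (g y - g x); lra.
  by exists 0 => y [x /=]; rewrite in_itv/= => xb <-; exact: G0.
have gGP : cvg (g x + G x @[x --> 0^'+]).
  apply/cvg_ex; eexists.
  apply: (@nondecreasing_at_right_cvgr _ (fun x => g x + G x) _ (BRight b)); first by rewrite bnd_simp.
    move=> x y; rewrite !in_itv/= => /andP[x0 _] /andP[_ yb] xy.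
    by have := inc x y x0 xy yb; rewrite ler_norml => /andP[]; lra.
  exists (- c) => y [x /=]; rewrite in_itv/= => xb <-.
  by have := G0 x xb; have := gc x xb; rewrite ler_norml => /andP[]; lra.
rewrite (_ : g = (fun x => g x + G x - G x)); first exact: is_cvgB.
by apply/funext => x; rewrite addrK.
Qed.

Section estimate.
Variables (m p : nat) (u du : R -> 'M[K]_(m, p)) (h H phi Phi : R -> R) (b : R).
Let c : R := (2 * (m * p))%:R.
Hypothesis b0 : 0 < b.
Hypothesis u_deriv : forall x, 0 < x <= b -> mderiv u x (du x).
Hypothesis H_deriv : forall x, 0 < x <= b -> is_derive x 1 H (h x).
Hypothesis Phi_deriv : forall x, 0 < x <= b -> is_derive x 1 Phi (phi x).
Hypothesis h0 : forall x, 0 < x <= b -> 0 <= h x.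
Hypothesis phi0 : forall x, 0 < x <= b -> 0 <= phi x.
Hypothesis H0 : forall x, 0 < x <= b -> 0 <= H x.
Hypothesis Phi0 : forall x, 0 < x <= b -> 0 <= Phi x.
Hypothesis duP : forall x, 0 < x <= b -> mnorm (du x) <= h x * mnorm (u x) + phi x.
Hypothesis small : c * H b <= 2^-1.

Let sub s t x : 0 < s -> t <= b -> s <= x <= t -> 0 < x <= b.
Proof.
by move=> s0 tb /andP[sx xt]; rewrite (lt_le_trans s0 sx) (le_trans xt tb).
Qed.

Let c_ge0 : 0 <= c. Proof. exact: ler0n. Qed.

Let mono (G g : R -> R) (s t : R) : (forall x, 0 < x <= b -> is_derive x 1 G (g x)) ->
  (forall x, 0 < x <= b -> 0 <= g x) -> 0 < s -> s <= t -> t <= b -> G s <= G t.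
Proof.
move=> dG g0 s0 st tb; rewrite -subr_ge0.
have := @ler_incr_derive (fun=> 0) G (fun=> 0) g s t st.
rewrite subrr normr0; apply => x /(sub s0 tb) xb.
- exact: dG.
- by rewrite g0.
Qed.

Let incr (S s t x y : R) : 0 < s -> t <= b -> s <= x -> x <= y -> y <= t ->
  (forall z, s <= z <= t -> mnorm (u z) <= S) ->
  mnorm (u y - u x) <= c * (H t * S + Phi t).
Proof.
move=> s0 tb sx xy yt uS.
have sub' z : x <= z <= y -> s <= z <= t.
  by move=> /andP[xz zy]; rewrite (le_trans sx xz) (le_trans zy yt).
have xb : 0 < x <= b by apply: (sub s0 tb); rewrite sx (le_trans xy yt).
have yb : 0 < y <= b by apply: (sub s0 tb); rewrite yt (le_trans sx xy).
have S0 : 0 <= S.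
  by apply: le_trans (uS x _); rewrite ?mnorm_ge0// sx (le_trans xy yt).
apply: (@le_trans _ _ (c * ((H y * S + Phi y) - (H x * S + Phi x)))).
  apply: (@ler_mnorm_incr _ _ _ du (fun x => H x * S + Phi x) (fun x => h x * S + phi x)) => // z /[dup] zxy /sub'/[dup] zst /(sub s0 tb) zb.
  - exact: u_deriv.
  - have ? := H_deriv zb; have ? := Phi_deriv zb.
    have -> : (fun x => H x * S + Phi x) = (S \*: H) + Phi.
      by apply/funext => w; rewrite fctE /= mulrC.
    by rewrite mulrC; exact: is_deriveD.
  - apply: le_trans (duP zb) _; rewrite lerD2r ler_wpM2l ?h0//.
    exact: uS.
apply: ler_wpM2l => //.
have Ht : H y <= H t by apply: (mono H_deriv h0) => //; case/andP: yb.
have Pt : Phi y <= Phi t by apply: (mono Phi_deriv phi0) => //; case/andP: yb.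
have := ler_wpM2r S0 Ht; have := mulr_ge0 (H0 xb) S0; have := Phi0 xb; lra.
Qed.

Let sup_bound s t a : 0 < s -> s <= t -> t <= b -> (a == s) || (a == t) ->
  forall x, s <= x <= t -> mnorm (u x) <= 2 * mnorm (u a) + 2 * c * Phi t.
Proof.
move=> s0 st tb ast.
have cont : {within `[s, t], continuous (fun x => mnorm (u x))}.
  apply: continuous_in_subspaceT => x; rewrite inE/= in_itv/= => /(sub s0 tb) xb.
  exact: mderiv_mnorm_continuous (u_deriv xb).
have [x0] := EVT_max st cont; rewrite in_itv/= => x0st x0max.
set S := mnorm (u x0) in x0max.
have uS z : s <= z <= t -> mnorm (u z) <= S by move=> zst; apply: x0max; rewrite in_itv.
have tb' : 0 < t <= b by rewrite (lt_le_trans s0 st).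
have S0 : 0 <= S by exact: mnorm_ge0.
have cS : c * (H t * S + Phi t) <= 2^-1 * S + c * Phi t.
  rewrite mulrDr mulrA lerD2r ler_wpM2r//; apply: le_trans small; rewrite ler_wpM2l//.
  by apply: (mono H_deriv h0) => //; case/andP: tb'.
(* The supremum [S] is attained at [x0], so that it can be absorbed. *)
have : S <= mnorm (u a) + (2^-1 * S + c * Phi t).
  rewrite /S -{1}[u x0](subrK (u a)) addrC.
  apply: le_trans (ler_mnormD _ _) _; rewrite lerD2l; apply: le_trans cS.
  case/andP: (x0st) => sx0 x0t.
  case/orP: ast => /eqP ->; first exact: (incr s0).
  by rewrite mnormB_sym; exact: (incr s0).
move=> SE x /uS; lra.
Qed.

(** Since [c * H b <= 1/2], the supremum of [u] over an interval is absorbed by the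
    left-hand side, which replaces Gronwall's lemma. *)
Lemma singular_ode_limit : exists l : 'M[K]_(m, p),
  u t @[t --> 0^'+] --> l /\
  forall t, 0 < t <= b -> mnorm (u t - l) <= 2 * c * (H t * mnorm l + Phi t).
Proof.
pose S := 2 * mnorm (u b) + 2 * c * Phi b.
have uS x : 0 < x <= b -> mnorm (u x) <= S.
  move=> /andP[x0 xb]; apply: (@sup_bound x b b) => //; first by rewrite eqxx orbT.
  by rewrite lexx.
have S0 : 0 <= S by apply: le_trans (uS b _); rewrite ?mnorm_ge0// b0 lexx.
have bound (g g' : R -> R) : (forall x, 0 < x <= b -> is_derive x 1 g (g' x)) ->
    (forall x, 0 < x <= b -> `|g' x| <= mnorm (du x)) ->
    (forall x, 0 < x <= b -> `|g x| <= S) -> cvg (g x @[x --> 0^'+]).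
  move=> dg g'u gS.
  apply: (@cvg_right_of_derive_bound g (fun x => H x * S + Phi x) g' (fun x => h x * S + phi x) b S) => // x xb.
  - have ? := H_deriv xb; have ? := Phi_deriv xb.
    have -> : (fun x => H x * S + Phi x) = (S \*: H) + Phi.
      by apply/funext => w; rewrite fctE /= mulrC.
    by rewrite mulrC; exact: is_deriveD.
  - apply: le_trans (g'u _ xb) _; apply: le_trans (duP xb) _.
    by rewrite lerD2r ler_wpM2l ?h0// uS.
  - by rewrite addr_ge0 ?mulr_ge0 ?H0 ?Phi0.
have cRe i j : cvg (complex.Re (u x i j) @[x --> 0^'+]).
  apply: (@bound _ (fun x => complex.Re (du x i j))) => x xb.
  - exact: mderiv_Re (u_deriv xb).
  - exact: le_trans (ler_Re_normc _) (ler_entry_mnorm _ _ _).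
  - by apply: le_trans (uS x xb); exact: le_trans (ler_Re_normc _) (ler_entry_mnorm _ _ _).
have cIm i j : cvg (complex.Im (u x i j) @[x --> 0^'+]).
  apply: (@bound _ (fun x => complex.Im (du x i j))) => x xb.
  - exact: mderiv_Im (u_deriv xb).
  - exact: le_trans (ler_Im_normc _) (ler_entry_mnorm _ _ _).
  - by apply: le_trans (uS x xb); exact: le_trans (ler_Im_normc _) (ler_entry_mnorm _ _ _).
pose l : 'M[K]_(m, p) := \matrix_(i, j)
  (lim (complex.Re (u x i j) @[x --> 0^'+]) +i* lim (complex.Im (u x i j) @[x --> 0^'+])).
have ul : u t @[t --> 0^'+] --> l.
  by apply: cvg_mx_ReIm => i j; rewrite mxE; [exact: cRe|exact: cIm].
exists l; split => // t /[dup] tb /andP[t0 t_b].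
apply/ler_addgt0Pr => e e0.
have e30 : 0 < e / 3 by rewrite divr_gt0.
move/cvg_mnorm0P : (ul) => /(_ _ e30) ue.
have : \forall s \near 0^'+, [/\ 0 < s, s <= t & mnorm (u s - l) < e / 3].
  near=> s; split; first by near: s; exact: nbhs_right_gt.
    by near: s; exact: nbhs_right_le.
  by near: s.
move=> /filter_ex[s [s0 st us]].
have us2 : mnorm (u s) <= mnorm l + e / 3.
  rewrite -[u s](subrK l) addrC; apply: le_trans (ler_mnormD _ _) _.
  by rewrite lerD2l ltW.
have E2 : mnorm (u t - u s) <= c * (H t * (2 * mnorm (u s) + 2 * c * Phi t) + Phi t).
  apply: (incr s0 t_b) => //; apply: sup_bound => //; by rewrite eqxx.
have E3 : mnorm (u t - l) <= mnorm (u t - u s) + e / 3.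
  have -> : u t - l = (u t - u s) + (u s - l) by rewrite addrA subrK.
  by apply: le_trans (ler_mnormD _ _) _; rewrite lerD2l ltW.
have cH : c * H t <= 2^-1.
  by apply: le_trans small; rewrite ler_wpM2l//; apply: (mono H_deriv h0).
have H1 := H0 tb; have P1 := Phi0 tb.
have cH0 : 0 <= c * H t by rewrite mulr_ge0.
have cP0 : 0 <= c * Phi t by rewrite mulr_ge0.
have M1 := ler_wpM2l cH0 us2.
have M2 := ler_wpM2r cP0 cH.
have M3 := ler_wpM2r (ltW e30) cH.
have -> : 2 * c * (H t * mnorm l + Phi t) = 2 * (c * H t * mnorm l) + 2 * (c * Phi t) by ring.
have E2' : c * (H t * (2 * mnorm (u s) + 2 * c * Phi t) + Phi t) =
  2 * (c * H t * mnorm (u s)) + 2 * (c * H t * (c * Phi t)) + c * Phi t by ring.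
rewrite E2' in E2; rewrite mulrDr in M1; lra.
Unshelve. all: by end_near. Qed.

End estimate.

End singular_ode.

(** * The renormalized equation *)

Section renormalized_equation.
Context {R : realType} {n : nat}.
Local Notation K := R[i].

Lemma mderiv_eq m p (f : R -> 'M[K]_(m, p)) (t : R) (X Y : 'M[K]_(m, p)) :
  mderiv f t X -> X = Y -> mderiv f t Y.
Proof. by move=> h <-. Qed.

(** Conjugating a system by [E], [Q] and [M] in turn: the Fuchsian part [t^-1 B]
    is removed by [E], and what is left is [Q]'s remainder and diagonal terms. *)
Lemma mderiv_renorm (E Q M : R -> 'M[K]_n.+1) (U : R -> 'cV[K]_n.+1) (t L : R)
    (B Rm Rsm D A dM dQ : 'M[K]_n.+1) (F : 'cV[K]_n.+1) :
  t != 0 -> L != 0 ->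
  mderiv E t ((- t^-1)%:C *: (B *m E t)) -> B *m E t = E t *m B ->
  mderiv Q t dQ -> mderiv M t dM -> mderiv U t (A *m U t + F) ->
  M t *m A + dM = ((t^-1)%:C *: B + L%:C *: Rm) *m M t ->
  Rsm = (L^-1)%:C *: dQ + Q t *m (((L * t)^-1)%:C *: B + Rm)
        - (((L * t)^-1)%:C *: B + D) *m Q t ->
  mderiv (fun s => E s *m Q s *m M s *m U s) t
    (L%:C *: (E t *m (Rsm + D *m Q t) *m (M t *m U t)) + E t *m Q t *m M t *m F).
Proof.
move=> t0 L0 dE EB dQt dMt dU eqM eqQ.
have {}eqQ : dQ = L%:C *: Rsm - Q t *m ((t^-1)%:C *: B + L%:C *: Rm)
                  + ((t^-1)%:C *: B + L%:C *: D) *m Q t.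
  have LLt : L%:C * ((L * t)^-1)%:C = (t^-1)%:C :> K.
    by rewrite -rmorphM invfM mulrA divff ?mul1r.
  have LB X : (t^-1)%:C *: B + L%:C *: X = L%:C *: (((L * t)^-1)%:C *: B + X).
    by rewrite scalerDr scalerA LLt.
  rewrite !LB -scalemxAl -scalemxAr -scalerBr -scalerDr.
  have -> : dQ = L%:C *: ((L^-1)%:C *: dQ).
    by rewrite scalerA -rmorphM divff// rmorph1 scale1r.
  congr (_ *: _); move: eqQ => /eqP; rewrite eq_sym subr_eq -subr_eq eq_sym => /eqP.
  by move=> ->; rewrite addrAC subrK addrK.
apply: mderiv_eq (mderivM (mderivM (mderivM dE dQt) dMt) dU) _.
rewrite mulmxDr addrA; congr (_ + _).
set V := M t *m U t.
have -> : (((- t^-1)%:C *: (B *m E t) *m Q t + E t *m dQ) *m M t + E t *m Q t *m dM) *m U t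
    + E t *m Q t *m M t *m (A *m U t) =
    ((- t^-1)%:C *: (B *m E t) *m Q t + E t *m dQ) *m V + E t *m Q t *m (M t *m A + dM) *m U t.
  move: (_ + E t *m dQ) => G.
  rewrite mulmxDl mulmxDr mulmxDl /V !mulmxA -!addrA; congr (_ + _).
  exact: addrC.
rewrite eqM; set W := (t^-1)%:C *: B + L%:C *: Rm.
have -> : E t *m Q t *m (W *m M t) *m U t = E t *m (Q t *m W) *m V by rewrite /V !mulmxA.
have -> : (- t^-1)%:C *: (B *m E t) *m Q t = E t *m (- ((t^-1)%:C *: (B *m Q t))).
  by rewrite EB rmorphN scaleNr mulNmx mulmxN -scalemxAl -scalemxAr mulmxA.
rewrite -!mulmxDr -!mulmxDl -!mulmxDr.
rewrite (scalemxAl _ (E t *m _) V) (scalemxAr _ (E t)); congr (_ *m _ *m _).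
rewrite eqQ -/W mulmxDl -!scalemxAl scalerDr.
by rewrite addrCA addKr addrAC subrK.
Qed.

End renormalized_equation.

Section symbol_bounds.
Context {R : realType} {d n : nat}.
Local Notation K := R[i].
Implicit Types (f : R -> 'rV[R]_d -> 'M[K]_n) (ell : 'I_d -> R) (V : set (R * 'rV[R]_d)).

Lemma symbol_star_mnorm ell V a f : symbol_star ell V a f ->
  exists (C : R) (p : nat), 0 <= C /\ forall t xi, V (t, xi) ->
    mnorm (f t xi) <= C * zvar ell t xi `^ a * (1 + `|ln (zvar ell t xi)|) ^+ p.
Proof.
move=> [_ [g [gf [p /(_ 0%N)[C gC]]]]].
exists ((n * n)%:R * `|C|), p; split; first by rewrite mulr_ge0.
move=> t xi Vt; have [g0 _] := gf xi; rewrite -g0//.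
apply: le_trans (ler_mnorm_cnorm _) _; rewrite -!mulrA ler_wpM2l//.
apply: le_trans (gC t xi Vt) _; rewrite -mulrA ler_wpM2r ?ler_norm//.
by rewrite mulr_ge0 ?powR_ge0// exprn_ge0// addr_ge0.
Qed.

Lemma symbol0_mnorm ell V f : symbol ell V 0 f ->
  exists C : R, 0 <= C /\ forall t xi, V (t, xi) -> mnorm (f t xi) <= C.
Proof.
move=> [_ [g [gf /(_ 0%N)[C gC]]]].
exists ((n * n)%:R * `|C|); split; first by rewrite mulr_ge0.
move=> t xi Vt; have [g0 _] := gf xi; rewrite -g0//.
apply: le_trans (ler_mnorm_cnorm _) _; rewrite ler_wpM2l//.
by apply: le_trans (gC t xi Vt) _; rewrite powRr0 mulr1 ler_norm.
Qed.

End symbol_bounds.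

(** * Size of the renormalized coefficients *)

Section pointwise_growth.
Context {R : realType} {n : nat}.
Local Notation K := R[i].

(** Write v = Q v - (Q - 1) v and absorb the last term. *)
Lemma near_id_bound (Q : 'M[K]_n.+1) (v : 'cV[K]_n.+1) :
  mnorm (Q - 1%:M) <= 2^-1 -> mnorm v <= 2 * mnorm (Q *m v).
Proof.
move=> Q1; have h : mnorm v <= mnorm (Q *m v) + 2^-1 * mnorm v.
  rewrite {1}(_ : v = Q *m v - (Q - 1%:M) *m v); last first.
    by rewrite mulmxBl mul1mx opprB addrC subrK.
  apply: le_trans (ler_mnormB _ _) _; rewrite lerD2l.
  by apply: le_trans (ler_mnormM _ _) _; rewrite ler_wpM2r ?mnorm_ge0.
by lra.
Qed.

Variables (B Q Rs D : 'M[K]_n.+1) (v : 'cV[K]_n.+1) (x b : R).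
Hypothesis Bb : mnorm B <= b.
Hypothesis Q1 : mnorm (Q - 1%:M) <= 2^-1.
Let u := mexp B x *m Q *m v.

Let mexp_b y : mnorm (mexp B y) <= n.+1%:R ^+ 2 * expR (b * `|y|).
Proof.
apply: le_trans (ler_mnorm_mexp _ _) _; rewrite ler_wpM2l ?exprn_ge0//.
by rewrite ler_expR ler_wpM2r.
Qed.

Lemma ler_mnorm_unrenorm : mnorm v <= 2 * n.+1%:R ^+ 2 * expR (b * `|x|) * mnorm u.
Proof.
apply: le_trans (near_id_bound _ Q1) _; rewrite -2!(mulrA 2) ler_wpM2l//.
have -> : Q *m v = mexp B (- x) *m u by rewrite /u !mulmxA mexpNK mul1mx.
by apply: le_trans (ler_mnormM _ _) _; rewrite ler_wpM2r ?mnorm_ge0// -(normrN x) mexp_b.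
Qed.

(** The remainder [Rs] is conjugated by brute force, which costs the factor
    exp(2 b |x|), whereas [D] is only multiplied by a power of 1 + |x|, thanks to
    Hadamard's formula. This is why diagonal terms may be kept at every order while
    the remainder has to be small. *)
Lemma ler_mnorm_growth : jordan_normal_form B -> is_diag_mx D ->
  mnorm (mexp B x *m (Rs + D *m Q) *m v) <=
    (2 * n.+1%:R ^+ 4 * expR (2 * b * `|x|) * mnorm Rs +
     (1 + 2 * b) ^+ n.+1 * n.+1%:R * (1 + `|x|) ^+ n.+1 * mnorm D) * mnorm u.
Proof.
move=> BJ Dd; rewrite mulmxDr mulmxDl; apply: le_trans (ler_mnormD _ _) _.
rewrite [leRHS]mulrDl; apply: lerD.
  rewrite -mulmxA; apply: le_trans (ler_mnormM _ _) _.
  apply: le_trans (ler_pM _ _ (mexp_b x) (le_trans (ler_mnormM _ _) (ler_wpM2l _ ler_mnorm_unrenorm))) _; rewrite ?mnorm_ge0//.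
  rewrite (_ : 2 * b * `|x| = b * `|x| + b * `|x|) ?expRD; last by ring.
  by rewrite le_eqVlt; apply/orP; left; apply/eqP; ring.
rewrite mulmxA (mexp_conj x _ (ad_jordan_nilpotent BJ Dd))// -!mulmxA [mexp B x *m _]mulmxA -/u.
apply: le_trans (ler_mnormM _ _) _; rewrite ler_wpM2r ?mnorm_ge0//.
apply: le_trans (ler_mnorm_ad_exp _ _ _ _) _.
rewrite -!mulrA ler_wpM2r ?mulr_ge0 ?exprn_ge0 ?addr_ge0 ?mnorm_ge0//.
have b0 : 0 <= b := le_trans (mnorm_ge0 B) Bb.
by rewrite lerXn2r ?nnegrE ?addr_ge0 ?mulr_ge0 ?mnorm_ge0// lerD2l ler_wpM2l.
Qed.

End pointwise_growth.

Section bracket.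
Context {R : realType} {d : nat}.
Implicit Types (ell : 'I_d.+1 -> R) (xi : 'rV[R]_d.+1).

Lemma japanese_ge1 (r : R) : 1 <= japanese r.
Proof. by rewrite /japanese -{1}sqrtr1 ler_wsqrtr// lerDl sqr_ge0. Qed.

Lemma bracket_ge1 ell xi : (forall i, -1 < ell i) -> 1 <= bracket ell xi.
Proof.
move=> ell1; apply: (@le_trans _ _ (japanese (xi 0 ord0) `^ (ell ord0 + 1)^-1)).
  apply: (@le_trans _ _ (1 `^ (ell ord0 + 1)^-1)); first by rewrite powR1.
  rewrite ge0_ler_powR ?nnegrE ?japanese_ge1//.
  - by rewrite invr_ge0; have := ell1 ord0; lra.
  - exact: le_trans (japanese_ge1 _).
exact: (le_bigmax_cond _ (fun i => japanese (xi 0 i) `^ (ell i + 1)^-1)).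
Qed.

(** Any exponent above all the 1 / (ell i + 1) will do; their sum avoids discussing
    the maximum. *)
Lemma bracket_le_japanese ell : (forall i, -1 < ell i) -> exists2 kappa : R, 0 < kappa &
  forall xi, bracket ell xi <= japanese (rnorm xi) `^ kappa.
Proof.
move=> ell1; have inv0 i : 0 < (ell i + 1)^-1.
  by rewrite invr_gt0; have := ell1 i; lra.
exists (\sum_i (ell i + 1)^-1).
  rewrite (bigD1 ord0)//= ltr_wpDr//.
  by apply: sumr_ge0 => i _; exact: ltW.
move=> xi; apply: bigmax_le => [|i _]; first exact: powR_ge0.
have jle : japanese (xi 0 i) <= japanese (rnorm xi).
  rewrite /japanese ler_wsqrtr// lerD2l /rnorm sqr_sqrtr.
    by rewrite (bigD1 i)//= lerDl; apply: sumr_ge0 => j _; exact: sqr_ge0.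
  by apply: sumr_ge0 => j _; exact: sqr_ge0.
apply: (@le_trans _ _ (japanese (rnorm xi) `^ (ell i + 1)^-1)).
  by rewrite ge0_ler_powR ?nnegrE// ?(ltW (inv0 i))// (le_trans ler01)// japanese_ge1.
rewrite ler_powR ?japanese_ge1// (bigD1 i)//= lerDl.
by apply: sumr_ge0 => j _; exact: ltW.
Qed.

End bracket.

Section zone_constants.
Context {R : realType} {d n : nat}.
Local Notation K := R[i].
Local Notation matfun := (R -> 'rV[R]_d.+1 -> 'M[K]_n.+1).
Variables (T : R) (ell : 'I_d.+1 -> R) (rho : R).
Hypothesis ell1 : forall i, -1 < ell i.
Hypothesis rho1 : rho < 1.
Local Notation V := (ZP T ell rho).
Local Notation z := (zvar ell).

Lemma bracket_gt0 xi : 0 < bracket ell xi.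
Proof. exact: lt_le_trans ltr01 (bracket_ge1 xi ell1). Qed.

Lemma ZP_zvar t xi : V (t, xi) -> 0 < z t xi <= 1.
Proof.
move=> [/andP[/= t0 _] zr]; rewrite /zvar mulr_gt0 ?bracket_gt0//=.
exact: le_trans zr (ltW rho1).
Qed.

Lemma powRD_gt0 (x r s : R) : 0 < x -> x `^ (r + s) = x `^ r * x `^ s.
Proof. by move=> x0; rewrite powRD//; apply/implyP => _; rewrite gt_eqF. Qed.

(** As z <= 1, the term of lowest order dominates: all the powers are compared with
    the one at k = 1, and the numbers of logarithms are added up. *)
Lemma sum_symbol_star (s a : R) (f : nat -> matfun) : 0 < s ->
  (forall k, (0 < k)%N -> symbol_star ell V (k%:R * s + a) (f k)) ->
  forall m, exists (C : R) (q : nat), 0 <= C /\ forall t xi, V (t, xi) ->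
    mnorm (\sum_(1 <= k < m.+1) f k t xi) <=
      C * z t xi `^ (s + a) * (1 + `|ln (z t xi)|) ^+ q.
Proof.
move=> s0 fS; elim=> [|m [C [q [C0 IH]]]].
  exists 0, 0%N; split => // t xi Vt.
  by rewrite big_geq// mnorm0 !mul0r.
have [C' [q' [C'0 fC']]] := symbol_star_mnorm (fS m.+1 isT).
exists (C + C'), (q + q')%N; split; first exact: addr_ge0.
move=> t xi Vt; rewrite big_nat_recr//=; apply: le_trans (ler_mnormD _ _) _.
have /andP[z0 z1] := ZP_zvar Vt.
have l1 : 1 <= 1 + `|ln (z t xi)| by rewrite lerDl.
have l0 : 0 <= 1 + `|ln (z t xi)| by exact: le_trans l1.
rewrite 2!mulrDl; apply: lerD.
  apply: le_trans (IH t xi Vt) _; rewrite ler_wpM2l ?mulr_ge0 ?powR_ge0//.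
  by rewrite ler_weXn2l// leq_addr.
apply: le_trans (fC' t xi Vt) _; apply: ler_pM.
- by rewrite mulr_ge0 ?powR_ge0.
- exact: exprn_ge0.
- rewrite ler_wpM2l//; apply: ger_powR; first by rewrite z0.
  by rewrite lerD2r ler_peMl ?(ltW s0)// ler1n.
- by rewrite ler_weXn2l// leq_addl.
Qed.

Variables (aP : R) (A MP RP : matfun) (BP : 'rV[R]_d.+1 -> 'M[K]_n.+1).
Variables (DPs NPs RPs : nat -> matfun) (m : nat) (b : R).
Hypothesis rho0 : 0 < rho.
Hypothesis aP1 : -1 < aP.
Hypothesis HP : assumption_P T ell rho A aP MP BP RP.
Hypothesis HR : renormalization_P T ell rho aP BP RP DPs NPs RPs.
Hypothesis BPb : forall xi, mnorm (BP xi) <= b.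
Hypothesis mb : 2 * b <= m%:R * (aP + 1).
Let eps := (aP + 1) / 2.

Let eps0 : 0 < eps. Proof. by rewrite divr_gt0//; move: aP1; lra. Qed.

(** With eps = (aP + 1) / 2 the exponents balance as follows: the diagonal terms are
    O(z^aP) up to logarithms, the conjugated remainder is O(z^(m (aP + 1) + aP - 2 b)),
    hence O(z^aP) by the choice of [m], and a factor z^(- eps) pays for the logarithms;
    the result is z^(aP - eps) = z^(eps - 1). The number [N] is a constant of the
    singular ODE estimate, and [rho1] is taken small with respect to it. *)
Lemma zone_constants (N : R) : 0 <= N -> exists C rho1 : R, [/\ 0 <= C, 0 < rho1 <= rho / 2,
  N * (C / eps * rho1 `^ eps) <= 2^-1 &
  forall t xi, V (t, xi) -> z t xi <= rho1 ->
    mnorm (Qmx NPs m t xi - 1%:M) <= 2^-1 /\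
    forall v : 'cV[K]_n.+1,
    let D := \sum_(1 <= k < m.+1) DPs k t xi in
    mnorm (calEP ell BP t xi *m (RPs m t xi + D *m Qmx NPs m t xi) *m v)
    <= C * z t xi `^ (eps - 1) * mnorm (calEP ell BP t xi *m Qmx NPs m t xi *m v)].
Proof.
move=> N0.
have s0 : 0 < aP + 1 by move: aP1; lra.
have [R0 HR'] := HR.
have [CN [qN [CN0 NB]]] : exists (C : R) (q : nat), 0 <= C /\ forall t xi, V (t, xi) ->
    mnorm (Qmx NPs m t xi - 1%:M) <= C * z t xi `^ (aP + 1) * (1 + `|ln (z t xi)|) ^+ q.
  have [|C [q [C0 CB]]] := @sum_symbol_star (aP + 1) 0 NPs s0 _ m.
    by move=> k k0; rewrite addr0; case: (HR' k k0).
  exists C, q; split=> // t xi Vt.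
  by have := CB t xi Vt; rewrite addr0 /Qmx addrAC subrr add0r.
have [CD [qD [CD0 DB]]] : exists (C : R) (q : nat), 0 <= C /\ forall t xi, V (t, xi) ->
    mnorm (\sum_(1 <= k < m.+1) DPs k t xi) <= C * z t xi `^ aP * (1 + `|ln (z t xi)|) ^+ q.
  have [|C [q [C0 CB]]] := @sum_symbol_star (aP + 1) (- 1) DPs s0 _ m.
    by move=> k k0; case: (HR' k k0).
  exists C, q; split=> // t xi Vt.
  by have := CB t xi Vt; rewrite addrK.
have [CR [qR [CR0 RB]]] : exists (C : R) (q : nat), 0 <= C /\ forall t xi, V (t, xi) ->
    mnorm (RPs m t xi) <= C * z t xi `^ (m%:R * (aP + 1) + aP) * (1 + `|ln (z t xi)|) ^+ q.
  case: (posnP m) => [->|m0]; last by apply: symbol_star_mnorm; case: (HR' m m0).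
  case: HP => _ _ _ /symbol_star_mnorm[C [q [C0 CB]]] _.
  by exists C, q; split => // t xi Vt; rewrite R0// mul0r add0r CB.
have [C1 C10 lN] := log_power_bound qN eps0.
have [C2 C20 lD] := log_power_bound (qD + n.+1) eps0.
have [C3 C30 lR] := log_power_bound qR eps0.
pose K1 := (2 * n.+1%:R ^+ 4 * (CR * C3) + (1 + 2 * b) ^+ n.+1 * n.+1%:R * (CD * C2)).
have b0 : 0 <= b := le_trans (mnorm_ge0 _) (BPb 0).
have K10 : 0 <= K1.
  by rewrite addr_ge0// !mulr_ge0// exprn_ge0// addr_ge0// mulr_ge0.
(* Large enough that rho1 ^ eps <= 1 / big gives both smallness requirements. *)
pose big := 2 * (CN * C1 + N * K1 / eps + 1).
have big0 : 0 < big.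
  by rewrite mulr_gt0// ltr_wpDl// addr_ge0 ?mulr_ge0// ?invr_ge0 ?(ltW eps0).
pose r := Num.min (rho / 2) (big^-1 `^ eps^-1).
have r0 : 0 < r by rewrite lt_min divr_gt0//= powR_gt0// invr_gt0.
have reps : r `^ eps <= big^-1.
  apply: (@le_trans _ _ ((big^-1 `^ eps^-1) `^ eps)).
    by rewrite ge0_ler_powR ?nnegrE ?powR_ge0 ?(ltW eps0) ?(ltW r0)// ge_min lexx orbT.
  by rewrite -powRrM mulVf ?gt_eqF// powRr1// invr_ge0 ltW.
have bigE x : 0 <= x -> x <= big / 2 -> x * r `^ eps <= 2^-1.
  move=> x0 xb; apply: le_trans (ler_pM x0 (powR_ge0 _ _) xb reps) _.
  by rewrite mulrAC divff ?gt_eqF// mul1r.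
have big2 : big / 2 = CN * C1 + N * K1 / eps + 1 by rewrite /big mulrAC divff// mul1r.
have CN1 : 0 <= CN * C1 by exact: mulr_ge0.
have NK1 : 0 <= N * K1 / eps by rewrite !mulr_ge0// invr_ge0 ltW.
exists K1, r; split => //.
- by rewrite r0 ge_min lexx.
- by rewrite mulrA mulrA bigE// big2; lra.
move=> t xi Vt zr; have z01 := ZP_zvar Vt; have /andP[z0 z1] := z01.
have zeps : z t xi `^ eps <= r `^ eps.
  by rewrite ge0_ler_powR ?nnegrE ?(ltW eps0) ?(ltW r0) ?(ltW z0).
have lz (q : nat) (C : R) (CB : forall z : R, 0 < z -> (1 + `|ln z|) ^+ q <= C * expR (eps * `|ln z|)) :
    (1 + `|ln (z t xi)|) ^+ q <= C * z t xi `^ (- eps).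
  by apply: le_trans (CB _ z0) _; rewrite expR_norm_ln.
have Q1 : mnorm (Qmx NPs m t xi - 1%:M) <= 2^-1.
  apply: le_trans (NB t xi Vt) _.
  apply: le_trans (ler_wpM2l _ (lz _ _ lN)) _; first by rewrite mulr_ge0 ?powR_ge0.
  rewrite mulrACA -powRD_gt0//.
  have -> : aP + 1 - eps = eps by rewrite /eps; lra.
  apply: le_trans (ler_wpM2l CN1 zeps) _.
  by rewrite bigE// big2; lra.
split=> // v /=; set D := \sum_(1 <= k < _) _.
have [_ _ [_ BJ] _ _] := HP.
have Dd : is_diag_mx D.
  apply/is_diag_mxP => i j ij; rewrite summxE big_nat_cond big1// => k /andP[/andP[k1 _] _].
  have [_ Dk _ _ _] := HR' k k1.
  by have /is_diag_mxP := Dk t xi Vt; exact.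
have := ler_mnorm_growth (RPs m t xi) v (- ln (z t xi)) (BPb xi) Q1 (BJ t xi Vt) Dd.
rewrite /mexp -/(calEP _ _ _ _) => h; apply: le_trans h _.
rewrite ler_wpM2r ?mnorm_ge0// normrN /K1 [leRHS]mulrDl; apply: lerD.
  rewrite -(mulrA (2 * _)) -(mulrA (2 * _)) ler_wpM2l ?mulr_ge0 ?exprn_ge0//.
  apply: le_trans (ler_wpM2l (expR_ge0 _) (RB t xi Vt)) _.
  rewrite mulrA expR_norm_ln//.
  apply: le_trans (ler_wpM2l _ (lz _ _ lR)) _.
    by rewrite mulr_ge0 ?powR_ge0// mulr_ge0 ?powR_ge0.
  have -> : z t xi `^ (- (2 * b)) * (CR * z t xi `^ (m%:R * (aP + 1) + aP)) * (C3 * z t xi `^ (- eps)) =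
    CR * C3 * (z t xi `^ (- (2 * b)) * z t xi `^ (m%:R * (aP + 1) + aP) * z t xi `^ (- eps)) by ring.
  rewrite -!powRD_gt0// ler_wpM2l ?mulr_ge0// ger_powR ?z0//.
  by rewrite /eps; move: mb; lra.
set G := (1 + 2 * b) ^+ n.+1 * n.+1%:R.
have G0 : 0 <= G by rewrite mulr_ge0// exprn_ge0// addr_ge0// mulr_ge0.
rewrite -(mulrA G) -(mulrA G) ler_wpM2l//.
apply: le_trans (ler_wpM2l _ (DB t xi Vt)) _; first by rewrite exprn_ge0// addr_ge0.
have -> : (1 + `|ln (z t xi)|) ^+ n.+1 * (CD * z t xi `^ aP * (1 + `|ln (z t xi)|) ^+ qD) =
    CD * z t xi `^ aP * (1 + `|ln (z t xi)|) ^+ (qD + n.+1) by rewrite exprD; ring.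
apply: le_trans (ler_wpM2l _ (lz _ _ lD)) _; first by rewrite mulr_ge0 ?powR_ge0.
rewrite mulrACA -powRD_gt0// ler_wpM2l ?mulr_ge0// ger_powR ?z0//.
by rewrite /eps; lra.
Qed.

End zone_constants.

(** * Limit of the renormalized solution at frequency [xi] *)

Section zone_estimate.
Context {R : realType} {d n : nat}.
Local Notation K := R[i].
Local Notation matfun := (R -> 'rV[R]_d.+1 -> 'M[K]_n.+1).
Local Notation vecfun := (R -> 'rV[R]_d.+1 -> 'cV[K]_n.+1).
Local Notation mu := (@lebesgue_measure R).
Variables (T : R) (ell : 'I_d.+1 -> R) (rho aP : R).
Hypothesis ell1 : forall i, -1 < ell i.
Hypothesis rho01 : 0 < rho < 1.
Variables (A MP RP : matfun) (BP : 'rV[R]_d.+1 -> 'M[K]_n.+1).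
Variables (DPs NPs RPs : nat -> matfun) (m : nat).
Hypothesis HP : assumption_P T ell rho A aP MP BP RP.
Hypothesis HR : renormalization_P T ell rho aP BP RP DPs NPs RPs.
Local Notation V := (ZP T ell rho).
Local Notation z := (zvar ell).
Local Notation L := (bracket ell).
Local Notation E := (calEP ell BP).
Local Notation Q := (Qmx NPs m).
Local Notation D t xi := (\sum_(1 <= k < m.+1) DPs k t xi).

Let L0 xi : 0 < L xi. Proof. exact: bracket_gt0. Qed.

(** The chain rule for x = - ln (L t), whose derivative is - 1 / t. *)
Lemma mderiv_calEP t xi : 0 < t ->
  mderiv (E ^~ xi) t ((- t^-1)%:C *: (BP xi *m E t xi)).
Proof.
move=> t0; have d1 : is_derive t 1 (fun s => - ln (L xi * s)) (- t^-1).
  have dL : is_derive t 1 (fun s => L xi * s) (L xi).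
    have dk := @is_deriveZ _ _ _ id (L xi) t 1 1 (is_derive_id t 1).
    by apply: is_derive_eq dk _; rewrite [_ *: 1]mulr1.
  have dl := is_derive1_comp (is_derive1_ln (mulr_gt0 (L0 xi) t0)) dL.
  have dn := is_deriveN dl.
  apply: is_derive_eq dn _; rewrite invfM mulrAC mulVf ?mul1r// gt_eqF//.
exact: (mderiv_comp d1 (@mderiv_mexp _ _ (BP xi) _)).
Qed.

Section interior.
Variables (t : R) (xi : 'rV[R]_d.+1).
Hypothesis t0T : 0 < t < T.
Hypothesis zt : z t xi < rho.

Let t0 : 0 < t. Proof. by case/andP: t0T. Qed.

Lemma ZP_interior : V (t, xi).
Proof. by case/andP: t0T => ? tT; split; [rewrite /= t0 ltW|exact: ltW]. Qed.

Lemma nbhs_ZP_section : nbhs t (tsection V xi).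
Proof.
case/andP: t0T => _ tT; have := zt; rewrite /zvar => zt'.
have tr : t < rho / L xi by rewrite ltr_pdivlMr// mulrC.
near=> s; split => /=.
  apply/andP; split; first by near: s; exact: lt_nbhsr.
  by apply: ltW; near: s; exact: lt_nbhsl.
rewrite /zvar /= mulrC -ler_pdivlMr//.
by apply: ltW; near: s; exact: lt_nbhsl.
Unshelve. all: by end_near. Qed.

Lemma nbhs_0T : nbhs t (`]0, T]%classic : set R).
Proof.
case/andP: t0T => _ tT; near=> s; rewrite /= in_itv/=.
apply/andP; split; first by near: s; exact: lt_nbhsr.
by apply: ltW; near: s; exact: lt_nbhsl.
Unshelve. all: by end_near. Qed.

(** At order 0, where [Q] is the identity, the renormalization identity is the
    definition of [RPs 0]. *)
Lemma Qmx_derivable : exists dQ, mderiv (Q ^~ xi) t dQ /\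
  RPs m t xi = ((L xi)^-1)%:C *: dQ
    + Q t xi *m (((L xi * t)^-1)%:C *: BP xi + RP t xi)
    - (((L xi * t)^-1)%:C *: BP xi + D t xi) *m Q t xi.
Proof.
have [R0 HR'] := HR; case: (posnP m) => [m0|m0].
  exists 0; rewrite m0; split.
    rewrite (_ : (fun _ => _) = fun=> 1%:M); first exact: mderiv_cst.
    by apply/funext => s; rewrite /Qmx big_geq// addr0.
  rewrite (R0 _ _ ZP_interior) /Qmx !big_geq// !addr0 mul1mx mulmx1 scaler0 add0r.
  by rewrite addrAC subrr add0r.
have [_ _ _ _ RI] := HR' m m0.
have [dN [dNk RE]] := RI t xi ZP_interior.
exists (\sum_(1 <= k < m.+1) dN k); split; last by rewrite scaler_sumr.
rewrite -[X in mderiv _ _ X]add0r; apply: mderivD; first exact: mderiv_cst.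
apply: mderiv_sum => k; rewrite mem_index_iota ltnS => km.
exact: mderiv_within nbhs_ZP_section (dNk k km).
Qed.

Lemma MP_derivable : exists dM, mderiv (MP ^~ xi) t dM /\
  MP t xi *m A t xi + dM = ((t^-1)%:C *: BP xi + (L xi)%:C *: RP t xi) *m MP t xi.
Proof.
have [Mu _ _ _ HM] := HP; have [dM [dMt ME]] := HM t xi ZP_interior.
exists dM; split; first exact: mderiv_within nbhs_ZP_section dMt.
by rewrite -ME mulmxDl !mulmxKV// Mu//; exact: ZP_interior.
Qed.

Lemma mderiv_renormP (F U : vecfun) : is_solution T A F U ->
  mderiv (renormP ell BP MP NPs m U ^~ xi) t
    ((L xi)%:C *: (E t xi *m (RPs m t xi + D t xi *m Q t xi) *m (MP t xi *m U t xi))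
     + renormP ell BP MP NPs m F t xi).
Proof.
move=> sol; have [dQ [dQt QE]] := Qmx_derivable; have [dM [dMt ME]] := MP_derivable.
have [/(_ t) dU _] := sol xi.
have Lxi0 : L xi != 0 by rewrite gt_eqF.
have tn0 : t != 0 by rewrite gt_eqF.
have dUt : mderiv (U ^~ xi) t (A t xi *m U t xi + F t xi).
  by apply: (mderiv_within nbhs_0T); apply: dU; case/andP: t0T => -> /ltW ->.
have EC : BP xi *m E t xi = E t xi *m BP xi by exact: mexp_comm.
exact: (mderiv_renorm tn0 Lxi0 (@mderiv_calEP t xi t0) EC dQt dMt dUt ME QE).
Qed.

Lemma renormP_continuous_at (F : vecfun) :
  continuous_on [set p : R * 'rV[R]_d.+1 | 0 < p.1 <= T] F ->
  renormP ell BP MP NPs m F s xi @[s --> t] --> renormP ell BP MP NPs m F t xi.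
Proof.
move=> cF; have [dQ [dQt _]] := Qmx_derivable; have [dM [dMt _]] := MP_derivable.
have dnb (p q : nat) (f : R -> 'M[K]_(p, q)) df : mderiv f t df -> f s @[s --> t] --> f t.
  by move=> /mderiv_continuous/continuous_withinNx.
apply: cvg_mulmx; last first.
  move/subspace_continuousP: cF => /(_ (t, xi)).
  have Vt : 0 < t <= T by case/andP: t0T => -> /ltW.
  move=> /(_ Vt)/= cF; apply: cvg_trans cF => B; rewrite /= !near_simpl => BV.
  have pc : (s, xi) @[s --> t] --> (t, xi) by exact: (cvg_pair cvg_id (cvg_cst xi)).
  have {}pc := pc _ BV; near=> s.
  suff : (fun p : R * 'rV[R]_d.+1 => 0 < p.1 <= T -> B (F p.1 p.2)) (s, xi).
    by apply => /=; have : (`]0, T]%classic : set R) s by near: s; exact: nbhs_0T.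
  by near: s; exact: pc.
apply: cvg_mulmx; last exact: dnb dMt.
apply: cvg_mulmx; last exact: dnb dQt.
exact: dnb (@mderiv_calEP t xi t0).
Unshelve. all: by end_near. Qed.

Lemma mnorm_renormP_continuous (F : vecfun) :
  continuous_on [set p : R * 'rV[R]_d.+1 | 0 < p.1 <= T] F ->
  {for t, continuous (fun s => mnorm (renormP ell BP MP NPs m F s xi))}.
Proof.
move=> cF; have /cvg_mnorm0P cFt := renormP_continuous_at cF.
apply/cvgrPdistC_lt => e /cFt; apply: filterS => s; apply: le_lt_trans.
set X := renormP _ _ _ _ _ _ s _; set Y := renormP _ _ _ _ _ _ t _.
have h1 : mnorm X <= mnorm (X - Y) + mnorm Y by rewrite -{1}[X](subrK Y) ler_mnormD.
have h2 : mnorm Y <= mnorm (X - Y) + mnorm X.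
  by rewrite mnormB_sym -{1}[Y](subrK X) ler_mnormD.
by rewrite ler_norml; apply/andP; split; lra.
Qed.

End interior.

Lemma measurable_mnorm_renormP (F : vecfun) t1 xi :
  continuous_on [set p : R * 'rV[R]_d.+1 | 0 < p.1 <= T] F ->
  0 < t1 < T -> z t1 xi < rho ->
  measurable_fun (`]0%R, t1]%classic : set R)
    (fun t => mnorm (renormP ell BP MP NPs m F t xi)).
Proof.
move=> cF /andP[t10 t1T] zt1.
apply: subspace_continuous_measurable_fun => //.
apply: continuous_in_subspaceT => t; rewrite inE/= in_itv/= => /andP[t0 tt1].
apply: mnorm_renormP_continuous => //; first by rewrite t0 (le_lt_trans tt1).
by apply: le_lt_trans zt1; rewrite /zvar ler_pM2l.
Qed.


Lemma is_derive_powR (a x : R) : 0 < x -> is_derive x 1 (fun y : R => y `^ a) (a * x `^ (a - 1)).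
Proof.
move=> x0; have xin : x \in `]0, +oo[%R by rewrite in_itv/= x0.
apply: DeriveDef; first exact: derivable_powR.
by rewrite -derive1E powR_derive1.
Qed.

Variable b : R.
Hypothesis aP1 : -1 < aP.
Hypothesis BPb : forall xi, mnorm (BP xi) <= b.
Hypothesis mb : 2 * b <= m%:R * (aP + 1).
Let eps := (aP + 1) / 2.
Let eps0 : 0 < eps. Proof. by rewrite divr_gt0//; move: aP1; lra. Qed.

(** [singular_ode_limit] with H t a multiple of z^eps and Phi t the integral of the
    source over ]0, t]. The fundamental theorem of calculus differentiates [Phi] only
    below [t1], so the bound is first obtained on the open interval and then passed to
    the endpoint by continuity. *)
Lemma zone_estimate : exists C rho1 : R, [/\ 0 <= C, 0 < rho1 <= rho / 2,
  forall t xi, V (t, xi) -> z t xi <= rho1 -> mnorm (Q t xi - 1%:M) <= 2^-1 &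
  forall F U : vecfun,
    continuous_on [set p : R * 'rV[R]_d.+1 | 0 < p.1 <= T] F ->
    is_solution T A F U ->
  forall xi t1, 0 < t1 < T -> z t1 xi <= rho1 ->
    (\int[mu]_(tau in `]0%R, t1]) (mnorm (renormP ell BP MP NPs m F tau xi))%:E < +oo)%E ->
  exists l : 'cV[K]_n.+1, renormP ell BP MP NPs m U tau xi @[tau --> 0^'+] --> l /\
    forall t, 0 < t <= t1 ->
      mnorm (renormP ell BP MP NPs m U t xi - l) <=
        C * (z t xi `^ eps * mnorm l +
             \int[mu]_(tau in `]0%R, t]) mnorm (renormP ell BP MP NPs m F tau xi))].
Proof.
have [rho0 rho_lt1] := andP rho01.
pose c : R := (2 * (n.+1 * 1))%:R.
have c0 : 0 <= c by exact: ler0n.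
have [C1 [rho1 [C10 /andP[rho10 rho1r] small]]] :=
  zone_constants ell1 rho_lt1 rho0 aP1 HP HR BPb mb c0.
move=> CQ; have cC : 0 <= 2 * c * (C1 / eps) by rewrite !mulr_ge0// invr_ge0 ltW.
exists (2 * c * (C1 / eps) + 2 * c), rho1; split.
- by rewrite addr_ge0// mulr_ge0.
- by rewrite rho10.
- by move=> t xi Vt zt; case: (CQ t xi Vt zt).
move=> F U cF sol xi t1 /andP[t10 t1T] zt1 Ffin.
set u := fun t => renormP ell BP MP NPs m U t xi.
set phi := fun t => mnorm (renormP ell BP MP NPs m F t xi).
pose Phi t := \int[mu]_(tau in `]0%R, t]) phi tau.
have tb t : 0 < t <= t1 -> [/\ 0 < t < T, z t xi <= rho1 & z t xi < rho].
  move=> /andP[t0 tt1].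
  have zz : z t xi <= rho1 by apply: le_trans zt1; rewrite /zvar ler_pM2l.
  split=> //; first by rewrite t0 (le_lt_trans tt1).
  by apply: le_lt_trans zz _; apply: le_lt_trans rho1r _; move: rho0; lra.
have phic t : 0 < t <= t1 -> {for t, continuous phi}.
  by move=> /tb[t0T _ zt]; exact: mnorm_renormP_continuous.
have phim : measurable_fun (`]0%R, t1]%classic : set R) phi.
  by apply: measurable_mnorm_renormP => //; [rewrite t10|case: (tb t1); rewrite ?t10 ?lexx].
have phii : mu.-integrable `]0%R, t1] (EFin \o phi).
  apply/integrableP; split; first exact/measurable_EFinP.
  apply: le_lt_trans Ffin; apply: ge0_le_integral => //=.
  - apply/measurable_EFinP; apply: (measurableT_comp (@normr_measurable _ _)) => //.
  - exact/measurable_EFinP.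
  - by move=> t _; rewrite lee_fin ger0_norm// mnorm_ge0.
have Phid t : 0 < t < t1 -> is_derive t 1 Phi (phi t).
  move=> /andP[t0 tt1].
  have ttb : 0 < t <= t1 by rewrite t0 ltW.
  have t0' : (BRight 0 < BRight t :> itv_bound R)%O by rewrite bnd_simp.
  have := continuous_FTC1 tt1 phii t0' (phic t ttb).
  move=> [dP PE]; apply: DeriveDef; first exact: dP.
  by rewrite -derive1E.
have Phi0 t : 0 <= Phi t by apply: Rintegral_ge0 => s _; exact: mnorm_ge0.
have Phi_le t : 0 < t <= t1 -> Phi t <= Phi t1.
  move=> /andP[t0 tt1]; rewrite /Phi /Rintegral fine_le//.
  - apply: integrable_fin_num => //; apply: integrableS phii => //.
    by apply: subset_itvl; rewrite bnd_simp.
  - exact: integrable_fin_num.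
  - apply: ge0_subset_integral => //.
    + exact/measurable_EFinP.
    + by move=> x _; rewrite lee_fin mnorm_ge0.
    + by apply: subset_itvl; rewrite bnd_simp.
pose k := C1 / eps * L xi `^ eps.
have k0 : 0 <= k by rewrite mulr_ge0 ?powR_ge0// divr_ge0// ltW.
pose H t := k * t `^ eps; pose h t := k * (eps * t `^ (eps - 1)).
have Hz t : 0 < t -> H t = C1 / eps * z t xi `^ eps.
  by move=> t0; rewrite /H /k -mulrA -powRM// ltW.
have hz t : 0 < t -> h t = L xi * (C1 * z t xi `^ (eps - 1)).
  move=> t0; rewrite /h /k /zvar powRM ?ltW//.
  rewrite -(mulr_powRB1 (ltW (L0 xi)) eps0).
  have epsn0 : eps != 0 by rewrite gt_eqF.
  by field.
have Hd (t : R) : 0 < t -> is_derive t 1 H (h t).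
  move=> t0; have dp := is_derive_powR eps t0.
  have dk := @is_deriveZ _ _ _ _ k t 1 _ dp.
  by apply: is_derive_eq dk _.
have est t2 : 0 < t2 < t1 -> exists l : 'cV[K]_n.+1, u tau @[tau --> 0^'+] --> l /\
    forall t, 0 < t <= t2 -> mnorm (u t - l) <= 2 * c * (H t * mnorm l + Phi t).
  move=> /andP[t20 t21].
  have sub t : 0 < t <= t2 -> 0 < t < t1.
    by move=> /andP[-> tt2]; exact: le_lt_trans t21.
  have sub' t : 0 < t <= t2 -> 0 < t <= t1.
    by move=> /sub/andP[-> /ltW].
  apply: (@singular_ode_limit _ _ _ u (fun t => (L xi)%:C *: (E t xi *m (RPs m t xi + D t xi *m Q t xi) *m (MP t xi *m U t xi))
     + renormP ell BP MP NPs m F t xi) h H phi Phi t2) => //.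
  - by move=> t /sub'/tb[t0T _ zt]; exact: mderiv_renormP.
  - by move=> t /andP[t0 _]; exact: Hd.
  - by move=> t /sub; exact: Phid.
  - move=> t /andP[t0 _]; rewrite hz//.
    by rewrite mulr_ge0 ?(ltW (L0 xi))// mulr_ge0 ?powR_ge0.
  - by move=> t _; exact: mnorm_ge0.
  - by move=> t _; rewrite mulr_ge0 ?powR_ge0.
  - move=> t /sub'/tb[t0T zt1' zt]; apply: le_trans (ler_mnormD _ _) _.
    rewrite lerD2r hz; last by case/andP: t0T.
    rewrite mnormZr ger0_norm ?(ltW (L0 xi))// -mulrA ler_wpM2l ?(ltW (L0 xi))//.
    have [_ CB] := CQ t xi (ZP_interior t0T zt) zt1'.
    by apply: le_trans (CB _) _; rewrite /u /renormP !mulmxA.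
  - apply: le_trans small; rewrite Hz//; apply: ler_wpM2l => //.
    apply: ler_wpM2l; first by rewrite divr_ge0// ltW.
    rewrite ge0_ler_powR ?nnegrE ?(ltW eps0) ?(ltW rho10)//.
      by rewrite mulr_ge0 ?ltW.
    by have t2b : 0 < t2 <= t1 by [rewrite t20 ltW]; case: (tb t2 t2b).
have t12 : 0 < t1 / 2 < t1 by apply/andP; split; lra.
have [l [ul _]] := est (t1 / 2) t12.
exists l; split => //.
have ineq t : 0 < t -> 2 * c * (H t * mnorm l + Phi t) <=
    (2 * c * (C1 / eps) + 2 * c) * (z t xi `^ eps * mnorm l + Phi t).
  move=> t0; rewrite Hz//; have M0 : 0 <= z t xi `^ eps * mnorm l.
    by rewrite mulr_ge0 ?powR_ge0 ?mnorm_ge0.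
  have X1 := mulr_ge0 cC (Phi0 t).
  have X2 : 0 <= 2 * c * (z t xi `^ eps * mnorm l) by rewrite mulr_ge0// mulr_ge0.
  rewrite mulrDr [leRHS]mulrDl !mulrDr.
  have -> : 2 * c * (C1 / eps * z t xi `^ eps * mnorm l) = 2 * c * (C1 / eps) * (z t xi `^ eps * mnorm l) by ring.
  by lra.
have open_bound t : 0 < t < t1 -> mnorm (u t - l) <=
    (2 * c * (C1 / eps) + 2 * c) * (z t xi `^ eps * mnorm l + Phi t).
  move=> /[dup] tt1 /est[l' [ul' bl']].
  have t0 : 0 < t by case/andP: tt1.
  have ll : l' = l by exact: norm_cvg_unique ul' ul.
  rewrite ll in bl'; apply: le_trans (bl' t _) (ineq t t0).
  by rewrite t0 lexx.
move=> t /andP[t0]; rewrite le_eqVlt => /orP[/eqP ->|tt1]; last first.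
  by apply: open_bound; rewrite t0.
apply/ler_addgt0Pr => e e0.
have t1b : 0 < t1 <= t1 by rewrite t10 lexx.
have [t1T' _ zt1'] := tb t1 t1b.
have /mderiv_continuous/cvg_dnbhs_at_left/cvg_mnorm0P/(_ _ e0) uc := mderiv_renormP t1T' zt1' sol.
have : \forall s \near t1^'-, [/\ 0 < s, s < t1 & mnorm (u s - u t1) < e].
  near=> s; split; first by near: s; exact: nbhs_left_gt.
    by near: s; exact: nbhs_left_lt.
  by near: s.
move=> /filter_ex[s [s0 st1 us]].
have st1b : 0 < s <= t1 by rewrite s0 ltW.
rewrite -/(u t1) -[u t1](subrK (u s)) -addrA addrC.
apply: le_trans (ler_mnormD _ _) _; apply: lerD; last by rewrite mnormB_sym ltW.
apply: le_trans (open_bound s _) _; first by rewrite s0.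
apply: ler_wpM2l; first by rewrite addr_ge0// mulr_ge0.
apply: lerD; last exact: Phi_le.
rewrite ler_wpM2r ?mnorm_ge0// ge0_ler_powR ?nnegrE ?(ltW eps0)//.
- by rewrite mulr_ge0 ?ltW.
- by rewrite mulr_ge0 ?ltW.
- by rewrite /zvar ler_pM2l ?ltW.
Unshelve. all: by end_near. Qed.

End zone_estimate.

(** * Measurability of the renormalized source *)

Section lower_integral.
Local Open Scope ereal_scope.
Context d (T : measurableType d) (R : realType) (mu : {measure set T -> \bar R}).

(** The integral of a nonnegative function is a supremum over simple functions
    below it, hence monotone without any measurability. *)
Lemma le_lower_integral (D1 D2 : set T) (f g : T -> \bar R) :
  (forall x, D1 x -> 0 <= f x) -> (forall x, D2 x -> 0 <= g x) ->
  (forall x, D1 x -> D2 x /\ f x <= g x) ->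
  \int[mu]_(x in D1) f x <= \int[mu]_(x in D2) g x.
Proof.
move=> f0 g0 fg; rewrite !ge0_integralE//.
apply: le_ereal_sup => _ [h hf <-]; exists h => // x.
apply: le_trans (hf x) _; rewrite /patch.
case: ifPn => [/set_mem/fg[D2x fgx]|_]; first by rewrite mem_set.
by case: ifPn => // /set_mem/g0.
Qed.

End lower_integral.

Section tuple_measurability.
Context {R : realType} {d : nat}.
Local Notation mR := (measurableTypeR R).
Local Notation K := R[i].

(** Integrals live on tuples, the hypotheses on row vectors. *)
Definition time_row (p : mR * d.-tuple mR) : R * 'rV[R]_d := (p.1, row_of_tuple p.2).

Lemma measurable_box (q : R) (r : 'rV[R]_d) (e : R) :
  measurable [set p : mR * d.-tuple mR |
    ball q e p.1 /\ forall i, ball (r 0 i) e (tnth p.2 i)].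
Proof.
rewrite (_ : mkset _ = (fst @^-1` ball q e) `&`
   \bigcap_(i in [set: 'I_d]) ((fun p => tnth p.2 i) @^-1` ball (r 0 i) e)).
  apply: measurableI.
    by rewrite -[X in measurable X]setTI; apply: measurable_fst => //; exact: measurable_ball.
  apply: fin_bigcap_measurable => [|i _]; first exact: finite_finset.
  rewrite -[X in measurable X]setTI.
  apply: (measurableT_comp (measurable_tnth i) measurable_snd) => //.
  exact: measurable_ball.
by apply/seteqP; split=> [p [h1 h2]|p [h1 h2]]; split=> // i; [move=> _|]; exact: h2.
Qed.

(** Row vectors carry the topology and tuples the sigma-algebra: both are generated
    by boxes, and countably many rational boxes exhaust an open set. *)
Lemma measurable_time_row_open (O : set (R * 'rV[R]_d)) :
  open O -> measurable (time_row @^-1` O).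
Proof.
move=> oO.
pose box (q : R) (r : 'rV[R]_d) (e : R) := [set p : mR * d.-tuple mR |
    ball q e p.1 /\ forall i, ball (r 0 i) e (tnth p.2 i)].
(* The j-th rational box, or nothing when the open set does not contain it. *)
pose S (j : nat) : set (mR * d.-tuple mR) :=
  if unpickle j is Some (q, r, k) then
    let B := box (ratr q) (map_mx ratr (r : 'rV[rat]_d)) k.+1%:R^-1 in
    if `[< B `<=` time_row @^-1` O >] then B else set0
  else set0.
rewrite (_ : _ @^-1` _ = \bigcup_j S j).
  apply: bigcupT_measurable => j; rewrite /S.
  case: unpickle => [[[q r] k]|]; last exact: measurable0.
  by case: ifPn => _; [exact: measurable_box|exact: measurable0].
apply/seteqP; split; last first.
  move=> p [j _]; rewrite /S; case: unpickle => [[[q r] k]|//].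
  by case: ifPn => // /asboolP BO /BO.
move=> p Op.
have /nbhs_ballP[e /= e0 eO] : nbhs (time_row p) O by exact: open_nbhs_nbhs.
have [k ke] : exists k : nat, k.+1%:R^-1 < e / 2.
  have e20 : 0 < e / 2 by rewrite divr_gt0.
  have := @near_infty_natSinv_lt R (PosNum e20).
  by move=> [k _ /(_ k (leqnn k))/= ke]; exists k.
have k0 : 0 < k.+1%:R^-1 :> R by rewrite invr_gt0.
have ratk (x : R) : exists q : rat, ball (ratr q : R) k.+1%:R^-1 x.
  have xk : x - k.+1%:R^-1 < x + k.+1%:R^-1 by rewrite ltrBlDr -addrA ltrDl addr_gt0.
  have [q] := rat_in_itvoo xk.
  rewrite in_itv/= => /andP[q1 q2]; exists q; rewrite /ball/= ltr_norml.
  by move: (k.+1%:R^-1 : R) q1 q2 => kk q1 q2; apply/andP; split; lra.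
have [q qp] := ratk p.1.
have [r rp] : exists r : 'rV[rat]_d, forall i, ball (ratr (r 0 i) : R) k.+1%:R^-1 (tnth p.2 i).
  have /choice[r rp] : forall i, exists q : rat, ball (ratr q : R) k.+1%:R^-1 (tnth p.2 i).
    by move=> i; exact: ratk.
  by exists (\row_i r i) => i; rewrite mxE.
have [jj jjE] : exists j, unpickle j = Some (q, r, k) by exists (pickle (q, r, k)); exact: pickleK.
exists jj => //; rewrite /S jjE.
case: asboolP => [_|]; first by split => // i; rewrite mxE; exact: rp.
have tri (a x y : R) : ball a k.+1%:R^-1 x -> ball a k.+1%:R^-1 y -> ball x e y.
  rewrite /ball/= !ltr_norml; move: (k.+1%:R^-1 : R) ke => kk ke /andP[? ?] /andP[? ?].
  by apply/andP; split; lra.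
case=> -[x y] [/= qx ry]; apply: eO; split => /=; first exact: tri qp qx.
split => // i i'; rewrite !mxE; apply: tri (rp i') _.
by have := ry i'; rewrite mxE.
Qed.

Lemma measurable_continuous_within (V : set (R * 'rV[R]_d)) (f : R * 'rV[R]_d -> R) :
  measurable (time_row @^-1` V) -> {within V, continuous f} ->
  measurable_fun (time_row @^-1` V) (f \o time_row).
Proof.
move=> mV /continuousP cf; apply: (measurability _ (RGenOpens.measurableE R)).
move=> _ [_ [a [b ->] <-]].
have oI : open (`]a, b[%classic : set R) by exact: interval_open.
have /open_subspaceP[W oW WE] := cf _ oI.
rewrite (_ : _ `&` _ = time_row @^-1` (W `&` V)).
  rewrite preimage_setI; apply: measurableI => //; exact: measurable_time_row_open.
rewrite WE; apply/seteqP; split=> p /= [h1 h2]; split => //.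
Qed.

End tuple_measurability.

Section matrix_measurability.
Context {R : realType} (dsp : measure_display) (X : measurableType dsp).
Local Notation K := R[i].
Variable D : set X.

(** Measurability by real coordinates, as in the definition of Lebesgue
    measurability of vector-valued functions used in the statement. *)
Definition mx_measurable m p (G : X -> 'M[K]_(m, p)) :=
  forall i j, measurable_fun D (fun x => complex.Re (G x i j)) /\
              measurable_fun D (fun x => complex.Im (G x i j)).

Lemma mx_measurable_cst m p (A : 'M[K]_(m, p)) : mx_measurable (fun=> A).
Proof. by move=> i j; split; exact: measurable_cst. Qed.

Lemma mx_measurableD m p (F G : X -> 'M[K]_(m, p)) :
  mx_measurable F -> mx_measurable G -> mx_measurable (fun x => F x + G x).
Proof.
move=> mF mG i j; have [F1 F2] := mF i j; have [G1 G2] := mG i j; split.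
- rewrite (_ : (fun _ => _) = (fun x => complex.Re (F x i j)) \+ (fun x => complex.Re (G x i j))).
    exact: measurable_funD.
  by apply/funext => x; rewrite mxE raddfD.
- rewrite (_ : (fun _ => _) = (fun x => complex.Im (F x i j)) \+ (fun x => complex.Im (G x i j))).
    exact: measurable_funD.
  by apply/funext => x; rewrite mxE raddfD.
Qed.

Lemma mx_measurable_sum m p (I : Type) (r : seq I) (F : I -> X -> 'M[K]_(m, p)) :
  (forall i, mx_measurable (F i)) -> mx_measurable (fun x => \sum_(i <- r) F i x).
Proof.
move=> mF; elim: r => [|i r IH].
  rewrite (_ : (fun _ => _) = fun=> 0); first exact: mx_measurable_cst.
  by apply/funext => x; rewrite big_nil.
rewrite (_ : (fun _ => _) = fun x => F i x + \sum_(j <- r) F j x).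
  exact: mx_measurableD.
by apply/funext => x; rewrite big_cons.
Qed.

Lemma mx_measurableZ m p (a : X -> R) (G : X -> 'M[K]_(m, p)) :
  measurable_fun D a -> mx_measurable G -> mx_measurable (fun x => (a x)%:C *: G x).
Proof.
move=> ma mG i j; have [G1 G2] := mG i j; split.
- rewrite (_ : (fun _ => _) = a \* (fun x => complex.Re (G x i j))).
    exact: measurable_funM.
  by apply/funext => x; rewrite mxE /=; case: (G x i j) => u v /=; rewrite mul0r subr0.
- rewrite (_ : (fun _ => _) = a \* (fun x => complex.Im (G x i j))).
    exact: measurable_funM.
  by apply/funext => x; rewrite mxE /=; case: (G x i j) => u v /=; rewrite mul0r addr0.
Qed.

Lemma mx_measurableM m p q (F : X -> 'M[K]_(m, p)) (G : X -> 'M[K]_(p, q)) :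
  mx_measurable F -> mx_measurable G -> mx_measurable (fun x => F x *m G x).
Proof.
move=> mF mG i j; split.
- rewrite (_ : (fun _ => _) = fun x => \sum_k
    (complex.Re (F x i k) * complex.Re (G x k j) - complex.Im (F x i k) * complex.Im (G x k j))).
    apply: measurable_sum => k; have [F1 F2] := mF i k; have [G1 G2] := mG k j.
    by apply: measurable_funB; exact: measurable_funM.
  apply/funext => x; rewrite mxE raddf_sum; apply: eq_bigr => k _.
  by case: (F x i k) => a b; case: (G x k j) => c e.
- rewrite (_ : (fun _ => _) = fun x => \sum_k
    (complex.Re (F x i k) * complex.Im (G x k j) + complex.Im (F x i k) * complex.Re (G x k j))).
    apply: measurable_sum => k; have [F1 F2] := mF i k; have [G1 G2] := mG k j.
    by apply: measurable_funD; exact: measurable_funM.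
  apply/funext => x; rewrite mxE raddf_sum; apply: eq_bigr => k _.
  by case: (F x i k) => a b; case: (G x k j) => c e /=.
Qed.

Lemma mx_measurable_cvg m p (F : nat -> X -> 'M[K]_(m, p)) (G : X -> 'M[K]_(m, p)) :
  (forall k, mx_measurable (F k)) -> (forall x, D x -> F k x @[k --> \oo] --> G x) ->
  mx_measurable G.
Proof.
move=> mF FG i j; split.
- apply: (@measurable_fun_cvg _ _ _ _ (fun k x => complex.Re (F k x i j))).
    by move=> k; case: (mF k i j).
  by move=> x Dx; apply: cvg_mx_Re; exact: FG.
- apply: (@measurable_fun_cvg _ _ _ _ (fun k x => complex.Im (F k x i j))).
    by move=> k; case: (mF k i j).
  by move=> x Dx; apply: cvg_mx_Im; exact: FG.
Qed.

(** A pointwise limit of polynomials in measurable data. *)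
Lemma mx_measurable_mexp n (B : X -> 'M[K]_n.+1) (a : X -> R) :
  mx_measurable B -> measurable_fun D a -> mx_measurable (fun x => mexp (B x) (a x)).
Proof.
move=> mB ma.
have mBk k : mx_measurable (fun x => B x ^+ k).
  elim: k => [|k IH]; first exact: mx_measurable_cst.
  rewrite (_ : (fun _ => _) = fun x => B x *m B x ^+ k); first exact: mx_measurableM.
  by apply/funext => x; rewrite exprS.
apply: (@mx_measurable_cvg _ _ (fun N x => \sum_(k < N) (a x ^+ k)%:C *: expmx_coeff 1%:M (B x) k)).
  move=> N; apply: mx_measurable_sum => k; apply: mx_measurableZ; first exact: measurable_funX.
  rewrite /expmx_coeff; apply: mx_measurableZ; first exact: measurable_cst.
  rewrite (_ : (fun _ => _) = fun x => B x ^+ k); first exact: mBk.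
  by apply/funext => x; rewrite mul1mx.
by move=> x _; exact: cvg_mexp.
Qed.

Lemma measurable_cnorm_sq m p (G : X -> 'M[K]_(m, p)) :
  mx_measurable G -> measurable_fun D (fun x => cnorm (G x) ^+ 2).
Proof.
move=> mG; rewrite (_ : (fun _ => _) = fun x => \sum_i \sum_j
    (complex.Re (G x i j) ^+ 2 + complex.Im (G x i j) ^+ 2)).
  apply: measurable_sum => i; apply: measurable_sum => j; have [G1 G2] := mG i j.
  by apply: measurable_funD; exact: measurable_funX.
apply/funext => x; rewrite /cnorm sqr_sqrtr.
  apply: eq_bigr => i _; apply: eq_bigr => j _.
  by case: (G x i j) => a b /=; rewrite sqr_sqrtr// addr_ge0 ?sqr_ge0.
by do 2 (apply: sumr_ge0 => ? _); exact: sqr_ge0.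
Qed.

End matrix_measurability.

Section zone_measurability.
Context {R : realType} {d n : nat}.
Local Notation mR := (measurableTypeR R).
Local Notation K := R[i].
Local Notation X := (mR * d.+1.-tuple mR)%type.
Variables (T : R) (ell : 'I_d.+1 -> R) (rho : R).
Local Notation V := (ZP T ell rho).

Lemma measurable_japanese dsp (Y : measurableType dsp) (D : set Y) (f : Y -> R) :
  measurable_fun D f -> measurable_fun D (fun x => japanese (f x)).
Proof.
move=> mf; rewrite (_ : (fun _ => _) = fun x => (1 + f x ^+ 2) `^ (2^-1)).
  apply: (measurableT_comp (@measurable_powR R _)).
  apply: measurable_funD; first exact: measurable_cst.
  exact: measurable_funX.
by apply/funext => x; rewrite powR12_sqrt// addr_ge0// sqr_ge0.
Qed.

Lemma measurable_bracket :
  measurable_fun setT (fun x : d.+1.-tuple mR => bracket ell (row_of_tuple x)).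
Proof.
rewrite /bracket; elim: (index_enum _) => [|i r IH].
  rewrite (_ : (fun _ => _) = fun=> 0); first exact: measurable_cst.
  by apply/funext => x; rewrite big_nil.
rewrite (_ : (fun _ => _) = (fun x : d.+1.-tuple mR => japanese (tnth x i) `^ (ell i + 1)^-1) \max
   (fun x : d.+1.-tuple mR => \big[Num.max/0]_(i <- r) japanese (row_of_tuple x 0 i) `^ (ell i + 1)^-1)).
  apply: measurable_maxr => //; apply: (measurableT_comp (@measurable_powR R _)).
  apply: measurable_japanese; exact: measurable_tnth.
by apply/funext => x; rewrite big_cons mxE.
Qed.

Lemma measurable_rnorm :
  measurable_fun setT (fun x : d.+1.-tuple mR => rnorm (row_of_tuple x)).
Proof.
rewrite (_ : (fun _ => _) = fun x : d.+1.-tuple mR => (\sum_i tnth x i ^+ 2) `^ (2^-1)).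
  apply: (measurableT_comp (@measurable_powR R _)).
  apply: measurable_sum => i; apply: measurable_funX; exact: measurable_tnth.
apply/funext => x; rewrite /rnorm powR12_sqrt; last by apply: sumr_ge0 => i _; exact: sqr_ge0.
by congr Num.sqrt; apply: eq_bigr => i _; rewrite mxE.
Qed.

Lemma measurable_weight (a : R) :
  measurable_fun setT (fun x : d.+1.-tuple mR => japanese (rnorm (row_of_tuple x)) `^ a).
Proof.
apply: (measurableT_comp (@measurable_powR R _)).
by apply: measurable_japanese; exact: measurable_rnorm.
Qed.

Lemma measurable_zvar :
  measurable_fun setT (fun p : X => zvar ell p.1 (row_of_tuple p.2)).
Proof.
apply: measurable_funM; last exact: measurable_fst.
exact: (measurableT_comp measurable_bracket measurable_snd).
Qed.

Lemma measurable_ZP : measurable (time_row @^-1` V : set X).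
Proof.
rewrite (_ : _ @^-1` _ = (fst @^-1` `]0, T]) `&`
   ((fun p : X => zvar ell p.1 (row_of_tuple p.2)) @^-1` `]-oo, rho])).
  apply: measurableI.
    by rewrite -[X in measurable X]setTI; apply: measurable_fst.
  by rewrite -[X in measurable X]setTI; apply: measurable_zvar.
by apply/seteqP; split=> p /=; rewrite !in_itv.
Qed.

Lemma mx_measurable_continuous_on m p (f : R -> 'rV[R]_d.+1 -> 'M[K]_(m, p)) :
  continuous_on V f ->
  mx_measurable (time_row @^-1` V) (fun x : X => f x.1 (row_of_tuple x.2)).
Proof.
move=> /subspace_continuousP cf i j; split.
- apply: (@measurable_continuous_within _ _ V (fun p => complex.Re (f p.1 p.2 i j))).
    exact: measurable_ZP.
  by apply/subspace_continuousP => x Vx; apply: cvg_mx_Re; exact: cf.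
- apply: (@measurable_continuous_within _ _ V (fun p => complex.Im (f p.1 p.2 i j))).
    exact: measurable_ZP.
  by apply/subspace_continuousP => x Vx; apply: cvg_mx_Im; exact: cf.
Qed.

End zone_measurability.

(** * Convergence up to the boundary of the zone *)

Section renormalized_solution.
Context {R : realType} {d n : nat}.
Local Notation K := R[i].
Local Notation matfun := (R -> 'rV[R]_d.+1 -> 'M[K]_n.+1).
Local Notation vecfun := (R -> 'rV[R]_d.+1 -> 'cV[K]_n.+1).
Local Notation mu := (@lebesgue_measure R).
Variables (T : R) (ell : 'I_d.+1 -> R) (rho aP : R).
Hypothesis ell1 : forall i, -1 < ell i.
Hypothesis rho01 : 0 < rho < 1.
Variables (A MP RP : matfun) (BP : 'rV[R]_d.+1 -> 'M[K]_n.+1).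
Variables (DPs NPs RPs : nat -> matfun) (m : nat).
Hypothesis HP : assumption_P T ell rho A aP MP BP RP.
Hypothesis HR : renormalization_P T ell rho aP BP RP DPs NPs RPs.
Variable b : R.
Hypothesis aP1 : -1 < aP.
Hypothesis BPb : forall xi, mnorm (BP xi) <= b.
Hypothesis mb : 2 * b <= m%:R * (aP + 1).
Local Notation z := (zvar ell).
Local Notation rP := (renormP ell BP MP NPs m).
Let eps := (aP + 1) / 2.

Section renormalize_in_zone.
Variables (r : R) (BH MH : matfun) (NHs : nat -> matfun) (mH : nat) (W : vecfun).
Hypothesis r01 : 0 < r < 1.
Local Notation WA := (renormalize T ell r BP MP NPs m BH MH NHs mH W).

Lemma renormalize_lt t xi : 0 < t <= T -> z t xi < r -> WA t xi = rP W t xi.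
Proof.
move=> t0T zr; rewrite /renormalize mem_set//; split; first by split=> //=; exact: ltW.
by move=> [_ /= /andP[]]; rewrite leNgt zr.
Qed.

Lemma renormalize_eq t xi : 0 < t <= T -> z t xi = r -> WA t xi = W t xi.
Proof.
move=> t0T zr; have inI : ZI T ell r (t, xi).
  split=> //=; rewrite zr lexx/= (@le_trans _ _ 1)//; first by case/andP: r01 => _ /ltW.
  by case/andP: r01 => r0 /ltW r1; rewrite invf_ge1.
rewrite /renormalize memNset; first by rewrite mem_set.
by move=> [_].
Qed.

End renormalize_in_zone.

(** Inside the zone this is [zone_estimate]. At z = r the renormalized solution is [U]
    itself, which is bounded by E Q M U since z stays away from 0; the missing smallness
    is harmless as z^eps = r^eps is then bounded below. Any r below [rho1] is allowed,
    [rho1] being at most rho / 2, so that z = r is interior to the larger zone. *)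
Lemma renormalize_estimate : exists2 rho1 : R, 0 < rho1 <= rho &
  forall r, 0 < r <= rho1 -> exists2 C : R, 0 <= C &
  forall (BH MH : matfun) (NHs : nat -> matfun) (mH : nat) (F U : vecfun),
  let UA := renormalize T ell r BP MP NPs m BH MH NHs mH U in
  let FA := renormalize T ell r BP MP NPs m BH MH NHs mH F in
  continuous_on [set p : R * 'rV[R]_d.+1 | 0 < p.1 <= T] F ->
  is_solution T A F U ->
  (forall xi, (\int[mu]_(tau in `]0%R, T]) (cnorm (FA tau xi))%:E < +oo)%E) ->
  forall t xi, 0 < t < T -> ZP T ell r (t, xi) ->
    mu.-integrable `]0%R, t] (fun tau => (mnorm (rP F tau xi))%:E) /\
    mnorm (UA t xi - lim (UA tau xi @[tau --> 0^'+])) <=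
      C * (z t xi `^ eps * mnorm (lim (UA tau xi @[tau --> 0^'+])) +
           \int[mu]_(tau in `]0%R, t]) mnorm (rP F tau xi)).
Proof.
have [C [rho1 [C0 /andP[rho10 rho1r] CQ est]]] := zone_estimate ell1 rho01 HP HR aP1 BPb mb.
have [rho0 rho_lt1] := andP rho01.
have [_ [_ Minv] _ _ _] := HP.
have [CM [CM0 CMP]] := symbol0_mnorm Minv.
exists rho1; first by rewrite rho10/=; lra.
move=> r /andP[r0 rr1].
have r01 : 0 < r < 1 by rewrite r0/=; lra.
pose C2 := CM * (2 * n.+1%:R ^+ 2 * expR (b * `|ln r|)).
have C20 : 0 <= C2 by rewrite mulr_ge0// mulr_ge0 ?expR_ge0// mulr_ge0// exprn_ge0.
exists (C + (C2 * C + (C2 + 1) * r `^ (- eps))).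
  by rewrite !addr_ge0// ?mulr_ge0 ?powR_ge0// addr_ge0.
move=> BH MH NHs mH F U UA FA cF sol FAfin t xi /andP[t0 tT] [/= _ zr].
have zlt s : 0 < s -> s < t -> z s xi < r.
  move=> s0 st; apply: lt_le_trans zr.
  by rewrite /zvar ltr_pM2l// bracket_gt0.
have zrho : z t xi < rho by lra.
have phim := measurable_mnorm_renormP ell1 m HP HR cF (introT andP (conj t0 tT)) zrho.
have phii : mu.-integrable `]0%R, t] (fun tau => (mnorm (rP F tau xi))%:E).
  apply/integrableP; split; first exact/measurable_EFinP.
  apply: (@le_lt_trans _ _ (\int[mu]_(tau in `]0%R, t]) (mnorm (rP F tau xi))%:E)%E).
    apply: le_lower_integral => [x _|x _|x xt]; first exact: abse_ge0.
      by rewrite lee_fin mnorm_ge0.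
    by split=> //; rewrite abse_EFin lee_fin ger0_norm// mnorm_ge0.
  have sub_t : (`]0%R, t[%classic : set R) `<=` `]0%R, t] by apply: subset_itvl; rewrite bnd_simp.
  have phim' := measurable_funS (measurable_itv _) sub_t phim.
  rewrite -integral_itv_bndo_bndc; last exact/measurable_EFinP.
  pose k : R := (n.+1 * 1)%:R.
  have k0 : 0 < k by rewrite ltr0n.
  (* [FA] may fail to be measurable, so k cannot be taken out of its integral: divide
     by k first, then compare lower integrals. *)
  have -> : (fun tau => (mnorm (rP F tau xi))%:E) = (fun tau => k%:E * (mnorm (rP F tau xi) / k)%:E)%E.
    by apply/funext => x; rewrite -EFinM mulrCA divff ?mulr1// gt_eqF.
  rewrite ge0_integralZl_EFin//; first last.

  - by apply/measurable_EFinP; apply: measurable_funM => //; exact: measurable_cst.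
  - by move=> x _; rewrite lee_fin divr_ge0 ?mnorm_ge0// ltW.
  apply: lte_mul_pinfty; [by rewrite lee_fin ltW|by []|].
  apply: le_lt_trans (FAfin xi); apply: le_lower_integral.
  - by move=> x _; rewrite lee_fin divr_ge0 ?mnorm_ge0// ltW.
  - by move=> x _; rewrite lee_fin cnorm_ge0.
  - move=> x /=; rewrite !in_itv/= => /andP[x0 xt].
    have xT : 0 < x <= T by rewrite x0 ltW// (lt_trans xt).
    split; first by [].
    rewrite /FA renormalize_lt//; last exact: zlt.
    by rewrite lee_fin ler_pdivrMr// mulrC ler_mnorm_cnorm.
split=> //.
have [|l [ul lest]] := est F U cF sol xi t (introT andP (conj t0 tT)) (le_trans zr rr1).
  move/integrableP: phii => [_]; apply: le_lt_trans.
  apply: le_lower_integral => [x _|x _|x xt]; first by rewrite lee_fin mnorm_ge0.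
    exact: abse_ge0.
  by split=> //; rewrite abse_EFin lee_fin ler_norm.
have UAl : UA tau xi @[tau --> 0^'+] --> l.
  apply: cvg_trans ul; apply: near_eq_cvg; near=> s.
  rewrite /UA renormalize_lt//.
    apply/andP; split; first by near: s; exact: nbhs_right_gt.
    by apply: ltW; apply: lt_trans tT; near: s; exact: nbhs_right_lt.
  apply: zlt; first by near: s; exact: nbhs_right_gt.
  by near: s; exact: nbhs_right_lt.
rewrite (norm_cvg_lim UAl).
have tb : 0 < t <= t by rewrite t0 lexx.
have Phi0 : 0 <= \int[mu]_(tau in `]0%R, t]) mnorm (rP F tau xi).
  by apply: Rintegral_ge0 => s _; exact: mnorm_ge0.
set S := z t xi `^ eps * mnorm l + _.
have S0 : 0 <= S by rewrite addr_ge0// mulr_ge0 ?powR_ge0// mnorm_ge0.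
have lS := lest t tb; rewrite -/S in lS.
move: zr; rewrite le_eqVlt => /orP[/eqP zr|zr]; last first.
  rewrite /UA renormalize_lt//; last by rewrite t0 ltW.
  apply: le_trans lS _; rewrite ler_wpM2r// lerDl addr_ge0// ?mulr_ge0// ?powR_ge0//.
  exact: addr_ge0.
have t0T : 0 < t <= T by rewrite t0 ltW.
rewrite /UA renormalize_eq//.
have Vt : ZP T ell rho (t, xi) by split=> //=; exact: ltW.
have Uu : mnorm (U t xi) <= C2 * mnorm (rP U t xi).
  have [Mu _ _ _ _] := HP.
  have -> : U t xi = invmx (MP t xi) *m (MP t xi *m U t xi).
    by rewrite mulmxA mulVmx ?mul1mx// Mu.
  apply: le_trans (ler_mnormM _ _) _; rewrite /C2 -(mulrA CM).
  apply: ler_pM; rewrite ?mnorm_ge0//; first exact: (CMP t xi Vt).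
  have Q1 : mnorm (Qmx NPs m t xi - 1%:M) <= 2^-1 by apply: CQ => //; rewrite zr.
  have := ler_mnorm_unrenorm (MP t xi *m U t xi) (- ln (z t xi)) (BPb xi) Q1.
  by rewrite normrN zr /renormP /calEP zr !mulmxA.
have lz : mnorm l <= r `^ (- eps) * S.
  rewrite powRN ler_pdivlMl ?powR_gt0// -zr /S lerDl//.
have ru : mnorm (rP U t xi) <= C * S + mnorm l.
  rewrite -[rP U t xi](subrK l); apply: le_trans (ler_mnormD _ _) _.
  by rewrite lerD2r.
apply: le_trans (ler_mnormB _ _) _.
have h1 := ler_wpM2l C20 ru.
have h2 := ler_wpM2l C20 lz.
have h3 := mulr_ge0 C0 S0.
rewrite mulrDr in h1.
have -> : (C + (C2 * C + (C2 + 1) * r `^ (- eps))) * S =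
  C * S + C2 * (C * S) + C2 * (r `^ (- eps) * S) + r `^ (- eps) * S by ring.
by lra.
Unshelve. all: by end_near. Qed.

End renormalized_solution.

(** * Weighted estimate at fixed time *)

Section cauchy_schwarz.
Context {R : realType}.
Local Notation mu := (@lebesgue_measure R).

(** Cauchy-Schwarz against the constant 1, by integrating 2 lam phi <= phi^2 + lam^2
    with lam the mean value of [phi]; the right-hand side may be infinite. *)
Lemma sqr_Rintegral_le (phi : R -> R) (t : R) : 0 < t ->
  mu.-integrable `]0%R, t] (EFin \o phi) -> (forall x, 0 <= phi x) ->
  (((\int[mu]_(x in `]0%R, t]) phi x) ^+ 2)%:E <=
    t%:E * \int[mu]_(x in `]0%R, t]) (phi x ^+ 2)%:E)%E.
Proof.
move=> t0 phii phi0; set Phi := (X in (X ^+ 2)%:E).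
have mphi : measurable_fun (`]0%R, t]%classic : set R) phi.
  by have /measurable_EFinP := measurable_int _ phii.
have PhiE : (\int[mu]_(x in `]0%R, t]) (phi x)%:E)%E = Phi%:E.
  by rewrite /Phi /Rintegral fineK//; exact: integrable_fin_num.
have Phi0 : 0 <= Phi by apply: Rintegral_ge0 => x _; exact: phi0.
pose lam := Phi / t.
have lam0 : 0 <= lam by rewrite divr_ge0// ltW.
have I0 : (0 <= \int[mu]_(x in `]0%R, t]) (phi x ^+ 2)%:E)%E.
  by apply: integral_ge0 => x _; rewrite lee_fin sqr_ge0.
have : ((2 * lam)%:E * Phi%:E <= \int[mu]_(x in `]0%R, t]) (phi x ^+ 2)%:E + (lam ^+ 2 * t)%:E)%E.
  rewrite -PhiE -ge0_integralZl_EFin//; first last.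
  - by rewrite mulr_ge0.
  - exact/measurable_EFinP.
  - by move=> x _; rewrite lee_fin.
  have <- : (\int[mu]_(x in `]0%R, t]) (lam ^+ 2)%:E = (lam ^+ 2 * t)%:E)%E.
    rewrite integral_cst//= lebesgue_measure_itv/= lte_fin t0.
    by rewrite sube0 -EFinM.
  rewrite -ge0_integralD//; first last.
  - by move=> x _; rewrite lee_fin sqr_ge0.
  - by apply/measurable_EFinP; exact: measurable_funX.
  - by move=> x _; rewrite lee_fin sqr_ge0.
  apply: le_lower_integral.
  - by move=> x _; rewrite mule_ge0 ?lee_fin// mulr_ge0.
  - by move=> x _; rewrite -EFinD lee_fin addr_ge0 ?sqr_ge0.
  - move=> x xt; split=> //; rewrite -EFinM -EFinD lee_fin.
    by have := sqr_ge0 (phi x - lam); rewrite sqrrB; lra.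
case: (\int[mu]_(x in `]0%R, t]) (phi x ^+ 2)%:E)%E I0 => [I|_ _|//].
  rewrite lee_fin => I0; rewrite -EFinM -EFinD lee_fin -EFinM lee_fin => h.
  have lamt : lam * t = Phi by rewrite /lam -mulrA mulVf ?mulr1// gt_eqF.
  have := ler_wpM2l (ltW t0) h.
  have -> : t * (2 * lam * Phi) = 2 * Phi ^+ 2 by rewrite -lamt; ring.
  have -> : t * (I + lam ^+ 2 * t) = t * I + Phi ^+ 2 by rewrite -lamt; ring.
  by lra.
by rewrite gt0_muley ?leey// lte_fin.
Qed.

End cauchy_schwarz.

Section weighted_estimate.
Context {R : realType} {d n : nat}.
Local Notation K := R[i].
Local Notation mu := (@lebesgue_measure R).
Variable ell : 'I_d.+1 -> R.
Hypothesis ell1 : forall i, -1 < ell i.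
Local Notation z := (zvar ell).
Local Notation J xi := (japanese (rnorm xi)).

(** Where the loss [delta] is spent: z^eps is small only when <xi>^kappa t is, and
    lowering the exponent of z to eta <= delta / kappa turns the frequency growth into
    <xi>^delta, leaving a power of t that is uniform in [xi]. *)
Lemma weight_tradeoff (eps delta kappa : R) : 0 < eps -> 0 < delta -> 0 < kappa ->
  (forall xi, bracket ell xi <= J xi `^ kappa) ->
  exists2 eta : R, 0 < eta & forall t xi, 0 < t -> z t xi <= 1 ->
    z t xi `^ (2 * eps) <= t `^ (2 * eta) * J xi `^ (2 * delta).
Proof.
move=> eps0 delta0 kappa0 LJ.
pose eta := Num.min eps (delta / kappa).
have eta0 : 0 < eta by rewrite lt_min eps0 divr_gt0.
exists eta => // t xi t0 z1.
have L0 : 0 < bracket ell xi by exact: bracket_gt0.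
have z0 : 0 < z t xi by rewrite mulr_gt0.
have J1 : 1 <= J xi by exact: japanese_ge1.
apply: (@le_trans _ _ (z t xi `^ (2 * eta))).
  by rewrite ger_powR ?z0// ler_wpM2l// ge_min lexx.
rewrite /zvar [bracket ell xi * t]mulrC powRM ?(ltW t0) ?(ltW L0)// ler_wpM2l ?powR_ge0//.
apply: (@le_trans _ _ ((J xi `^ kappa) `^ (2 * eta))).
  by rewrite ge0_ler_powR ?nnegrE ?powR_ge0 ?(ltW L0)// mulr_ge0// ltW.
rewrite -powRrM ler_powR// mulrCA ler_wpM2l// mulrC -ler_pdivlMr//.
by rewrite ge_min lexx orbT.
Qed.

(** The source term needs no loss of weight: Cauchy-Schwarz in time already gives the
    factor t. *)
Lemma weighted_sq_estimate (s delta eps eta C t : R) (xi : 'rV[R]_d.+1)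
    (v l : 'cV[K]_n.+1) (f : R -> 'cV[K]_n.+1) :
  0 < delta -> 0 <= C -> 0 < t -> z t xi <= 1 ->
  z t xi `^ (2 * eps) <= t `^ (2 * eta) * J xi `^ (2 * delta) ->
  mu.-integrable `]0%R, t] (fun tau => (mnorm (f tau))%:E) ->
  mnorm (v - l) <= C * (z t xi `^ eps * mnorm l + \int[mu]_(tau in `]0%R, t]) mnorm (f tau)) ->
  let k : R := 2 * C ^+ 2 * n.+1%:R ^+ 2 in
  (weighted_sq (s - delta) xi (v - l) <=
    (k * t `^ (2 * eta))%:E * weighted_sq s xi l +
    (k * t)%:E * \int[mu]_(tau in `]0%R, t]) weighted_sq s xi (f tau))%E.
Proof.
move=> delta0 C0 t0 z1 trade fi vl /=; set Phi := (X in _ <= _ * (_ + X)) in vl.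
have J1 : 1 <= J xi by exact: japanese_ge1.
have J0 : 0 < J xi by exact: lt_le_trans J1.
pose N : R := n.+1%:R.
have N0 : 0 < N by rewrite ltr0n.
have mnc (w : 'cV[K]_n.+1) : mnorm w <= N * cnorm w.
  by apply: le_trans (ler_mnorm_cnorm w) _; rewrite muln1.
set ws := J xi `^ (2 * s).
have ws0 : 0 <= ws by exact: powR_ge0.
have wE : J xi `^ (2 * (s - delta)) = ws * J xi `^ (- (2 * delta)).
  by rewrite -powRD_gt0// mulrBr.
set wd := J xi `^ (- (2 * delta)) in wE.
have wd0 : 0 <= wd by exact: powR_ge0.
have wd1 : wd <= 1.
  by rewrite /wd powRN invf_le1 ?powR_gt0// -[leLHS](powRr0 (J xi)) ler_powR// mulr_ge0// ltW.
set a := z t xi `^ eps * mnorm l in vl.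
have a0 : 0 <= a by rewrite mulr_ge0 ?powR_ge0 ?mnorm_ge0.
have Phi0 : 0 <= Phi by apply: Rintegral_ge0 => x _; exact: mnorm_ge0.
have sq : cnorm (v - l) ^+ 2 <= 2 * C ^+ 2 * (a ^+ 2 + Phi ^+ 2).
  apply: (@le_trans _ _ ((C * (a + Phi)) ^+ 2)).
    rewrite lerXn2r ?nnegrE ?cnorm_ge0 ?mulr_ge0 ?addr_ge0//.
    exact: le_trans (ler_cnorm_mnorm _) vl.
  have -> : 2 * C ^+ 2 * (a ^+ 2 + Phi ^+ 2) = C ^+ 2 * (2 * (a ^+ 2 + Phi ^+ 2)) by ring.
  rewrite exprMn ler_wpM2l ?sqr_ge0//.
  by have := sqr_ge0 (a - Phi); rewrite sqrrB sqrrD; lra.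
have aw : wd * a ^+ 2 <= N ^+ 2 * (t `^ (2 * eta) * cnorm l ^+ 2).
  have aE : a ^+ 2 = z t xi `^ (2 * eps) * mnorm l ^+ 2.
    by rewrite /a exprMn -(powR_mulrn _ (powR_ge0 _ _)) -powRrM [eps * _]mulrC.
  rewrite aE mulrA.
  apply: (@le_trans _ _ (t `^ (2 * eta) * (N * cnorm l) ^+ 2)); last first.
    by rewrite exprMn mulrCA.
  have hz : wd * z t xi `^ (2 * eps) <= t `^ (2 * eta).
    apply: le_trans (ler_wpM2l wd0 trade) _.
    by rewrite mulrCA /wd -powRD_gt0// addNr powRr0 mulr1.
  apply: ler_pM => //; [by rewrite mulr_ge0 ?powR_ge0|exact: sqr_ge0|].
  by rewrite lerXn2r ?nnegrE ?mnorm_ge0// mulr_ge0 ?cnorm_ge0// ltW.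
have Pw : ((ws * Phi ^+ 2)%:E <= (N ^+ 2 * t)%:E * \int[mu]_(tau in `]0%R, t]) weighted_sq s xi (f tau))%E.
  have := @sqr_Rintegral_le R (fun tau => mnorm (f tau)) t t0 fi (fun=> mnorm_ge0 _).
  rewrite -/Phi => CS.
  have mphi : measurable_fun (`]0%R, t]%classic : set R) (fun tau => mnorm (f tau)).
    by have /measurable_EFinP := measurable_int _ fi.
  have wI : (ws%:E * \int[mu]_(tau in `]0%R, t]) (mnorm (f tau) ^+ 2)%:E <=
      (N ^+ 2)%:E * \int[mu]_(tau in `]0%R, t]) weighted_sq s xi (f tau))%E.
    have -> : (fun tau => (mnorm (f tau) ^+ 2)%:E) =
        (fun tau => (N ^+ 2)%:E * (mnorm (f tau) ^+ 2 / N ^+ 2)%:E)%E.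
      by apply/funext => x; rewrite -EFinM mulrCA divff ?mulr1// gt_eqF// exprn_gt0.
    have mq : measurable_fun (`]0%R, t]%classic : set R) (fun tau => mnorm (f tau) ^+ 2 / N ^+ 2).
      by apply: measurable_funM; [exact: measurable_funX|exact: measurable_cst].
    have q0 x : 0 <= mnorm (f x) ^+ 2 / N ^+ 2 by rewrite divr_ge0 ?sqr_ge0.
    rewrite ge0_integralZl_EFin//; first last.
    - by rewrite sqr_ge0.
    - exact/measurable_EFinP.
    - by move=> x _; rewrite lee_fin.
    rewrite muleCA; apply: lee_wpmul2l; first by rewrite lee_fin sqr_ge0.
    rewrite -ge0_integralZl_EFin//; first last.
    - exact/measurable_EFinP.
    - by move=> x _; rewrite lee_fin.
    apply: le_lower_integral.
    - by move=> x _; rewrite -EFinM lee_fin mulr_ge0.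
    - by move=> x _; rewrite lee_fin mulr_ge0 ?powR_ge0 ?sqr_ge0.
    - move=> x xt; split=> //; rewrite -EFinM lee_fin ler_wpM2l//.
      rewrite ler_pdivrMr ?exprn_gt0// mulrC -exprMn.
      by rewrite lerXn2r ?nnegrE ?mnorm_ge0// mulr_ge0 ?cnorm_ge0// ltW.
  rewrite EFinM; apply: le_trans (lee_wpmul2l _ CS) _; first by rewrite lee_fin.
  rewrite muleCA; apply: le_trans (lee_wpmul2l _ wI) _; first by rewrite lee_fin ltW.
  by rewrite muleA -EFinM mulrC.
have C20 : 0 <= 2 * C ^+ 2 by rewrite mulr_ge0 ?sqr_ge0.
rewrite {1}/weighted_sq wE.
apply: (@le_trans _ _ ((2 * C ^+ 2 * N ^+ 2 * t `^ (2 * eta) * (ws * cnorm l ^+ 2))%:E +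
   (2 * C ^+ 2)%:E * (ws * Phi ^+ 2)%:E)%E).
  rewrite -EFinM -EFinD lee_fin.
  apply: le_trans (ler_wpM2l (mulr_ge0 ws0 wd0) sq) _.
  have -> : ws * wd * (2 * C ^+ 2 * (a ^+ 2 + Phi ^+ 2)) =
    2 * C ^+ 2 * ws * (wd * a ^+ 2) + 2 * C ^+ 2 * (ws * (wd * Phi ^+ 2)) by ring.
  apply: lerD.
    apply: le_trans (ler_wpM2l (mulr_ge0 C20 ws0) aw) _.
    by rewrite le_eqVlt; apply/orP; left; apply/eqP; ring.
  apply: ler_wpM2l => //; apply: ler_wpM2l => //.
  by rewrite ler_piMl ?sqr_ge0.
apply: leeD; first by rewrite /weighted_sq -EFinM.
have -> : ((2 * C ^+ 2 * n.+1%:R ^+ 2 * t)%:E = (2 * C ^+ 2)%:E * (N ^+ 2 * t)%:E)%E.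
  by rewrite -EFinM /N; congr (_%:E); ring.
by rewrite -muleA; apply: lee_wpmul2l; [rewrite lee_fin|exact: Pw].
Qed.

End weighted_estimate.

Section measurable_energy.
Context {R : realType} {d n : nat}.
Local Notation mR := (measurableTypeR R).
Local Notation K := R[i].
Local Notation X := (mR * d.+1.-tuple mR)%type.
Local Notation matfun := (R -> 'rV[R]_d.+1 -> 'M[K]_n.+1).
Local Notation vecfun := (R -> 'rV[R]_d.+1 -> 'cV[K]_n.+1).

Lemma measurable_weighted_sq dsp (Y : measurableType dsp) (D : set Y) (s : R)
    (x : Y -> d.+1.-tuple mR) (v : Y -> 'cV[K]_n.+1) :
  measurable_fun D x -> mx_measurable D v ->
  measurable_fun D (fun y => weighted_sq s (row_of_tuple (x y)) (v y)).
Proof.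
move=> mx mv; apply/measurable_EFinP; apply: measurable_funM.
  exact: (measurableT_comp (measurable_weight (2 * s)) mx).
exact: measurable_cnorm_sq.
Qed.

Variables (T : R) (ell : 'I_d.+1 -> R) (rho aP : R).
Variables (A MP RP : matfun) (BP : 'rV[R]_d.+1 -> 'M[K]_n.+1).
Variables (DPs NPs RPs : nat -> matfun) (m : nat).
Hypothesis HP : assumption_P T ell rho A aP MP BP RP.
Hypothesis HR : renormalization_P T ell rho aP BP RP DPs NPs RPs.

(** M, N, B and F are jointly continuous on the zone, and E is a limit of polynomials
    in B and log z. *)
Lemma mx_measurable_renormP (F : vecfun) :
  continuous_on [set p : R * 'rV[R]_d.+1 | 0 < p.1 <= T] F ->
  mx_measurable (time_row @^-1` ZP T ell rho)
    (fun p : X => renormP ell BP MP NPs m F p.1 (row_of_tuple p.2)).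
Proof.
move=> cF; have mV := measurable_ZP T ell rho.
have [_ [[cM _] _] [[cB _] _] _ _] := HP; have [_ HR'] := HR.
have mc q p (f : R -> 'rV[R]_d.+1 -> 'M[K]_(q, p)) : continuous_on (ZP T ell rho) f ->
    mx_measurable (time_row @^-1` ZP T ell rho) (fun x : X => f x.1 (row_of_tuple x.2)).
  exact: mx_measurable_continuous_on.
apply: mx_measurableM; last first.
  by apply: mc; apply: continuous_subspaceW cF => p [].
apply: mx_measurableM; last exact: mc.
apply: mx_measurableM.
  apply: (@mx_measurable_mexp _ _ _ _ n (fun x => BP (row_of_tuple x.2))
    (fun x => - ln (zvar ell x.1 (row_of_tuple x.2)))); first exact: (mc _ _ (fun _ xi => BP xi)).
  apply: measurableT_comp => //; apply: measurableT_comp => //.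
  exact: measurable_funTS (measurable_zvar ell).
apply: mx_measurableD; first by move=> i j; split; exact: measurable_cst.
rewrite (_ : (fun _ => _) = fun x : X => \sum_(0 <= k < m) NPs k.+1 x.1 (row_of_tuple x.2)).
  apply: mx_measurable_sum => // k; apply: mc.
  by have [_ _ [cN _] _ _] := HR' k.+1 isT.
by apply/funext => x; rewrite big_add1.
Qed.

Lemma measurable_weighted_renormP (F : vecfun) (s : R) :
  continuous_on [set p : R * 'rV[R]_d.+1 | 0 < p.1 <= T] F ->
  measurable_fun (time_row @^-1` ZP T ell rho)
    (fun p : X => weighted_sq s (row_of_tuple p.2)
       (renormP ell BP MP NPs m F p.1 (row_of_tuple p.2))).
Proof.
move=> cF; have mV := measurable_ZP T ell rho.
apply/measurable_EFinP; apply: measurable_funM; last first.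
  by apply: measurable_cnorm_sq; exact: mx_measurable_renormP.
apply: (measurableT_comp (measurable_weight (2 * s))).
exact: measurable_funTS.
Qed.

End measurable_energy.

(** * Choice of parameters and conclusion *)

Section limit_zero.
Context {R : realType}.

Lemma cvg_vanishing_bound (a b eta : R) : 0 < eta ->
  ((a * t `^ eta + b * t)%:E @[t --> (0:R)^'+] --> 0%E).
Proof.
move=> eta0; apply: cvg_EFin; first exact: nearW.
have h : a * t `^ eta + b * t @[t --> (0:R)^'+] --> a * 0 + b * 0.
  apply: cvgD; (apply: cvgM; first exact: cvg_cst); first exact: powR_cvg0.
  exact: (cvg_at_right_filter cvg_id).
by rewrite !mulr0 addr0 in h.
Qed.

End limit_zero.

Section parameter_choice.
Context {R : realType} {d n : nat}.
Local Notation K := R[i].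

(** The order [m] has to satisfy 2 b <= m (a + 1) for some bound b of the norm
    of [B]; the smallness of the remainder then survives the conjugation by E. *)
Definition renormalization_order (a : R) (B : 'rV[R]_d.+1 -> 'M[K]_n.+1) : nat :=
  xget 0%N [set m : nat | exists b : R,
    (forall xi, mnorm (B xi) <= b) /\ 2 * b <= m%:R * (a + 1)].

Lemma renormalization_orderP (a : R) (B : 'rV[R]_d.+1 -> 'M[K]_n.+1) (m : nat) :
  -1 < a -> (exists b, forall xi, mnorm (B xi) <= b) ->
  (renormalization_order a B <= m)%N ->
  exists b : R, (forall xi, mnorm (B xi) <= b) /\ 2 * b <= m%:R * (a + 1).
Proof.
move=> a1 [b Bb] Bm; have a10 : 0 < a + 1 by lra.
have [b' [Bb' b'm]] : exists b : R, (forall xi, mnorm (B xi) <= b) /\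
    2 * b <= (renormalization_order a B)%:R * (a + 1).
  apply: (@xgetPex _ 0%N [set m : nat | exists b : R,
    (forall xi, mnorm (B xi) <= b) /\ 2 * b <= m%:R * (a + 1)]).
  exists (Num.bound (2 * b / (a + 1))), b; split=> //.
  rewrite -ler_pdivrMr//; apply: ltW; apply: archi_boundP.
  by rewrite divr_ge0 ?(ltW a10)// mulr_ge0// (le_trans (mnorm_ge0 _) (Bb 0)).
exists b'; split=> //; apply: le_trans b'm _.
by rewrite ler_wpM2r ?(ltW a10)// ler_nat.
Qed.

Lemma symbol0_bounded (T : R) (ell : 'I_d.+1 -> R) (rho : R) (B : 'rV[R]_d.+1 -> 'M[K]_n.+1) :
  0 < T -> 0 < rho -> (forall i, -1 < ell i) ->
  symbol ell (ZP T ell rho) 0 (fun _ xi => B xi) -> exists b, forall xi, mnorm (B xi) <= b.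
Proof.
move=> T0 rho0 ell1 /symbol0_mnorm[C [_ CB]]; exists C => xi.
have L0 : 0 < bracket ell xi by exact: bracket_gt0.
apply: (CB (Num.min T (rho / bracket ell xi))); split => /=.
  by rewrite lt_min T0 divr_gt0//= ge_min lexx.
by rewrite /zvar mulrC -ler_pdivlMr// ge_min lexx orbT.
Qed.

End parameter_choice.

Theorem proposition2p27 (R : realType) (d n : nat) :
  exists (mP0 : R -> ('rV[R]_d.+1 -> 'M[R[i]]_n.+1) -> nat)
         (mH0 : R -> (R -> 'rV[R]_d.+1 -> 'M[R[i]]_n.+1) -> nat),
  forall (T : R) (ell : 'I_d.+1 -> R)
    (alpha : R) (lam : R -> 'M[R]_d.+1) (lambda0 : R)
    (A : R -> 'rV[R]_d.+1 -> 'M[R[i]]_n.+1)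
    (rhobar aP aH : R)
    (BP : 'rV[R]_d.+1 -> 'M[R[i]]_n.+1)
    (MP RP MH DH BH RH : R -> 'rV[R]_d.+1 -> 'M[R[i]]_n.+1)
    (DPs NPs RPs DHs NHs RHs :
       nat -> R -> 'rV[R]_d.+1 -> 'M[R[i]]_n.+1),
  0 < T -> (forall i, -1 < ell i) ->
  0 < alpha -> lambda_form T alpha lam ->
  0 < lambda0 -> frakH_coercive T ell lam lambda0 ->
  -1 < aP -> aH < -1 ->
  0 < rhobar < 1 ->
  (forall rho, 0 < rho <= rhobar ->
     assumption_I T ell rho A /\
     assumption_P T ell rho A aP MP BP RP /\
     assumption_H T ell lam rho A aH MH DH BH RH /\
     renormalization_P T ell rho aP BP RP DPs NPs RPs /\
     renormalization_H T ell lam rho (ell_star ell) DH BH RH DHs NHs RHs /\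
     semi_strictly_hyperbolic T ell rho DH) ->
  forall mP mH : nat,
  (mP0 aP BP <= mP)%N -> (0 < mH)%N -> (mH0 (ell_star ell) BH <= mH)%N ->
  exists rho1 : R, 0 < rho1 <= rhobar /\
  forall rho : R, 0 < rho <= rho1 ->
  forall F U : R -> 'rV[R]_d.+1 -> 'cV[R[i]]_n.+1,
  continuous_on [set p : R * 'rV[R]_d.+1 | 0 < p.1 <= T] F ->
  is_solution T A F U ->
  let UA := renormalize T ell rho BP MP NPs mP BH MH NHs mH U in
  let FA := renormalize T ell rho BP MP NPs mP BH MH NHs mH F in
  let uA : 'rV[R]_d.+1 -> 'cV[R[i]]_n.+1 :=
    fun xi => lim (UA tau xi @[tau --> 0^'+]) in
  let mu_d := lebesgue_measure_tuple R d.+1 in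
  (forall xi,
     (\int[lebesgue_measure]_(tau in `]0%R, T]) (cnorm (FA tau xi))%:E < +oo)%E) ->
  lebesgue_measurable_on setT uA ->
  (forall t, 0 < t <= T ->
     lebesgue_measurable_on [set xi | ZP T ell rho (t, xi)] (UA t)) ->
  forall s : R,
  (\int[mu_d]_x weighted_sq s (row_of_tuple x) (uA (row_of_tuple x)) < +oo)%E ->
  (\int[lebesgue_measure \x mu_d]_(p in
       [set p | ZP T ell rho (p.1, row_of_tuple p.2)])
     weighted_sq s (row_of_tuple p.2)
       (renormP ell BP MP NPs mP F p.1 (row_of_tuple p.2)) < +oo)%E ->
  forall delta : R, 0 < delta ->
  (\int[mu_d]_(x in [set x | ZP T ell rho (t, row_of_tuple x)])
     weighted_sq (s - delta) (row_of_tuple x)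
       (UA t (row_of_tuple x) - uA (row_of_tuple x)))%E
    @[t --> 0^'+] --> 0%E.
Proof.
exists renormalization_order, (fun _ _ => 0%N).
move=> T ell alpha lam lambda0 A rhobar aP aH BP MP RP MH DH BH RH DPs NPs RPs DHs NHs RHs.
move=> T0 ell1 _ _ _ _ aP1 _ rhobar01 hyp mP mH mPm _ _.
have rhobar0 : 0 < rhobar by case/andP: rhobar01.
have [_ [HP [_ [HR _]]]] : _ := hyp rhobar (introT andP (conj rhobar0 (lexx _))).
have [_ _ [BPs _] _ _] := HP.
have [b [BPb mb]] := renormalization_orderP aP1 (symbol0_bounded T0 rhobar0 ell1 BPs) mPm.
have [rho1 rho1P est] := renormalize_estimate ell1 rhobar01 HP HR aP1 BPb mb.
exists rho1; split=> // rho rhoP F U cF sol UA FA uA mu_d FAfin uAm _ s uAfin Ffin delta delta0.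
have {est} [C C0 /(_ BH MH NHs mH F U cF sol FAfin) est] := est rho rhoP.
have [rho0 rhor1] := andP rhoP; have [rho10 rho1r] := andP rho1P.
have rho_bar : 0 < rho <= rhobar by rewrite rho0 (le_trans rhor1).
have rho1' : rho <= 1.
  by case/andP: rhobar01 => _ r1; rewrite (le_trans rhor1)// (le_trans rho1r)// ltW.
have {HP HR BPs} [_ [HP [_ [HR _]]]] := hyp rho rho_bar.
have eps0 : 0 < (aP + 1) / 2 by rewrite divr_gt0//; lra.
have [kappa kappa0 LJ] := bracket_le_japanese ell1.
have [eta eta0 trade] := weight_tradeoff ell1 eps0 delta0 kappa0 LJ.
pose k : R := 2 * C ^+ 2 * n.+1%:R ^+ 2.
have k0 : 0 <= k by rewrite mulr_ge0 ?sqr_ge0// mulr_ge0 ?sqr_ge0.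
have ws0 q xi (v : 'cV[R[i]]_n.+1) : (0 <= weighted_sq q xi v)%E.
  by rewrite lee_fin mulr_ge0 ?powR_ge0 ?sqr_ge0.
have [g [gm [N [mN N0 gN]]]] := uAm.
have gE x : ~ N x -> uA (row_of_tuple x) = g x.
  by move=> Nx; apply: contrapT => ne; apply: Nx; apply: gN => /(_ Logic.I).
pose Wg x := weighted_sq s (row_of_tuple x) (g x).
have mWg : measurable_fun setT Wg.
  apply: (@measurable_weighted_sq _ _ _ _ _ _ s id g) => //.
  by move=> i j; rewrite ord1; exact: gm.
have Wgfin : (\int[mu_d]_x Wg x < +oo)%E.
  rewrite (@ge0_negligible_integral _ _ _ _ _ N)//; last by move=> x _; exact: ws0.
  apply: le_lt_trans uAfin; apply: le_lower_integral => [x _|x _|x [_ Nx]].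
  - exact: ws0.
  - exact: ws0.
  - by split=> //; rewrite gE.
pose V := [set p : measurableTypeR R * d.+1.-tuple (measurableTypeR R) |
  ZP T ell rho (p.1, row_of_tuple p.2)].
have mV : measurable V := measurable_ZP T ell rho.
pose h := (fun p => weighted_sq s (row_of_tuple p.2)
  (renormP ell BP MP NPs mP F p.1 (row_of_tuple p.2))) \_ V.
have mh : measurable_fun setT h.
  have mh0 := measurable_weighted_renormP mP HP HR s cF.
  exact: ((measurable_restrictT _ mV).1 mh0).
have h0 p : (0 <= h p)%E by rewrite /h /patch; case: ifPn.
pose G y := (\int[lebesgue_measure]_tau h (tau, y))%E.
have mG : measurable_fun setT G := measurable_fun_fubini_tonelli_G _ mh h0.
have G0 y : (0 <= G y)%E by apply: integral_ge0.
have Gfin : (\int[mu_d]_y G y < +oo)%E.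
  rewrite -(@fubini_tonelli2 _ _ _ _ _ lebesgue_measure mu_d h mh h0).
  by move: Ffin; rewrite integral_mkcond.
have [a aE] : exists a, (\int[mu_d]_x Wg x = a%:E)%E.
  exists (fine (\int[mu_d]_x Wg x)%E); rewrite fineK// ge0_fin_numE//.
  by apply: integral_ge0 => x _; exact: ws0.
have [c cE] : exists c, (\int[mu_d]_x G x = c%:E)%E.
  exists (fine (\int[mu_d]_x G x)%E); rewrite fineK// ge0_fin_numE//.
  by apply: integral_ge0 => x _; exact: G0.
apply: (@squeeze_cvge _ _ _ _ (fun=> 0%E) _
  (fun t => (k * a * t `^ (2 * eta) + k * c * t)%:E)); first last.
- by apply: cvg_vanishing_bound; rewrite mulr_gt0.
- exact: cvg_cst.
near=> t.
have t0 : 0 < t by near: t; exact: nbhs_right_gt.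
have tT : t < T by near: t; exact: nbhs_right_lt.
apply/andP; split; first by apply: integral_ge0.
pose kap x := ((k * t `^ (2 * eta))%:E * Wg x + (k * t)%:E * G x)%E.
have kt0 : 0 <= k * t `^ (2 * eta) by rewrite mulr_ge0 ?powR_ge0.
have kt1 : 0 <= k * t by rewrite mulr_ge0// ltW.
have mkap : measurable_fun setT kap.
  apply: emeasurable_funD.
    by apply: emeasurable_funM => //; exact: measurable_cst.
  by apply: emeasurable_funM => //; exact: measurable_cst.
have Wg0 x : (0 <= Wg x)%E by exact: ws0.
have kap0 x : (0 <= kap x)%E.
  by apply: adde_ge0; apply: mule_ge0; rewrite ?Wg0 ?G0// lee_fin.
(* An infinite value on the null set where [uA] and its Borel version differ makes
   the comparison hold at every point. *)
pose kap' x := if x \in N then +oo%E else kap x.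
have mkap' : measurable_fun setT kap'.
  apply: measurable_fun_ifT; [|exact: measurable_cst|exact: mkap].
  apply: (measurable_fun_bool true); rewrite setTI (_ : _ @^-1` _ = N)//.
  by apply/seteqP; split=> x /=; [move/set_mem|move/mem_set].
have kap'0 x : (0 <= kap' x)%E by rewrite /kap'; case: ifPn.
apply: (@le_trans _ _ (\int[mu_d]_x kap' x)%E).
  apply: le_lower_integral => [x _|x _|x Zx] //; split=> //.
  rewrite /kap'; case: ifPn => [_|/negP Nx]; first by rewrite leey.
  have {}Nx : ~ N x by move=> ?; apply: Nx; rewrite inE.
  have [fi ineq] := est t (row_of_tuple x) (introT andP (conj t0 tT)) Zx.
  rewrite -/(uA (row_of_tuple x)) in ineq.
  have z1 : zvar ell t (row_of_tuple x) <= 1 by case: Zx => _ /le_trans; apply.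
  have W1 := weighted_sq_estimate s delta0 C0 t0 z1 (trade _ _ t0 z1) fi ineq.
  apply: le_trans W1 _.
  rewrite /kap /Wg -gE//; apply: leeD => //; apply: lee_wpmul2l; first by rewrite lee_fin.
  apply: le_lower_integral => [y _|y _|y] //.
  rewrite /= in_itv/= => /andP[y0 yt]; split=> //.
  rewrite /h /patch mem_set//; case: Zx => /= _ zt; split => /=.
    by rewrite y0 (le_trans yt)// ltW.
  by apply: le_trans zt; rewrite /zvar ler_pM2l// bracket_gt0.
rewrite (@ge0_ae_eq_integral _ _ _ mu_d setT kap' kap)//; last first.
  exists N; split=> // x /= nx; apply: contrapT => Nx; apply: nx => _.
  by rewrite /kap' memNset.
rewrite ge0_integralD//; first last.
- by apply: emeasurable_funM => //; exact: measurable_cst.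
- by move=> x _; apply: mule_ge0; rewrite ?G0// lee_fin.
- by apply: emeasurable_funM => //; exact: measurable_cst.
- by move=> x _; apply: mule_ge0; rewrite ?Wg0// lee_fin.
rewrite ge0_integralZl_EFin//.
rewrite ge0_integralZl_EFin// aE cE -!EFinM -EFinD lee_fin.
by rewrite le_eqVlt; apply/orP; left; apply/eqP; ring.
Unshelve. all: by end_near. Qed.
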